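(* Let $\mu=(\mu_j)_{j\ge1}$ be a sequence of reals with $0<\mu_1\le\mu_2\le\cdots$, $\mu_j\ge j$ for all $j\ge1$, and $\sum_{j\ge1}1/\mu_j=\infty$, and let $M_0>0$. Let $L\subseteq\mathbb R^n$ be a convex body and $K\in\mathscr K(\mathbb R^n)$ with $K\subseteq L$. There is a constant $\nu_K\in(0,1]$ depending only on $K$ (in particular not on $\mu,M_0,L,b_0,f,E$ below) such that the following holds. Let $b_0\in(0,M_0)$. Then for each $(\mu^{|\infty},M_0)$-smooth function $f:L\to\mathbb R$ with $\|f\|_K\ge b_0$ and each Lebesgue measurable set $E\subseteq K$ with $|E|>0$, $$\|f\|_K\le \mathbf C_{\mathbf N}\,\Big(\frac{|K|^{\nu_K}}{|K|^{\nu_K}-(|K|-|E|)^{\nu_K}}\Big)^{\mathbf N}\,\|f\|_E,$$ where $\mathbf N=2\,\mathbf D_{a_K\mu}(b_0/M_0)$ and $\mathbf C_{\mathbf N}$ is a constant depending only on $\mathbf N$ and $\mu$ (given explicitly in the context).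
   Context: $|E|$ denotes Lebesgue measure; $\|f\|_E:=\sup_{x\in E}|f(x)|$. A convex body is a compact convex set with nonempty interior. Smoothness. Put $M_j=M_0\mu_1\cdots\mu_j$ for $j\ge1$. A function $f:L\to\mathbb R$ on a nonempty compact set $L\subseteq\mathbb R^n$ is $(\mu^{|\infty},M_0)$-smooth if it is of class $C^\infty$ (in some open neighborhood of $L$) and $\sup_{x\in L}\sum_{|\alpha|=j}\frac{j!}{\alpha!}|\partial^\alpha f(x)|\le M_j$ for all $j\ge0$. Bang degree. For an increasing positive sequence $\lambda=(\lambda_j)_{j\ge1}$ and $b>0$ put $\mathbf D_{\lambda}(b):=\sup\{k\in\mathbb N:\sum_{j=j_0(b)+1}^k 1/\lambda_j<e\}$, where $j_0(b)$ is the smallest nonnegative integer $j\ge\log(b^{-1})$ (empty sums are $0$). Here $a_K\mu=(a_K\mu_j)_{j\ge1}$. The constant $\mathbf C_{\mathbf N}$. Fix an increasing continuous, (piecewise) $C^1$ function $\tilde\mu:[1,\infty)\to(0,\infty)$ with $\tilde\mu(j)=\mu_j$ for all integers $j\ge1$ (left derivatives are used at points of nondifferentiability), put $\gamma_{\tilde\mu}(k):=\sup_{1\le s\le k}\frac{s\tilde\mu'(s)}{\tilde\mu(s)}$, and $\mathbf C_{\mathbf N}:=(4e^{4+\gamma_{\tilde\mu}(\mathbf N)})^{\mathbf N}$. Admissible sets. A family $(K_w,a_w,\Upsilon_w)_{w\in W}$, where $W$ is any set, $K_w\subseteq[0,1]^n$ is compact, $a_w\in K_w$, and $\Upsilon_w:[0,\infty)^n\to\mathbb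 R^n$ is a map, is an admissible collection of degree $d\in\mathbb N_{\ge1}$ if there are constants $\delta_1,\delta_2,\delta_3>0$, $q\in\mathbb N_{\ge1}$ and polynomial maps $R_w:\mathbb R^n\to\mathbb R^n$ of degree at most $d$ such that for all $w\in W$: (1) $K_w$ is star-shaped with respect to $a_w$ and $|K_w|\ge\delta_1$; (2) $\Upsilon_w(x_1,\dots,x_n)=R_w(x_1^{1/q},\dots,x_n^{1/q})$; (3) $\delta_2\le\sum_\kappa|c_{w,\kappa}|\le\delta_3$, where $c_{w,\kappa}$ are the coefficients of the polynomial $\operatorname{Jac}(R_w)$ (the Jacobian determinant); (4) writing $a_w=(a_{w,1},\dots,a_{w,n})$, $a_{w,i}=0$ whenever $\Upsilon_w$ is not a polynomial map with respect to the variable $x_i$. A nonempty compact set $K\subseteq\mathbb R^n$ is admissible (of degree $d$) if there is an admissible collection (of degree $d$) $(K_w,a_w,\Upsilon_w)_{w\in K}$ indexed by $K$ with $\Upsilon_w(a_w)=w$ for each $w\in K$ and $K=\bigcup_{w\in K}\Upsilon_w(K_w)$. $\mathscr K(\mathbb R^n)$ is the family of all admissible sets. For each $K\in\mathscr K(\mathbb R^n)$ such a collection and its degree $d$ are fixed, and $$a_K:=4\,\tfrac{(d+1)^{d+1}}{(d-1)^{d-1}}\max\{\operatorname{diam}(K),1\}\ \text{ if }d\ge2,\qquad a_K:=\operatorname{diam}(K)\ \text{ if }d=1.$$ *)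

(* Defs.v *)
From HB Require Import structures.
From mathcomp Require Import all_boot all_order all_algebra.
From mathcomp Require Import all_classical all_reals all_analysis.
(* The notations of mpoly clash with those of MathComp-Analysis. *)
From mathcomp Require Import -(notations) mpoly.

Set Implicit Arguments.
Unset Strict Implicit.
Unset Printing Implicit Defensive.

Import Order.TTheory GRing.Theory Num.Theory.
Import numFieldNormedType.Exports.

Local Open Scope classical_set_scope.
Local Open Scope ring_scope.

Section geometry.
Context {R : realType} {n : nat}.
Implicit Types (A K L : set 'rV[R]_n) (x y a b : 'rV[R]_n).

(* The library norm on 'rV[R]_n is the sup norm, hence this definition. *)
Definition enorm x : R := Num.sqrt (\sum_i x 0 i ^+ 2).

Definition diam A : R :=
  sup [set r | exists x y, [/\ A x, A y & r = enorm (x - y)]].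

Definition convex_body L : Prop :=
  [/\ compact L, convex_set L & L° !=set0].

Definition star_shaped A a : Prop :=
  forall x t, A x -> 0 <= t -> t <= 1 -> A ((1 - t) *: a + t *: x).

Definition orthant : set 'rV[R]_n := [set x | forall i, 0 <= x 0 i].

Definition unit_cube : set 'rV[R]_n := [set x | forall i, 0 <= x 0 i <= 1].

Definition box a b : set 'rV[R]_n :=
  [set x | forall i, a 0 i <= x 0 i <= b 0 i].

(* The maximum gives empty boxes the volume 0. *)
Definition box_volume a b : R := \prod_i Num.max 0 (b 0 i - a 0 i).

(* Lebesgue outer measure on R^n, by countable coverings by boxes; the Lebesgue
   measurable sets are its Caratheodory measurable sets, and on them it is the
   Lebesgue measure. *)
Definition lebesgue_rV A : \bar R :=
  ereal_inf [set (\sum_(k <oo) (box_volume (c k).1 (c k).2)%:E)%E |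
    c in [set c : nat -> 'rV[R]_n * 'rV[R]_n |
          A `<=` \bigcup_k box (c k).1 (c k).2]].

Definition lebesgue_measurable A : Prop := lebesgue_rV.-caratheodory A.

(* Real-valued |A|, for A of finite measure. *)
Definition vol A : R := fine (lebesgue_rV A).

Definition supnorm A (f : 'rV[R]_n -> R) : R := sup [set `|f x| | x in A].

End geometry.

Section smoothness.
Context {R : realType} {n : nat}.
Implicit Types (f : 'rV[R]_n -> R) (U L : set 'rV[R]_n).

Definition partial (i : 'I_n) f : 'rV[R]_n -> R :=
  fun x => 'D_(delta_mx 0 i) f x.

Definition partials (s : seq 'I_n) f : 'rV[R]_n -> R := foldr partial f s.

Definition multi_partial (alpha : 'I_n -> nat) f : 'rV[R]_n -> R :=
  foldr (fun i g => iter (alpha i) (partial i) g) f (enum 'I_n).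

(* C^oo on U (meant for U open): all partial derivatives of all orders exist and
   are continuous at the points of U. *)
Definition Cinfty_on U f : Prop :=
  forall (s : seq 'I_n) x, U x ->
    {for x, continuous (partials s f)} /\
    forall i, derivable (partials s f) x (delta_mx 0 i).

(* M_j; the value mu 0 is not used. *)
Definition Mseq (mu : nat -> R) (M0 : R) (j : nat) : R :=
  M0 * \prod_(1 <= i < j.+1) mu i.

(* A function on L is represented by a total function that is C^oo near L; its
   values away from L are irrelevant.  The inner sum is over the multi-indices
   alpha with |alpha| = j, whose components are necessarily at most j. *)
Definition mu_smooth (mu : nat -> R) (M0 : R) L f : Prop :=
  (exists U, [/\ open U, L `<=` U & Cinfty_on U f]) /\
  forall (j : nat) x, L x ->
    \sum_(alpha : {ffun 'I_n -> 'I_j.+1} | (\sum_i alpha i)%N == j)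
      (j`!)%:R / (\prod_i (alpha i)`!)%:R * `|multi_partial (fun i => alpha i) f x|
    <= Mseq mu M0 j.

End smoothness.

Section bang.
Context {R : realType}.

(* The smallest nonnegative integer j >= log(1/b). *)
Definition j0 (b : R) : nat := `|Num.max 0%R (Num.ceil (ln b^-1)%R)|%N.

(* Supremum in nat; it is a maximum whenever \sum_j 1/lambda_j diverges, and
   the junk value 0 is taken if the set is unbounded. *)
Definition bang_degree (lambda : nat -> R) (b : R) : nat :=
  supremum 0%N
    [set k : nat | \sum_((j0 b).+1 <= j < k.+1) (lambda j)^-1 < expR 1].

(* Every piece of f extends to a C^1 function on the line, i.e. f is C^1 on each
   of the closed intervals [t_k, t_k+1], with one-sided derivatives at the ends;
   the breakpoints have no accumulation point. *)
Definition piecewise_C1 (f : R -> R) : Prop :=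
  exists t : nat -> R,
    [/\ t 0%N = 1, (forall i j, (i < j)%N -> t i < t j), t @ \oo --> +oo &
     forall k, exists g : R -> R,
       [/\ forall x, derivable g x 1, continuous (derive1 g) &
        {in `[t k, t k.+1], f =1 g}]].

Definition interpolant (mu : nat -> R) (mut : R -> R) : Prop :=
  [/\ forall x y, 1 <= x -> x <= y -> mut x <= mut y,
      {within `[1, +oo[, continuous mut},
      piecewise_C1 mut,
      forall x, 1 <= x -> 0 < mut x &
      forall j : nat, (1 <= j)%N -> mut j%:R = mu j].

(* Derivative of f seen as a function on [1, +oo[: the right derivative at 1,
   and the left derivative at the other points of nondifferentiability. *)
Definition deriv1 (f : R -> R) (s : R) : R :=
  if s <= 1 then lim (h^-1 * (f (s + h) - f s) @[h --> 0^'+])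
  else if `[< derivable f s 1 >] then derive1 f s
  else lim (h^-1 * (f (s + h) - f s) @[h --> 0^'-]).

Definition gamma (mut : R -> R) (k : R) : R :=
  sup [set s * deriv1 mut s / mut s | s in `[1, k]].

Definition C_ (mut : R -> R) (N : nat) : R :=
  (4 * expR (4 + gamma mut N%:R)) ^+ N.

End bang.

Section admissible.
Context {R : realType} {n : nat}.
Implicit Types (P : 'I_n -> mpoly n R) (K : set 'rV[R]_n).

(* The polynomial map R^n -> R^n with components P. *)
Definition polymap P (x : 'rV[R]_n) : 'rV[R]_n :=
  \row_j meval (fun i => x 0 i) (P j).

Definition Jac P : mpoly n R := \det (\matrix_(j, i) mderiv i (P j)).

Definition coef_norm (p : mpoly n R) : R := \sum_(m <- msupp p) `|mcoeff m p|.

Definition set_coord (i : 'I_n) (t : R) (x : 'rV[R]_n) : 'rV[R]_n :=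
  \row_j if j == i then t else x 0 j.

(* With the other variables frozen, each component is a polynomial function of
   the i-th variable. *)
Definition polynomial_in (i : 'I_n) (Y : 'rV[R]_n -> 'rV[R]_n) : Prop :=
  forall x, orthant x -> forall j, exists p : {poly R},
    forall t, 0 <= t -> Y (set_coord i t x) 0 j = p.[t].

(* Families indexed by W are total on T and only matter on W; the maps Y w only
   matter on the orthant.  mmeasure mdeg is msize, i.e. the degree plus one. *)
Definition admissible_collection (T : Type) (W : set T) (d : nat)
    (Kw : T -> set 'rV[R]_n) (aw : T -> 'rV[R]_n)
    (Y : T -> 'rV[R]_n -> 'rV[R]_n) : Prop :=
  (forall w, W w -> [/\ compact (Kw w), Kw w `<=` unit_cube & Kw w (aw w)]) /\
  exists (delta1 delta2 delta3 : R) (q : nat) (P : T -> 'I_n -> mpoly n R),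
    [/\ 0 < delta1, 0 < delta2, 0 < delta3, (1 <= q)%N &
     forall w, W w ->
       (forall j, (mmeasure mdeg (P w j) <= d.+1)%N) /\
       [/\ star_shaped (Kw w) (aw w) /\ (delta1%:E <= lebesgue_rV (Kw w))%E,
           forall x, orthant x ->
             Y w x = polymap (P w) (\row_i (x 0 i `^ (q%:R)^-1)),
           delta2 <= coef_norm (Jac (P w)) <= delta3 &
           forall i, ~ polynomial_in i (Y w) -> aw w 0 i = 0]].

Definition admissible (d : nat) K : Prop :=
  [/\ (1 <= d)%N, K !=set0, compact K &
   exists (Kw : 'rV[R]_n -> set 'rV[R]_n) (aw : 'rV[R]_n -> 'rV[R]_n)
          (Y : 'rV[R]_n -> 'rV[R]_n -> 'rV[R]_n),
     [/\ admissible_collection K d Kw aw Y,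
         forall w, K w -> Y w (aw w) = w &
         K = \bigcup_(w in K) (Y w @` Kw w)]].

(* a_K, for K admissible of degree d >= 1. *)
Definition aK (d : nat) K : R :=
  if (d <= 1)%N then diam K
  else 4 * ((d.+1)%:R ^+ d.+1 / (d.-1)%:R ^+ d.-1) * Num.max (diam K) 1.

End admissible.

(* Main.v *)
(* Let w be a point of K where |f| is maximal.  If a polynomial curve from w stays
   in L and spends in E a fraction m of the time in [0, 1], then the restriction
   of f to it satisfies the same kind of derivative bounds, with a_K mu in place
   of mu, and a one-variable argument in the style of Bang gives
   |f w| m^N <= C_N ||f||_E: interpolate f at well separated points of E, and
   follow the derivatives of the remainder through its Rolle zeros down to the
   end point w of the curve.  Such a curve is found by averaging.  If
   lam = |K \ E| / |K| is small, use the images under Y_w of the curves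
   s |-> a_w + s^q (v - a_w), which are polynomial of degree at most d because
   a_w vanishes in the variables where Y_w is not polynomial; the Jacobian bound
   makes the preimage of K \ E small, hence some v gives m >= 1 - lam^nu.  If lam
   is not small, a segment from w inside the convex set L has
   m >= c (1 - lam) >= 1 - lam^nu for nu small enough. *)
Require Import Defs.
From HB Require Import structures.
From mathcomp Require Import all_boot all_order all_algebra.
From mathcomp Require Import perm.
From mathcomp Require Import -(notations) mpoly.
From mathcomp Require Import all_classical all_reals all_analysis.
From mathcomp Require Import measurable_realfun.
From mathcomp Require Import ring lra zify.

Set Implicit Arguments.
Unset Strict Implicit.
Unset Printing Implicit Defensive.

Import Order.TTheory GRing.Theory Num.Theory.
Import numFieldNormedType.Exports.

Local Open Scope classical_set_scope.
Local Open Scope ring_scope.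

(** * A Remez inequality for quasianalytic functions on an interval *)

Section one_variable.
Context {R : realType}.
Implicit Types (f df H dH : R -> R) (x y z : R).

(** Bang's method needs a point where many derivatives are small. Here they vanish at different
    points, the Rolle zeros of G - p with p the interpolant; the descent still works because these
    zeros can be chosen nondecreasing in the order of the derivative and all to the right of the
    target. Hence w has to be an end point of the curve. The price is p itself: either its
    derivatives are negligible against the M_j, or one of them is comparable with M_j and thereby
    bounds M_0. Comparing M_j with powers of D + 1 is where the growth index of mu enters the
    constant. The Jacobian of Y_w may vanish, so preimages of small sets are small only at a
    polynomial rate: a curve misses E during a time tau as soon as lam is below a constant times
    tau^p. This is the origin of the exponent nu, of order 1/p. Along a polynomial curve of degree
    d, Markov's inequality costs d^2 times the diameter, which the factor 4 (d+1)^(d+1) /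
    (d-1)^(d-1) in a_K dominates; the assumption mu_j >= j controls the lower-order terms of the
    iterated chain rule. *)

Lemma is_derive_within_continuous f df (a b : R) :
  (forall u, a <= u <= b -> is_derive u 1 f (df u)) ->
  {within `[a, b], continuous f}.
Proof.
move=> fd; apply: derivable_within_continuous => u.
by rewrite in_itv /= => uab; have /@ex_derive := fd u uab.
Qed.

Lemma le_of_derivative_le0 f df y z : y <= z ->
  (forall u, y <= u <= z -> is_derive u 1 f (df u)) ->
  (forall u, y < u < z -> df u <= 0) -> f z <= f y.
Proof.
rewrite le_eqVlt => /predU1P[->//|yz] fd df0.
have [||c cI E] := @MVT R f df y z yz.
- by move=> u; rewrite in_itv /= => /andP[u1 u2]; apply: fd; rewrite !ltW.
- exact: is_derive_within_continuous fd.
rewrite -subr_le0 E mulr_le0_ge0 ?subr_ge0 ?(ltW yz)//; apply: df0.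
by move: cI; rewrite in_itv.
Qed.

(** Both H + f and H - f are nonincreasing, so a bound at the right end travels to the left. *)
Lemma abs_le_of_derivative_le f df H dH y z : y <= z ->
  (forall u, y <= u <= z -> is_derive u 1 f (df u)) ->
  (forall u, y <= u <= z -> is_derive u 1 H (dH u)) ->
  (forall u, y <= u <= z -> `|df u| <= - dH u) ->
  `|f z| <= H z -> `|f y| <= H y.
Proof.
move=> yz fd Hd dle fz.
have A1 := @le_of_derivative_le0 (fun u => H u + f u) (fun u => dH u + df u) y z yz.
have A2 := @le_of_derivative_le0 (fun u => H u - f u) (fun u => dH u - df u) y z yz.
move: fz; rewrite !ler_norml => /andP[f1 f2]; apply/andP; split.
- have : H z + f z <= H y + f y.
    apply: A1 => u uI; first by apply: is_deriveD; [exact: Hd|exact: fd].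
    by have := dle u ltac:(lra); rewrite ler_norml; lra.
  by lra.
- have : H z - f z <= H y - f y.
    apply: A2 => u uI; first by apply: is_deriveB; [exact: Hd|exact: fd].
    by have := dle u ltac:(lra); rewrite ler_norml; lra.
  by lra.
Qed.

(** The derivatives are two-sided even at 0 and 1; this is available because f is smooth on a
    neighbourhood of L and the curves are polynomial. *)
Definition derivative_chain (G : nat -> R -> R) : Prop :=
  forall j x, 0 <= x <= 1 -> is_derive x 1 (G j) (G j.+1 x).

Lemma is_derive_expR_affine (c a y u : R) :
  is_derive u 1 (fun u => c * expR (a * (y - u))) (- a * (c * expR (a * (y - u)))).
Proof.
by apply: is_derive_eq; rewrite /GRing.scale /=; ring.
Qed.

Section bang_propagation.
Variables (G : nat -> R -> R) (lam M : nat -> R) (k : nat) (xs : nat -> R).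
Hypothesis Gd : derivative_chain G.
Hypothesis GM : forall j x, 0 <= x <= 1 -> `|G j x| <= M j.
Hypothesis lam_gt0 : forall i, (1 <= i)%N -> 0 < lam i.
Hypothesis lam_homo : forall i j, (1 <= i)%N -> (i <= j)%N -> lam i <= lam j.
Hypothesis M_gt0 : forall j, 0 < M j.
Hypothesis MS : forall j, M j.+1 = M j * lam j.+1.
Hypothesis xs01 : forall i, (i < k)%N -> 0 <= xs i <= 1.
Hypothesis xs_homo : forall i, (i.+1 < k)%N -> xs i <= xs i.+1.
Hypothesis Gxs : forall i, (i < k)%N -> `|G i (xs i)| <= expR (i%:R - k%:R) * M i.

(* The bound grows by downward induction on i: up to min(y, xs i) it is the
   integral of the bound for G i.+1, and at xs i it is Gxs. *)
Lemma bang_path N v y : (1 <= N)%N -> (N <= k)%N -> expR (- N%:R) <= v ->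
  0 <= y <= 1 ->
  (forall i, (i < k)%N -> y <= xs i -> `|G i y| <= v * expR i%:R * M i) ->
  forall y', 0 <= y' <= y -> forall i, (i < k)%N -> y' <= xs i ->
  `|G i y'| <= v * expR i%:R * M i * expR (expR 1 * lam N * (y - y')).
Proof.
move=> N1 Nk vN y01 Hy.
have v0 : 0 < v by apply: lt_le_trans vN; exact: expR_gt0.
have ge1 u : 0 <= u <= y -> 1 <= expR (expR 1 * lam N * (y - u)).
  move=> u0; rewrite -[leLHS]expR0 ler_expR !mulr_ge0 ?expR_ge0//.
    exact/ltW/lam_gt0.
  by lra.
suff S : forall m i, (N <= i + m)%N -> forall y', 0 <= y' <= y ->
    ((i < N)%N -> y' <= xs i) ->
    `|G i y'| <= v * expR i%:R * M i * expR (expR 1 * lam N * (y - y')).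
  move=> y' y'0 i ik y'x; apply: (S N) => //; exact: leq_addl.
(* For i >= N one has v e^i >= 1 and [GM] suffices. So only orders below N need work, and their
   rates lam (i+1) are at most lam N. *)
have triv i y' : (N <= i)%N -> 0 <= y' <= y ->
    `|G i y'| <= v * expR i%:R * M i * expR (expR 1 * lam N * (y - y')).
  move=> Ni y'0; apply: (le_trans (@GM i y' _)); first by lra.
  rewrite -[leLHS]mulr1 ler_pM ?ge1 ?ler01 ?(ltW (M_gt0 i))//.
  rewrite -[leLHS]mul1r ler_pM2r//.
  apply: (@le_trans _ _ (expR (- N%:R) * expR i%:R)); last by rewrite ler_pM2r ?expR_gt0.
  by rewrite -expRD -[leLHS]expR0 ler_expR addrC subr_ge0 ler_nat.
elim=> [|m IH] i Nim y' y'0 y'x; first by apply: triv => //; rewrite addn0 in Nim.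
have [Ni|iN] := leqP N i; first exact: triv.
have {}y'x := y'x iN.
have ik : (i < k)%N by exact: leq_trans Nk.
pose z := Num.min y (xs i).
have zy : z <= y by rewrite /z ge_min lexx.
have zx : z <= xs i by rewrite /z ge_min lexx orbT.
have y'z : y' <= z by rewrite /z le_min y'x andbT; case/andP: y'0.
set c := v * expR i%:R * M i.
have c0 : 0 < c by rewrite /c !mulr_gt0 ?expR_gt0.
apply: (@abs_le_of_derivative_le _ _ (fun u => c * expR (expR 1 * lam N * (y - u)))
  (fun u => - (expR 1 * lam N) * (c * expR (expR 1 * lam N * (y - u)))) y' z y'z).
- by move=> u uI; apply: Gd; lra.
- by move=> u _; exact: is_derive_expR_affine.
- move=> u uI; apply: (le_trans (IH i.+1 _ u _ _)).
  + by rewrite addSnnS.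
  + by lra.
  + move=> i1N; apply: le_trans (xs_homo _); last exact: leq_trans Nk.
    by lra.
  rewrite mulNr opprK mulrA ler_pM2r ?expR_gt0// /c MS -natr1 expRD.
  have : lam i.+1 <= lam N by exact: lam_homo.
  have -> : v * (expR i%:R * expR 1) * (M i * lam i.+1) =
    (expR 1 * (v * expR i%:R * M i)) * lam i.+1 by ring.
  have -> : expR 1 * lam N * (v * expR i%:R * M i) =
    (expR 1 * (v * expR i%:R * M i)) * lam N by ring.
  by rewrite ler_pM2l// mulr_gt0 ?expR_gt0.
rewrite -[leLHS]mulr1; apply: ler_pM => //; last by apply: ge1; lra.
have [yx|xy] := leP y (xs i).
  by have -> : z = y; [rewrite /z min_l | exact: Hy].
have -> : z = xs i by rewrite /z min_r// ltW.
apply: (le_trans (Gxs ik)); rewrite /c expRD [X in X * M i <= _]mulrC ler_pM2r// ler_pM2r ?expR_gt0//.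
by apply: le_trans vN; rewrite ler_expR lerN2 ler_nat.
Qed.

(** Walking left from X, the level e^-(N+1) degrades to e^-N over a length 1 / (e lam (N+1)). These
    lengths, for N from j0 to k - 1, add up to at least 1 > X, so 0 is reached before the level
    e^-j0. *)
Lemma bang_climb j0 X : (j0 < k)%N ->
  (forall i, (i < k)%N -> xs i <= X) -> 0 <= X -> X < 1 ->
  expR 1 <= \sum_(j0.+1 <= n < k.+1) (lam n)^-1 ->
  `|G 0%N 0| < expR (- j0%:R) * M 0%N.
Proof.
move=> j0k xsX X0 X1 hT.
(* [T N] is the distance from X at which the bound has degraded to level e^-N. *)
pose T N : R := (\sum_(N.+1 <= n < k.+1) (lam n)^-1) / expR 1.
have TS N : (N < k)%N -> T N = T N.+1 + (expR 1 * lam N.+1)^-1.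
  by move=> Nk; rewrite /T big_ltn// mulrDl addrC invfM [_^-1 / _]mulrC.
have Tk : T k = 0 by rewrite /T big_geq// mul0r.
have step_gt0 N : 0 < (expR 1 * lam N.+1)^-1.
  by rewrite invr_gt0 mulr_gt0 ?expR_gt0 ?lam_gt0.
have T_ge0 N : 0 <= T N.
  rewrite /T divr_ge0 ?expR_ge0// big_nat; apply: sumr_ge0 => i /andP[h _].
  by rewrite invr_ge0 ltW// lam_gt0//; apply: leq_trans h.
have step1 N : expR 1 * lam N.+1 * (expR 1 * lam N.+1)^-1 = 1.
  by rewrite mulfV// mulf_neq0// gt_eqF ?expR_gt0 ?lam_gt0.
have C1 m : (m <= k)%N -> 0 <= X - T (k - m)%N ->
    forall i, (i < k)%N -> X - T (k - m)%N <= xs i ->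
    `|G i (X - T (k - m)%N)| <= expR (- (k - m)%:R) * expR i%:R * M i.
  elim: m => [|m IH] mk.
    rewrite subn0 Tk subr0 => _ i ik Xi.
    have -> : X = xs i by apply/eqP; rewrite eq_le Xi xsX.
    by rewrite -expRD addrC Gxs.
  have E : (k - m = (k - m.+1).+1)%N by rewrite subnSK.
  set N := (k - m.+1)%N in E *.
  have Nk : (N < k)%N by rewrite /N; lia.
  move=> h i ik hi.
  have TN := TS _ Nk; have s0 := step_gt0 N; have t0 := T_ge0 N.+1.
  have := @bang_path N.+1 (expR (- N.+1%:R)) (X - T N.+1) isT Nk (lexx _) _ _ (X - T N) _ i ik hi.
  move=> /(_ _ _ _)/le_trans; apply.
  - by lra.
  - by rewrite -E; apply: IH => //; [exact: ltnW|rewrite E; lra].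
  - by lra.
  have -> : X - T N.+1 - (X - T N) = (expR 1 * lam N.+1)^-1 by lra.
  rewrite step1 -natr1 opprD expRD.
  have -> : expR (- N%:R) * expR (-1) * expR i%:R * M i * expR 1 =
    expR (- N%:R) * expR i%:R * M i * (expR (-1) * expR 1) by ring.
  have -> : expR (-1 : R) * expR 1 = 1 by rewrite -expRD addNr expR0.
  by rewrite mulr1.
(* The point 0 is met inside a step, and the incomplete step makes the inequality strict. *)
have C2 m : (m <= k)%N -> X - T (k - m)%N < 0 ->
    `|G 0%N 0| < expR (- (k - m)%:R) * M 0%N.
  elim: m => [|m IH] mk; first by rewrite subn0 Tk; lra.
  have E : (k - m = (k - m.+1).+1)%N by rewrite subnSK.
  set N := (k - m.+1)%N in E *.
  have Nk : (N < k)%N by rewrite /N; lia.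
  move=> h.
  have k0 : (0 < k)%N by exact: leq_trans Nk.
  have TN := TS _ Nk; have s0 := step_gt0 N; have t0 := T_ge0 N.+1.
  have [h'|h'] := ltP (X - T (k - m)%N) 0.
    apply: (lt_trans (IH (ltnW mk) h')); rewrite ltr_pM2r// ltr_expR ltrN2 ltr_nat.
    by rewrite E.
  rewrite E in h'.
  have := @bang_path N.+1 (expR (- N.+1%:R)) (X - T N.+1) isT Nk (lexx _) _ _ 0 _ 0%N k0 _.
  move=> /(_ _ _ _ _)/le_lt_trans; apply.
  - by lra.
  - by rewrite -E; apply: C1 => //; [exact: ltnW|rewrite E; lra].
  - by lra.
  - by have := xs01 k0; lra.
  rewrite expR0 mulr1 subr0 mulrAC ltr_pM2r// -expRD ltr_expR -natr1 opprD -addrA gtrDl.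
  rewrite addrC subr_lt0.
  have : expR 1 * lam N.+1 * (X - T N.+1) < expR 1 * lam N.+1 * (expR 1 * lam N.+1)^-1.
    by rewrite ltr_pM2l ?mulr_gt0 ?expR_gt0 ?lam_gt0//; lra.
  by rewrite step1.
have := C2 (k - j0)%N (leq_subr _ _).
rewrite subKn ?(ltnW j0k)//; apply.
have : 1 <= T j0 by rewrite /T ler_pdivlMr ?expR_gt0// mul1r.
by lra.
Qed.

End bang_propagation.

(** Keep the leftmost zero for order 0 and recurse on the Rolle points of consecutive zeros. These
    lie to the right of z 0, so the selected zeros are nondecreasing in the order, as [bang_climb]
    and [interpolation_error] require. *)
Lemma rolle_chain k (H : nat -> R -> R) (z : nat -> R) : derivative_chain H ->
  (forall i, (i < k.+1)%N -> 0 <= z i <= 1) ->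
  (forall i, (i < k)%N -> z i < z i.+1) ->
  (forall i, (i < k.+1)%N -> H 0%N (z i) = 0) ->
  exists xs : nat -> R,
    [/\ forall i, (i < k.+1)%N -> H i (xs i) = 0,
        forall i, (i.+1 < k.+1)%N -> xs i <= xs i.+1 &
        forall i, (i < k.+1)%N -> z 0%N <= xs i <= z k].
Proof.
elim: k H z => [|k IH] H z Hd z01 zinc Hz.
  by exists z; split=> // -[|//] _; [exact: Hz|rewrite lexx].
have : forall i, exists w, (i < k.+1)%N -> z i < w < z i.+1 /\ H 1%N w = 0.
  move=> i; have [ik|] := ltnP i k.+1; last by exists 0.
  have zi := z01 i (ltnW ik); have zi1 := z01 i.+1 ik.
  have [|||w wI [_ wd]] := @Rolle R (H 0%N) (z i) (z i.+1) (zinc _ ik).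
  - move=> x; rewrite in_itv /= => xI.
    by have /@ex_derive := @Hd 0%N x ltac:(lra).
  - by apply: (@is_derive_within_continuous _ (H 1%N)) => u uI; apply: Hd; lra.
  - by rewrite !Hz// ltnW.
  exists w => _; split; first by move: wI; rewrite in_itv.
  have : 0 <= w <= 1 by move: wI; rewrite in_itv /=; lra.
  by move=> /(@Hd 0%N) [_ <-].
move=> /choice[w wP].
have w_inc i : (i < k)%N -> w i < w i.+1.
  move=> ik; have [/andP[_ h1] _] := wP i (ltnW ik).
  by have [/andP[h2 _] _] := wP i.+1 ik; exact: lt_trans h2.
have [|i ik|//|i ik|xs [xs0 xs_inc xsI]] := IH (fun j => H j.+1) w.
- by move=> j x xI; exact: Hd.
- by have [h _] := wP i ik; have := z01 i (ltnW ik); have := z01 i.+1 ik; lra.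
- by have [_ ->] := wP i ik.
have [h0 _] := wP 0%N isT; have [hk _] := wP k (leqnn _).
have z0k : z 0%N <= z k.+1 by have := xsI 0%N isT; lra.
exists (fun i => if i is j.+1 then xs j else z 0%N); split.
- by case=> [|i] ik; [exact: Hz|exact: xs0].
- case=> [|i] ik; last exact: xs_inc.
  by have := xsI 0%N isT; lra.
- by case=> [|i] ik; [lra|have := xsI i ik; lra].
Qed.

End one_variable.

(** * Lagrange interpolation at separated nodes *)

Section interpolation.
Context {R : realType}.
Implicit Types (p : {poly R}) (x y : R).

Lemma ffact_recE (m j : nat) : (m.+1 ^_ j.+1 = m ^_ j.+1 + j.+1 * m ^_ j)%N.
Proof.
rewrite ffactSS ffactnSr [(m ^_ j * _)%N]mulnC -mulnDl.
have [jm|mj] := leqP j m; first by congr (_ * _)%N; lia.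
by rewrite ffact_small// !muln0.
Qed.

(** The derivative is a sum of [size s ^_ j] products of differences between points of [0, 1]. *)
Lemma derivn_prod_XsubC_le (s : seq R) x (j : nat) : 0 <= x <= 1 ->
  (forall z, z \in s -> 0 <= z <= 1) ->
  `|(derivn j (\prod_(z <- s) ('X - z%:P))).[x]| <= (size s ^_ j)%:R.
Proof.
move=> x01; elim: s j => [|z s IH] j s01.
  rewrite big_nil; case: j => [|j]; first by rewrite derivn0 hornerC normr1.
  by rewrite derivnC hornerC normr0.
have {}IH i : `|(derivn i (\prod_(y <- s) ('X - y%:P))).[x]| <= (size s ^_ i)%:R.
  by apply: IH => u us; apply: s01; rewrite inE us orbT.
have z01 : 0 <= z <= 1 by apply: s01; rewrite mem_head.
have xz : `|x - z| <= 1 by rewrite ler_norml; lra.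
rewrite big_cons; set q := \prod_(_ <- _) _ in IH *.
have -> : ('X - z%:P) * q = q * 'X + (0 : R)%:P - z *: q.
  by rewrite addr0 mulrBl mul_polyC [q * _]mulrC.
rewrite derivnB derivnZ; case: j => [|j].
  have -> : (derivn 0 (q * 'X + (0 : R)%:P) - z *: derivn 0 q).[x] = (x - z) * (derivn 0 q).[x].
    by rewrite !derivn0 !hornerE /=; ring.
  by rewrite normrM ffactn0; have := IH 0%N; rewrite ffactn0; apply: mulr_ile1.
rewrite derivnMXaddC ffact_recE natrD natrM.
have -> : (derivn j q *+ j.+1 + derivn j.+1 q * 'X - z *: derivn j.+1 q).[x] =
   (x - z) * (derivn j.+1 q).[x] + j.+1%:R * (derivn j q).[x].
  by rewrite !hornerE hornerMn -mulr_natl; ring.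
apply: (le_trans (ler_normD _ _)); apply: lerD.
  by rewrite normrM -[leRHS]mul1r ler_pM.
by rewrite normrM normr_nat ler_wpM2l.
Qed.

Lemma prod_dist_ord (D i : nat) : (i <= D)%N ->
  (\prod_(l < D.+1 | l != i :> nat) (if l < i then i - l else l - i) = i`! * (D - i)`!)%N.
Proof.
move=> iD.
rewrite -(big_mkord (fun l => l != i) (fun l => if (l < i)%N then (i - l)%N else (l - i)%N)).
rewrite (big_cat_nat (n := i))//=; last exact: leqW.
rewrite (@big_ltn_cond _ _ _ i D.+1) ?ltnS// eqxx /=; congr (_ * _)%N.
  rewrite big_nat_rev /= add0n fact_prod big_nat_cond [RHS]big_add1 /= [RHS]big_nat_cond.
  apply: eq_big => [l|l h]; first by apply/idP/idP; lia.
  by rewrite ifT; lia.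
rewrite fact_prod.
have -> : (D - i).+1 = (D.+1 - i)%N by rewrite subSn.
rewrite -{1}[i.+1]add1n big_addn big_nat_cond [RHS]big_nat_cond.
apply: eq_big => [l|l h]; first by apply/idP/idP; lia.
by rewrite ifF; lia.
Qed.

(** Lagrange's formula. Since the nodes satisfy |y_i - y_l| >= |i - l| del, the i-th weight is at
    most 1 / (del^D i! (D-i)!), and these bounds sum to (2/del)^D / D! by the binomial theorem. *)
Lemma interpolation_bound (D : nat) (y phi : nat -> R) (del eps : R) :
  0 < del -> 0 <= eps -> (forall i, (i <= D)%N -> 0 <= y i <= 1) ->
  (forall i j, (i < j)%N -> (j <= D)%N -> y i + (j - i)%:R * del <= y j) ->
  (forall i, (i <= D)%N -> `|phi i| <= eps) ->
  exists p, [/\ (size p <= D.+1)%N, forall i, (i <= D)%N -> p.[y i] = phi i &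
    forall j x, 0 <= x <= 1 ->
      `|(derivn j p).[x]| <= eps * (D ^_ j)%:R * ((2 / del) ^+ D / (D`!)%:R)].
Proof.
move=> del0 eps0 y01 ysp phile.
have ydist (i l : 'I_D.+1) : l != i ->
    (if (l < i)%N then (i - l)%N else (l - i)%N)%:R * del <= `|y i - y l|.
  move=> li; case: ltnP => [lti|leil].
    by have := ysp l i lti (ltn_ord i); rewrite ler_normr => h; apply/orP; left; lra.
  have lti : (i < l)%N by rewrite ltn_neqAle leil andbT eq_sym.
  by have := ysp i l lti (ltn_ord l); rewrite ler_normr => h; apply/orP; right; lra.
have ydist_gt0 (i l : 'I_D.+1) : l != i -> 0 < `|y i - y l|.
  move=> li; apply: lt_le_trans (ydist _ _ li); rewrite mulr_gt0// ltr0n.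
  have pos (a c : nat) : c != a -> (0 < (if c < a then a - c else c - a))%N.
    by case: ifP => ?; lia.
  exact: pos.
pose w (i : 'I_D.+1) := \prod_(l < D.+1 | l != i) (y i - y l).
pose q (i : 'I_D.+1) : {poly R} := \prod_(l < D.+1 | l != i) ('X - (y l)%:P).
have qE i : q i = \prod_(z <- [seq y l | l : 'I_D.+1 <- enum (predC1 i)]) ('X - z%:P).
  by rewrite big_map big_enum.
have szs i : size [seq y l | l : 'I_D.+1 <- enum (predC1 i)] = D.
  by rewrite size_map -cardE cardC1 card_ord.
have w_neq0 i : w i != 0.
  by apply/prodf_neq0 => l li; rewrite -normr_gt0 ydist_gt0.
have wge (i : 'I_D.+1) : del ^+ D * (i`! * (D - i)`!)%:R <= `|w i|.
  have iD : (i <= D)%N by rewrite -ltnS.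
  rewrite -(prod_dist_ord iD).
  have -> : del ^+ D = \prod_(l < D.+1 | l != i :> nat) del.
    rewrite prodr_const; congr (_ ^+ _).
    by rewrite -[LHS]/(D.+1.-1) -[in LHS](card_ord D.+1) -(cardC1 i); apply: eq_card.
  rewrite natr_prod -big_split /= /w normr_prod; apply: ler_prod => l li.
  by rewrite mulr_ge0 ?(ltW del0)//= mulrC ydist.
have qi (i j : 'I_D.+1) : (q i).[y j] = if i == j then w i else 0.
  rewrite /q horner_prod; case: eqVneq => [->|ij].
    by apply: eq_bigr => l _; rewrite !hornerE.
  by rewrite (bigD1 j) 1?eq_sym//= !hornerE subrr mul0r.
exists (\sum_(i < D.+1) (phi i / w i) *: q i); split.
- apply: (leq_trans (size_sum _ _ _)); apply/bigmax_leqP => i _.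
  by apply: (leq_trans (size_scale_leq _ _)); rewrite qE size_prod_XsubC szs.
- move=> i iD; pose i' : 'I_D.+1 := Ordinal (iD : (i < D.+1)%N).
  rewrite horner_sum (bigD1 i')//= big1 => [|j ji]; rewrite hornerZ (qi _ i').
    by rewrite eqxx addr0 divfK.
  by rewrite (negPf ji) mulr0.
move=> j x x01.
rewrite linear_sum /= horner_sum.
have E : (2 / del) ^+ D / (D`!)%:R = \sum_(i < D.+1) (del ^+ D * (i`! * (D - i)`!)%:R)^-1 :> R.
  have F0 m : (m`!)%:R != 0 :> R by rewrite pnatr_eq0 -lt0n fact_gt0.
  have -> : (2 / del) ^+ D / (D`!)%:R = (\sum_(i < D.+1) 'C(D, i)%:R) * (del ^+ D * (D`!)%:R)^-1 :> R.
    rewrite expr_div_n invfM mulrA; congr (_ / _ / _).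
    rewrite -[2]/(1 + 1) exprDn; apply: eq_bigr => i _.
    by rewrite !expr1n mul1r.
  rewrite mulr_suml; apply: eq_bigr => i _.
  have iD : (i <= D)%N by rewrite -ltnS.
  have C0 : 'C(D, i)%:R != 0 :> R by rewrite pnatr_eq0 -lt0n bin_gt0.
  have B0 : (i`! * (D - i)`!)%:R != 0 :> R by rewrite natrM mulf_neq0.
  have del_neq0 : del ^+ D != 0 by rewrite expf_neq0 ?gt_eqF.
  rewrite -(bin_fact iD) natrM; move: C0 B0 del_neq0.
  set a := 'C(D, i)%:R; set c := (i`! * _)%:R; set d := del ^+ D => a0 c0 d0.
  by clearbody a c d; field; rewrite a0 c0 d0.
apply: (le_trans (ler_norm_sum _ _ _)); rewrite E mulr_sumr; apply: ler_sum => i _.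
rewrite derivnZ hornerZ normrM normf_div [leRHS]mulrAC.
have B0 : 0 < del ^+ D * (i`! * (D - i)`!)%:R.
  by rewrite mulr_gt0 ?exprn_gt0// ltr0n muln_gt0 !fact_gt0.
apply: ler_pM => //.
  rewrite ler_pM ?invr_ge0//; first by apply: phile; rewrite -ltnS.
  by rewrite lef_pV2 ?posrE ?normr_gt0// wge.
rewrite qE -[in leRHS](szs i); apply: derivn_prod_XsubC_le => // z /mapP[l _ ->].
by apply: y01; rewrite -ltnS.
Qed.

End interpolation.

Section remez_one_variable.
Context {R : realType}.

Lemma expR1_ge2 : 2 <= expR 1 :> R.
Proof. by have := @expR_ge1Dx R 1; lra. Qed.

Lemma expR1_le4 : expR 1 <= 4 :> R.
Proof.
have h := @expR_ge1Dx R (- 2^-1).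
have h2 : expR (- 2^-1) * expR 1 * expR (- 2^-1) = 1 :> R.
  by rewrite -!expRD -[RHS]expR0; congr expR; lra.
have h3 : 2^-1 <= expR (- 2^-1) :> R by lra.
have e0 := @expR_gt0 R 1.
set a := expR (- 2^-1) in h2 h3; set e := expR 1 in h2 e0 *.
have e1 : 2^-1 * e <= a * e by rewrite ler_wpM2r// ltW.
have : 2^-1 * e * 2^-1 <= a * e * a by apply: ler_pM => //; rewrite mulr_ge0// ltW.
by rewrite h2; lra.
Qed.

Lemma exprn_le_expR_fact (x : R) n : 0 <= x -> x ^+ n <= expR x * (n`!)%:R.
Proof.
move=> x0; rewrite -ler_pdivrMr ?ltr0n ?fact_gt0//.
case: n => [|n]; last by have := @expR_ge1Dxn R x n x0; lra.
by rewrite expr0 fact0 divr1; have := @expR_ge1Dx R x; lra.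
Qed.

Lemma ffact_le_exp (n j : nat) : (n ^_ j <= n ^ j)%N.
Proof.
elim: j n => [|j IH] n; first by rewrite ffactn0 expn0.
rewrite ffactnS expnS leq_mul2l; apply/orP; right.
by apply: (leq_trans (IH _)); case: j {IH} => // j; rewrite leq_exp2r// leq_pred.
Qed.

Lemma derivative_chain_sub_poly (G : nat -> R -> R) (p : {poly R}) :
  derivative_chain G ->
  derivative_chain (fun j x => G j x - (derivn j p).[x]).
Proof.
move=> Gd j x x01; apply: is_deriveB; first exact: Gd.
Qed.

Lemma is_derive_polyE (p : {poly R}) (f : R -> R) (x df : R) :
  (forall u, f u = p.[u]) -> p^`().[x] = df -> is_derive x 1 f df.
Proof. by move=> /funext -> <-; exact: is_derive_poly. Qed.

(** Abel-Goncharov remainder: H i is recovered from H (i+1) by integrating leftwards from its zero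
    xs i. As the zeros increase with the order, the bound for H (i+1) is available on the whole
    range of integration. *)
Lemma interpolation_error (H : nat -> R -> R) (k : nat) (C X : R) (xs : nat -> R) :
  derivative_chain H -> X <= 1 ->
  (forall x, 0 <= x <= 1 -> `|H k x| <= C) ->
  (forall i, (i < k)%N -> H i (xs i) = 0) ->
  (forall i, (i.+1 < k)%N -> xs i <= xs i.+1) ->
  (forall i, (i < k)%N -> 0 <= xs i <= X) ->
  `|H 0%N 0| <= C / (k`!)%:R.
Proof.
move=> Hd X1 HC Hx xsinc xsX.
have C0 : 0 <= C by apply: le_trans (HC 0 _); rewrite // lexx ler01.
have S : forall m i, (i + m = k)%N -> forall y, 0 <= y <= 1 ->
    ((i < k)%N -> y <= xs i) -> `|H i y| <= C * (1 - y) ^+ m / (m`!)%:R.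
  elim=> [|m IH] i ik y y0 yx.
    by rewrite addn0 in ik; rewrite ik expr0 fact0 divr1 mulr1 HC.
  have {ik}ik : (i.+1 + m = k)%N by rewrite addSnnS.
  have lt_ik : (i < k)%N by rewrite -ik leq_addr.
  have xi := xsX i lt_ik; have {}yx := yx lt_ik.
  apply: (@abs_le_of_derivative_le _ _ (H i.+1) (fun u => C * (1 - u) ^+ m.+1 / (m.+1)`!%:R)
    (fun u => - (C * (1 - u) ^+ m / (m`!)%:R)) y (xs i) yx).
  - by move=> u uI; apply: Hd; lra.
  - move=> u _; have m0 : m.+1%:R != 0 :> R by rewrite pnatr_eq0.
    apply: (@is_derive_polyE ((C / (m.+1)`!%:R) *: (1%:P - 'X) ^+ m.+1)).
      by move=> w; rewrite !hornerE mulrAC.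
    rewrite derivZ deriv_exp derivB derivC derivX hornerZ hornerMn !hornerE /= factS natrM invfM -[(-1 * _) *+ _]mulr_natl.
    have : (m`!)%:R != 0 :> R by rewrite pnatr_eq0 -lt0n fact_gt0.
    move: m0; set c := (m`!)%:R; set c' := m.+1%:R => c'0 c0.
    by clearbody c c'; field; rewrite c0 c'0.
  - move=> u uI; rewrite opprK; apply: IH => //; first by lra.
    by move=> h; have := xsinc i h; lra.
  rewrite Hx// normr0 divr_ge0 ?ler0n// mulr_ge0// exprn_ge0//; lra.
have := S k 0%N (add0n k) 0; rewrite subr0 expr1n mulr1; apply.
  by rewrite lexx ler01.
by move=> k0; have := xsX 0%N k0; lra.
Qed.

Lemma remez_bang (G : nat -> R -> R) (lam : nat -> R) (M0 gam del eps m : R)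
    (D j0 : nat) (y : nat -> R) :
  let M j := M0 * \prod_(1 <= i < j.+1) lam i in
  derivative_chain G ->
  (forall j x, 0 <= x <= 1 -> `|G j x| <= M j) ->
  0 < M0 ->
  (forall i, (1 <= i)%N -> 0 < lam i) ->
  (forall i j, (1 <= i)%N -> (i <= j)%N -> lam i <= lam j) ->
  0 <= gam ->
  (forall i, (1 <= i <= D.+1)%N -> lam D.+1 * (i%:R / D.+1%:R) `^ gam <= lam i) ->
  (1 <= D)%N -> (j0 <= D)%N ->
  expR (- j0%:R) * M0 <= `|G 0%N 0| ->
  expR 1 <= \sum_(j0.+1 <= n < D.+2) (lam n)^-1 ->
  0 < m <= 1 -> del = m / (2 * D.+2%:R) ->
  (forall i, (i <= D.+1)%N -> 0 <= y i <= 1) ->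
  (forall i j, (i < j)%N -> (j <= D.+1)%N -> y i + (j - i)%:R * del <= y j) ->
  (forall i, (i <= D.+1)%N -> `|G 0%N (y i)| <= eps) ->
  `|G 0%N 0| * m ^+ (2 * D) <= (4 * expR (4 + gam)) ^+ (2 * D) * eps.
Proof.
move=> M Gd GM M00 lam0 lam_homo gam0 lamgam D1 j0D hb hsum m01 delE y01 ysp Gy.
have m0 : 0 < m by case/andP: m01.
have m1 : m <= 1 by case/andP: m01.
have leD2 : (D <= 2 * D)%N by clear; lia.
have leSD2 : (D.+1 <= 2 * D)%N by clear -D1; lia.
have le4D : (4 + 4 * D <= 4 * (2 * D))%N by clear -D1; lia.
have D2E : (D.+2 + 3 * D.+1 = 1 + (4 + 4 * D))%N by clear; lia.
have M_0 : M 0%N = M0 by rewrite /M big_geq// mulr1.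
have MS j : M j.+1 = M j * lam j.+1 by rewrite /M big_nat_recr//= mulrA.
have M_gt0 j : 0 < M j.
  by elim: j => [|j IH]; [rewrite M_0|rewrite MS mulr_gt0// lam0].
have del0 : 0 < del by rewrite delE divr_gt0// mulr_gt0// ltr0n.
have eps0 : 0 <= eps by apply: le_trans (Gy 0%N isT).
have [p [szp py pd]] := @interpolation_bound R D y (fun i => G 0%N (y i)) del eps del0 eps0
  (fun i h => y01 i (leqW h)) (fun i j h h' => ysp i j h (leqW h')) (fun i h => Gy i (leqW h)).
pose H j x := G j x - (derivn j p).[x].
have Hd : derivative_chain H by exact: derivative_chain_sub_poly.
have yinc i : (i <= D)%N -> y i + del <= y i.+1.
  by move=> iD; have := ysp i i.+1 (leqnn _); rewrite subSnn mul1r; apply.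
have [||i iD|xs [Hxs xsinc xsI]] := @rolle_chain R D H y Hd.
- by move=> i iD; apply: y01; exact: ltnW.
- by move=> i iD; have := yinc i (ltnW iD); lra.
- by rewrite /H derivn0 py// subrr.
(* The node y (D+1) is left out of the interpolation; it keeps the Rolle points strictly left of 1,
   as [bang_climb] requires. *)
have yD1 : y D <= 1 - del by have := yinc D (leqnn _); have := y01 D.+1 (leqnn _); lra.
have y0 := y01 0%N isT; have yD := y01 D (leqnSn _).
set K0 : R := (2 / del) ^+ D / D`!%:R in pd.
have e2 := expR1_ge2; have e4 := expR1_le4.
have eexp (n : nat) : expR n%:R = expR 1 ^+ n :> R by rewrite -expRM_natl mulr1.
have e1 : 1 <= expR 1 :> R by lra.
have K0_ge0 : 0 <= K0 by rewrite divr_ge0// exprn_ge0// divr_ge0// ltW.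
have K0_le : K0 * m ^+ D <= 4 ^+ D * expR 1 ^+ D.+2.
  rewrite /K0 mulrAC -exprMn ler_pdivrMr ?ltr0n ?fact_gt0// delE.
  have -> : 2 / (m / (2 * D.+2%:R)) * m = 4 * D.+2%:R :> R.
    have : D.+2%:R != 0 :> R by rewrite pnatr_eq0.
    by set c := D.+2%:R; clearbody c => c0; field; rewrite c0 gt_eqF.
  rewrite exprMn -mulrA ler_pM2l ?exprn_gt0// -eexp.
  by apply: exprn_le_expR_fact; exact: ler0n.
(* The argument yields m^D, which is stronger since m <= 1. The exponent 2 D serves the constant:
   4^D e^(4D+5) e^(gam (D+1)) has to fit under (4 e^(4+gam))^(2D), where D >= 1. *)
have mD : m ^+ (2 * D) <= m ^+ D.
  by apply: ler_wiXn2l => //; exact: ltW.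
suff key : `|G 0%N 0| <= eps * K0 * (expR 1 ^+ (3 * D.+1) * expR (gam * D.+1%:R)).
  apply: (@le_trans _ _ (eps * K0 * (expR 1 ^+ (3 * D.+1) * expR (gam * D.+1%:R)) * m ^+ D)).
    apply: ler_pM => //; exact: exprn_ge0 (ltW m0).
  have -> : eps * K0 * (expR 1 ^+ (3 * D.+1) * expR (gam * D.+1%:R)) * m ^+ D =
    K0 * m ^+ D * (expR 1 ^+ (3 * D.+1) * expR (gam * D.+1%:R)) * eps by ring.
  rewrite ler_wpM2r//.
  apply: (@le_trans _ _ (4 ^+ D * expR 1 ^+ D.+2 * (expR 1 ^+ (3 * D.+1) * expR (gam * D.+1%:R)))).
    by rewrite ler_wpM2r// mulr_ge0 ?exprn_ge0 ?expR_ge0.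
  rewrite exprMn expRD exprMn -expRM_natl -[expR gam ^+ _]expRM_natl !mulrA.
  apply: ler_pM; rewrite ?expR_ge0 ?mulr_ge0 ?exprn_ge0 ?expR_ge0//; last first.
    by rewrite ler_expR mulrC; apply: ler_wpM2r => //; rewrite ler_nat.
  have -> : expR 4 ^+ (2 * D) = expR 1 ^+ (4 * (2 * D)) :> R by rewrite (eexp 4%N) [RHS]exprM.
  rewrite mulr1 eexp -mulrA -exprD [X in _ <= X * _]exprM.
  have -> : (4 ^+ 2) ^+ D = 4 ^+ D * 4 ^+ D :> R by rewrite -exprMn -expr2.
  rewrite -mulrA ler_pM2l ?exprn_gt0//.
  rewrite D2E exprD expr1; apply: ler_pM; rewrite ?expR_ge0 ?exprn_ge0 ?expR_ge0//.
    by apply: (le_trans e4); rewrite -[leLHS]expr1 ler_eXn2l ?ltr1n.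
  by rewrite ler_weXn2l.
(* If lam (D+1) is small, the interpolation error is at most half of |G 0 0|.
   Otherwise M is so regular that any derivative of p comparable with M bounds
   M 0, and if there is none, bang_climb applies to the Rolle points of G - p. *)
have [lamle|lamgt] := leP (lam D.+1) (expR (- 3) * D.+1%:R).
  have MD : M D.+1 <= M0 * (expR (- 3) * D.+1%:R) ^+ D.+1.
    rewrite /M ler_pM2l//.
    have -> : (expR (- 3) * D.+1%:R) ^+ D.+1 = \prod_(1 <= i < D.+2) (expR (- 3) * D.+1%:R) :> R.
      by rewrite prodr_const_nat subn1.
    rewrite big_nat [leRHS]big_nat; apply: ler_prod => i /andP[i1 iD].
    rewrite ltW ?lam0//=; apply: le_trans lamle; exact: lam_homo.
  have err : `|H 0%N 0| <= M D.+1 / (D.+1`!)%:R.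
    apply: (@interpolation_error H D.+1 (M D.+1) (y D) xs Hd) => //.
    - by lra.
    - move=> x x01; rewrite /H derivn_poly0// hornerC subr0; exact: GM.
    - by move=> i iD; have := xsI i iD; lra.
  have {}err : `|H 0%N 0| <= 2^-1 * `|G 0%N 0|.
    apply: (le_trans err); apply: (@le_trans _ _ (2^-1 * (expR (- j0%:R) * M0))); last by rewrite ler_pM2l.
    (* Since (D+1)^(D+1) <= e^(D+1) (D+1)!, the factor e^-3 of the case hypothesis leaves
       e^(-2(D+1)), which is below half of e^-j0 because j0 <= D. *)
    apply: (@le_trans _ _ (M0 * expR (- (2 * D.+1%:R)))).
      rewrite ler_pdivrMr ?ltr0n ?fact_gt0//; apply: (le_trans MD).
      rewrite -mulrA ler_pM2l// exprMn -expRM_natl.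
      apply: (@le_trans _ _ (expR (D.+1%:R * - 3) * (expR D.+1%:R * (D.+1`!)%:R))).
        by rewrite ler_pM2l ?expR_gt0//; apply: exprn_le_expR_fact; exact: ler0n.
      by rewrite mulrA -expRD ler_pM2r ?ltr0n ?fact_gt0// ler_expR; lra.
    rewrite mulrC mulrA ler_pM2r//.
    have : expR (- (2 * D.+1%:R)) * 2 <= expR (- j0%:R) :> R.
      apply: (@le_trans _ _ (expR (- (2 * D.+1%:R)) * expR 1)).
        by rewrite ler_pM2l ?expR_gt0.
      rewrite -expRD ler_expR -natr1.
      have : j0%:R <= D%:R :> R by rewrite ler_nat.
      by have : 0 <= D%:R :> R by []; lra.
    by lra.
  have p0 : `|p.[0]| <= eps * K0.
    by have := pd 0%N 0; rewrite derivn0 ffactn0 mulr1; apply; rewrite lexx ler01.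
  have : `|G 0%N 0| <= 2 * (eps * K0).
    have GE : G 0%N 0 = H 0%N 0 + p.[0] by rewrite /H derivn0 subrK.
    by have := ler_normD (H 0%N 0) p.[0]; rewrite -GE; lra.
  move=> /le_trans; apply; rewrite mulrC; apply: ler_wpM2l; first exact: mulr_ge0.
  apply: (le_trans e2); rewrite -[leLHS]mulr1; apply: ler_pM; rewrite ?expR_ge0//.
    by rewrite -[leLHS]expr1 ler_weXn2l.
  by rewrite -[leLHS]expR0 ler_expR mulr_ge0.
have [[j jD hj]|hno] := pselect (exists2 j, (j < D.+1)%N &
    expR (j%:R - D.+1%:R) * M j <= eps * (D ^_ j)%:R * K0); last first.
  exfalso.
  have : `|G 0%N 0| < expR (- j0%:R) * M 0%N.
    apply: (@bang_climb R G lam M D.+1 xs Gd GM lam0 lam_homo M_gt0 MS _ _ _ j0 (y D)) => //.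
    - by move=> i iD; have := xsI i iD; lra.
    - move=> i iD.
      have -> : G i (xs i) = (derivn i p).[xs i] by apply/eqP; rewrite -subr_eq0; apply/eqP/Hxs.
      apply: le_trans (pd _ _ _) _; first by have := xsI i iD; lra.
      by rewrite leNgt; apply/negP => h; apply: hno; exists i => //; exact: ltW.
    - by move=> i iD; have := xsI i iD; lra.
    - by lra.
    - by lra.
  by rewrite M_0 ltNge hb.
have k0 : 0 < D.+1%:R :> R by rewrite ltr0n.
(* By the growth condition, M j / M0 is at least (lam (D+1))^j (j! / (D+1)^j)^gam, and (D+1)^j <=
   e^(D+1) j!. *)
have Mj : M0 * (expR (- 3) * D.+1%:R) ^+ j * expR (- (gam * D.+1%:R)) <= M j.
  have lamk0 := lam0 D.+1 isT.
  rewrite /M -mulrA ler_pM2l//.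
  apply: (@le_trans _ _ (lam D.+1 ^+ j * (((j`!)%:R / D.+1%:R ^+ j) `^ gam))).
    apply: ler_pM; rewrite ?exprn_ge0 ?expR_ge0 ?mulr_ge0 ?expR_ge0//.
      by rewrite lerXn2r ?nnegrE ?mulr_ge0 ?expR_ge0 ?(ltW lamk0)// ltW.
    have -> : expR (- (gam * D.+1%:R)) = (expR (- D.+1%:R)) `^ gam :> R.
      by rewrite -expRM mulNr mulrC.
    apply: ge0_ler_powR => //; rewrite ?nnegrE ?expR_ge0 ?divr_ge0 ?exprn_ge0//.
    rewrite expRN ler_pdivlMr ?exprn_gt0// mulrC ler_pdivrMr ?expR_gt0// mulrC.
    by apply: exprn_le_expR_fact; exact: ler0n.
  have -> : lam D.+1 ^+ j * ((j`!)%:R / D.+1%:R ^+ j) `^ gam =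
      \prod_(1 <= i < j.+1) (lam D.+1 * (i%:R / D.+1%:R) `^ gam).
    rewrite big_split /= prodr_const_nat subn1; congr (_ * _).
    elim: j {jD hj} => [|j IH].
      by rewrite big_geq// fact0 expr0 divr1 powR1.
    rewrite big_nat_recr//= -IH -powRM ?divr_ge0 ?exprn_ge0 ?ler0n//.
    by congr (_ `^ _); rewrite factS natrM exprS invfM; ring.
  rewrite big_nat [leRHS]big_nat; apply: ler_prod => i /andP[i1 ij].
  rewrite mulr_ge0 ?powR_ge0 ?(ltW lamk0)//= lamgam// i1/=.
  by apply: ltnW; exact: leq_trans ij jD.
have Djle : (D ^_ j)%:R <= D.+1%:R ^+ j :> R.
  rewrite -natrX ler_nat; apply: (leq_trans (ffact_le_exp _ _)).
  by case: j {jD hj Mj} => // j; rewrite leq_exp2r.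
have main : M0 <= eps * K0 * (expR 1 ^+ (3 * D.+1) * expR (gam * D.+1%:R)).
  have h1 : expR (j%:R - D.+1%:R) * (M0 * (expR (- 3) * D.+1%:R) ^+ j * expR (- (gam * D.+1%:R)))
     <= eps * K0 * D.+1%:R ^+ j.
    apply: (@le_trans _ _ (expR (j%:R - D.+1%:R) * M j)); first by rewrite ler_pM2l ?expR_gt0.
    by apply: (le_trans hj); rewrite mulrAC ler_wpM2l// mulr_ge0.
  have h2 : M0 * (expR (j%:R - D.+1%:R) * expR (- 3) ^+ j * expR (- (gam * D.+1%:R)))
     <= eps * K0.
    rewrite -(@ler_pM2r _ (D.+1%:R ^+ j)) ?exprn_gt0//; apply: le_trans h1.
    by rewrite exprMn le_eqVlt; apply/orP; left; apply/eqP; ring.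
  set F := expR _ * _ * _ in h2.
  have F0 : 0 < F by rewrite /F !mulr_gt0 ?exprn_gt0 ?expR_gt0.
  rewrite -(@ler_pM2r _ F)//; apply: (le_trans h2).
  rewrite -[leRHS]mulrA -[leLHS]mulr1; apply: ler_wpM2l; first exact: mulr_ge0.
  rewrite /F -eexp -!expRM_natl -!expRD -[leLHS]expR0 ler_expR.
  have : j%:R <= D.+1%:R :> R by rewrite ler_nat ltnW.
  rewrite natrM; have : 0 <= j%:R :> R by [].
  by lra.
by apply: le_trans main; rewrite -M_0; apply: GM; rewrite lexx ler01.
Qed.

End remez_one_variable.

Section bang_degree_facts.
Context {R : realType}.
Implicit Types (mu lam : nat -> R) (b : R).

Lemma ex_partial_sum_gt mu : (forall j, (1 <= j)%N -> 0 < mu j) ->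
  (\sum_(1 <= j <oo) ((mu j)^-1)%:E = +oo)%E ->
  forall C, exists n, C < \sum_(1 <= j < n) (mu j)^-1.
Proof.
move=> mu0 div C; apply/not_existsP => h.
have le n : \sum_(1 <= j < n) (mu j)^-1 <= C by rewrite leNgt; apply/negP/h.
have : (\sum_(1 <= j <oo) ((mu j)^-1)%:E <= C%:E)%E.
  apply: lime_le; first by apply: is_cvg_nneseries => n n1 _; rewrite lee_fin invr_ge0 ltW ?mu0.
  by apply: nearW => n; rewrite sumEFin lee_fin.
by rewrite div leye_eq.
Qed.

Lemma j0_ge1 b : 0 < b < 1 -> (1 <= j0 b)%N.
Proof.
move=> /andP[b0 b1]; rewrite /j0.
have l0 : 0 < ln b^-1 by rewrite ln_gt0// invf_gt1.
have : (0 < Num.ceil (ln b^-1))%R by rewrite ceil_gt0.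
by case: (Num.ceil _) => // -[|n]//; rewrite maxEle /= => _.
Qed.

Lemma expRN_j0_le b : 0 < b -> expR (- (j0 b)%:R) <= b.
Proof.
move=> b0; rewrite -[leRHS]lnK ?posrE// ler_expR lerNl -lnV ?posrE//.
rewrite /j0 natr_absz ger0_norm; last by rewrite le_max lexx.
apply: (le_trans (ceil_ge _)).
by rewrite ler_int le_max lexx orbT.
Qed.

(** Divergence bounds the defining set, so the supremum is a maximum. The second claim is its
    maximality; it reaches index D + 1, which is why derivatives up to that order and D + 2 points
    are used in [remez_bang]. *)
Lemma bang_degreeP lam b : (forall j, (1 <= j)%N -> 0 < lam j) ->
  (forall C, exists n, C < \sum_(1 <= j < n) (lam j)^-1) ->
  (j0 b <= bang_degree lam b)%N /\
  expR 1 <= \sum_((j0 b).+1 <= j < (bang_degree lam b).+2) (lam j)^-1.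
Proof.
move=> lam0 div; set J := j0 b.
pose A := [set k : nat | \sum_(J.+1 <= j < k.+1) (lam j)^-1 < expR 1].
have AJ : A J by rewrite /A /= big_geq// expR_gt0.
have [m Am] : exists m, forall k, A k -> (k <= m)%N.
  have [n hn] := div (\sum_(1 <= j < J.+1) (lam j)^-1 + expR 1).
  exists n => k Ak; rewrite leqNgt; apply/negP => nk.
  have : \sum_(1 <= j < n) (lam j)^-1 < \sum_(1 <= j < J.+1) (lam j)^-1 + expR 1.
    have [nJ|Jn] := leqP n J.+1.
      rewrite -[ltLHS]addr0 ler_ltD ?expR_gt0//.
      have [n1|n1] := leqP 1 n; last first.
        rewrite big_geq; last by rewrite ltnW.
        by rewrite big_nat sumr_ge0// => i /andP[i1 _]; rewrite invr_ge0 ltW ?lam0.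
      rewrite [leRHS](big_cat_nat (n := n))//= lerDl big_nat sumr_ge0// => i /andP[i1 _].
      by rewrite invr_ge0 ltW ?lam0// (leq_trans n1).
    rewrite (big_cat_nat (n := J.+1))//=; last exact: ltnW.
    rewrite ltrD2l; apply: le_lt_trans Ak.
    rewrite [leRHS](big_cat_nat (n := n))//=; [|exact: ltnW|exact/ltnW/ltnW].
    rewrite lerDl big_nat sumr_ge0// => i /andP[i1 _].
    by rewrite invr_ge0 ltW ?lam0// (leq_trans _ i1)// (leq_trans _ Jn).
  by move=> /(lt_trans hn); rewrite ltxx.
have [D [AD ADmax]] : exists D, A D /\ forall k, A k -> (k <= D)%N.
  have [] := @ex_maxnP (fun k => `[< A k >]) m.
  - by exists J; apply/asboolP.
  - by move=> i /asboolP; exact: Am.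
  by move=> D /asboolP AD h; exists D; split => // k Ak; apply: h; apply/asboolP.
have DE : bang_degree lam b = D.
  have sD : supremums A D.
    by split=> [k /ADmax//|k]; apply.
  rewrite /bang_degree /supremum ifF; last first.
    by apply/negP => /eqP A0; have : A J by []; rewrite /A A0.
  apply: (@is_subset1_supremums _ _ A); last exact: sD.
  by apply: xgetPex; exists D.
rewrite DE; split; first exact: ADmax.
rewrite leNgt; apply/negP => h.
by have := ADmax D.+1 h; rewrite ltnn.
Qed.

End bang_degree_facts.

Section spaced.
Context {R : realType}.

(** Greedy choice: take a point within del' - del of the infimum, discard an interval of length del'
    starting at the infimum, and repeat. The slack del' - del makes up for an infimum that is not
    attained. *)
Lemma spaced_points (k : nat) (A : set R) (del del' : R) :
  0 < del -> del < del' -> measurable A -> has_lbound A ->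
  ((k%:R * del')%:E < lebesgue_measure A)%E ->
  exists y : nat -> R, (forall i, (i <= k)%N -> A (y i)) /\
    forall i, (i < k)%N -> y i + del <= y i.+1.
Proof.
move=> del0 dd'; elim: k A => [|k IH] A mA lbA mA_gt.
  have [A0|/set0P[y Ay]] := eqVneq A set0.
    by move: mA_gt; rewrite A0 measure0 mul0r ltxx.
  by exists (fun=> y).
have A0 : A !=set0.
  apply/set0P/eqP => A0; move: mA_gt; rewrite A0 measure0 lte_fin.
  by rewrite ltNge mulr_ge0//; lra.
have infA : has_inf A by split.
have e0 : 0 < del' - del by lra.
have [y0 Ay0 y0lt] := inf_adherent e0 infA.
pose s := inf A.
pose A' := A `&` `[s + del', +oo[%classic.
have mA' : measurable A' by exact: measurableI.
have [||y [yA ysp]] := IH A' mA'.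
- by case: lbA => z zA; exists z => x [Ax _]; exact: zA.
- have AE : A `<=` A' `|` `[s, s + del'[%classic.
    move=> x Ax; have sx : s <= x by exact: inf_lbound.
    have [h|h] := leP (s + del') x; [left; split => //|right]; rewrite /= in_itv /=.
      by rewrite andbT.
    by rewrite sx.
  have : (lebesgue_measure A <= lebesgue_measure A' + del'%:E)%E.
    apply: (@le_trans _ _ (lebesgue_measure (A' `|` `[s, (s + del')%R[%classic))).
      by apply: le_measure; rewrite ?inE//; exact: measurableU.
    apply: (@le_trans _ _ (lebesgue_measure A' + lebesgue_measure `[s, (s + del')%R[%classic)%E); first exact: measureU2.
    rewrite leeD2l//.
    rewrite lebesgue_measure_itv /= lte_fin ifT; last by lra.
    by rewrite -EFinB lee_fin; lra.
  move=> /(lt_le_trans mA_gt).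
  case: (lebesgue_measure A') => [r| |]; rewrite ?ltry ?ltNye//.
  by rewrite -EFinD !lte_fin -natr1 mulrDl mul1r; lra.
exists (fun i => if i is j.+1 then y j else y0); split.
  by case=> [|i] ik //; have [] := yA i ik.
case=> [|i] ik; last exact: ysp.
have [_] := yA 0%N isT; rewrite /= in_itv /= andbT => h.
by move: y0lt; rewrite -/s; lra.
Qed.

Lemma spaced_pointsD k (y : nat -> R) del : (forall i, (i < k)%N -> y i + del <= y i.+1) ->
  forall i j, (i < j)%N -> (j <= k)%N -> y i + (j - i)%:R * del <= y j.
Proof.
move=> h i; elim=> // j IH; rewrite ltnS leq_eqVlt => /orP[/eqP <- ik|ij jk].
  by rewrite subSnn mul1r h.
have := IH ij (ltnW jk); have := h j jk.
by rewrite subSn 1?ltnW// -natr1 mulrDl mul1r; lra.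
Qed.

Lemma spaced_points_in (D : nat) (E : set R) (m : R) :
  measurable E -> E `<=` `[0, 1]%classic -> 0 < m -> (m%:E <= lebesgue_measure E)%E ->
  exists y : nat -> R, (forall i, (i <= D)%N -> E (y i)) /\
    forall i j, (i < j)%N -> (j <= D)%N -> y i + (j - i)%:R * (m / (2 * D.+1%:R)) <= y j.
Proof.
move=> mE E01 m0 mleE; have D0 : 0 < D.+1%:R :> R by rewrite ltr0n.
have del0 : 0 < m / (2 * D.+1%:R) by rewrite divr_gt0// mulr_gt0.
(* With del' = 2 del = m / (D+1), the D discarded intervals have total length less than m. *)
have [|||y [yE ysp]] := @spaced_points D E _ (m / D.+1%:R) del0 _ mE.
- by rewrite invfM mulrA mulrAC gtr_pMr ?divr_gt0//; lra.
- by exists 0 => x /E01 /=; rewrite in_itv /= => /andP[].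
- apply: lt_le_trans mleE; rewrite lte_fin mulrCA gtr_pMr//.
  by rewrite ltr_pdivrMr// mul1r ltr_nat.
by exists y; split => //; exact: spaced_pointsD.
Qed.

End spaced.

(** * The growth index of the interpolating function *)

Section growth_index.
Context {R : realType}.
Implicit Types (f g mut : R -> R) (s t : R).

Lemma left_quotient_cvg g s : derivable g s 1 ->
  h^-1 * (g (s + h) - g s) @[h --> 0^'-] --> g^`()%classic s.
Proof.
move=> gd; apply: cvg_dnbhs_at_left.
have : h^-1 *: (g (h + s) - g s) @[h --> 0^'] --> g^`()%classic s.
  have := gd; rewrite /derivable /= /derive1.
  have -> : (fun h : R => h^-1 *: (g (h *: 1 + s) - g s)) = (fun h => h^-1 *: (g (h + s) - g s)).
    by apply/funext => h; rewrite /GRing.scale /= mulr1.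
  by [].
have -> // : (fun h => h^-1 *: (g (h + s) - g s)) = (fun h => h^-1 * (g (s + h) - g s)).
by apply/funext => h; rewrite [s + h]addrC.
Qed.

(** The point s may be the right end of a piece: the left derivative used there sees only values on
    that piece. *)
Lemma deriv1_piece f g t s : 1 <= t -> t < s ->
  (forall x, t <= x <= s -> f x = g x) -> derivable g s 1 ->
  deriv1 f s = g^`()%classic s.
Proof.
move=> t1 ts fg gd; rewrite /deriv1 ifF; last by apply/negbTE; rewrite -ltNge; lra.
have fl : h^-1 * (f (s + h) - f s) @[h --> 0^'-] --> g^`()%classic s.
  apply: cvg_trans (left_quotient_cvg gd); apply: near_eq_cvg.
  have st : 0 < s - t by lra.
  near=> h; rewrite !fg//; first by lra.
  have h0 : h < 0 by near: h; exact: nbhs_left_lt.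
  have : - (s - t) < h by near: h; apply: nbhs_left_gt; lra.
  by lra.
case: ifPn => [/asboolP fd|_]; last exact: cvg_lim fl.
have := cvg_unique _ (left_quotient_cvg fd) fl.
by apply.
Unshelve. all: by end_near. Qed.

Section growth.
Variables (mu : nat -> R) (mut : R -> R).
Hypothesis mutP : interpolant mu mut.

(** Without this the supremum in [gamma] could be a default value that bounds nothing. Finitely many
    pieces meet [1, K], and on each the derivative of the C^1 extension is bounded. *)
Lemma growth_index_has_ubound K :
  has_ubound [set s * deriv1 mut s / mut s | s in `[1, K]].
Proof.
have [mut_homo _ [t [t0 tinc tlim tg]] mut_gt0 _] := mutP.
have t_ge1 j : 1 <= t j by case: j => [|j]; [rewrite t0|rewrite -t0 ltW// tinc].
have ex_t s : exists j, s <= t j.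
  have := tlim; move/cvgryPge/(_ s) => [j _ hj]; exists j; exact: hj (leqnn j).
have bound j : exists B : R, forall s, t j <= s <= t j.+1 -> `|deriv1 mut s| <= B.
  have [g [gd gc gE]] := tg j.
  have tj : t j < t j.+1 by exact: tinc.
  have gE' x : t j <= x <= t j.+1 -> mut x = g x by move=> h; apply: gE; rewrite in_itv.
  have [|c _ hc] := @EVT_max R (fun s => `|g^`()%classic s|) (t j) (t j.+1) (ltW tj).
    apply: continuous_subspaceT => x; apply: continuous_comp; first exact: gc.
    exact: norm_continuous.
  have dg s : t j < s <= t j.+1 -> deriv1 mut s = g^`()%classic s.
    move=> /andP[s1 s2]; apply: (@deriv1_piece _ _ (t j)) => // x xs.
    by apply: gE'; lra.
  (* [dg] leaves out the left end t j, where [deriv1] may look at the previous piece; its value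
     there is added. *)
  exists (`|g^`()%classic c| + `|deriv1 mut 1| + `|deriv1 mut (t j)|) => s sI.
  have [->|sj] := eqVneq s (t j).
    by rewrite lerDr addr_ge0.
  rewrite dg; last by rewrite lt_neqAle eq_sym sj.
  rewrite -addrA -[leLHS]addr0 lerD ?addr_ge0//; apply: hc.
  by rewrite in_itv.
have [B hB] := choice bound.
have [J hJ] := ex_t K.
pose T := \sum_(j < J) `|B j|.
have dT s : 1 <= s <= K -> `|deriv1 mut s| <= T + `|B 0%N|.
  move=> sK; have [j0' hj0] := ex_t s.
  have exP : exists j, s <= t j.+1.
    by exists j0'; apply: (le_trans hj0); apply: ltW; exact: tinc.
  case: (ex_minnP exP) => j hj jmin.
  have tjs : t j <= s.
    case: j hj jmin => [|j] hj jmin; first by rewrite t0; lra.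
    by rewrite leNgt; apply/negP => h; have := jmin j (ltW h); rewrite ltnn.
  have [jJ|Jj] := ltnP j J.
    apply: (@le_trans _ _ `|B j|).
      by apply: le_trans (ler_norm _); apply: hB; rewrite tjs.
    rewrite /T (bigD1 (Ordinal jJ))//= -addrA lerDl addr_ge0// sumr_ge0//.
  have tJj : t J <= t j.
    by move: Jj; rewrite leq_eqVlt => /predU1P[->//|h]; apply/ltW/tinc.
  have sE : s = t J by lra.
  have sj : s = t j by lra.
  have j0E : j = 0%N.
    apply/eqP; rewrite eqn_leq leq0n andbT; case: j hj jmin tjs Jj tJj sj => // j hj jmin tjs Jj tJj sj.
    by have := jmin j; rewrite -sj lexx => /(_ isT); rewrite ltnn.
  apply: (@le_trans _ _ `|B 0%N|); last by rewrite lerDr sumr_ge0.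
  apply: le_trans (ler_norm _); apply: hB; rewrite -j0E sj lexx ltW//; exact: tinc.
exists (`|K| * (T + `|B 0%N|) / mut 1) => x [s /=]; rewrite in_itv /= => sK <- {x}.
have m1 : 0 < mut 1 by apply: mut_gt0.
have ms : mut 1 <= mut s by apply: mut_homo; lra.
apply: (@le_trans _ _ (`|s| * `|deriv1 mut s| / mut s)).
  by rewrite -normrM ler_wpM2r ?ler_norm// invr_ge0 ltW// (lt_le_trans m1).
apply: ler_pM; rewrite ?mulr_ge0 ?invr_ge0//; first by rewrite ltW// (lt_le_trans m1).
  by apply: ler_pM => //; [rewrite !ger0_norm; lra|exact: dT].
by rewrite lef_pV2 ?posrE// (lt_le_trans m1).
Qed.

(** On each piece ln mut - gamma ln has derivative (s mut'(s) / mut(s) - gamma) / s <= 0, so it is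
    nonincreasing on [1, K]. *)
Lemma mut_growth K x y : 1 <= x -> x <= y -> y <= K ->
  mut y * (x / y) `^ gamma mut K <= mut x.
Proof.
have [mut_homo _ [t [t0 tinc tlim tg]] mut_gt0 _] := mutP.
move=> x1 xy yK; set gam := gamma mut K.
have ubg s : 1 <= s <= K -> s * deriv1 mut s / mut s <= gam.
  move=> sK; apply: ub_le_sup; first exact: growth_index_has_ubound.
  by exists s; rewrite //= in_itv.
pose phi s := ln (mut s) - gam * ln s.
have t_ge1 j : 1 <= t j by case: j => [|j]; [rewrite t0|rewrite -t0 ltW// tinc].
have phi_le : forall j x y, 1 <= x -> x <= y -> y <= K -> y <= t j -> phi y <= phi x.
  elim=> [|j IH] {x1 xy yK}x {}y x1 xy yK yj; first by have -> : x = y by lra.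
  have [yj'|jy] := leP y (t j); first exact: IH.
  have piece z : 1 <= z -> t j <= z -> z <= y -> phi y <= phi z.
    move=> z1 jz zy; have [g [gd gc gE]] := tg j.
    have gE' u : t j <= u <= t j.+1 -> mut u = g u by move=> h; apply: gE; rewrite in_itv.
    rewrite /phi !gE'; [|lra|lra].
    have gpos u : z <= u <= y -> 0 < g u by move=> h; rewrite -gE'; [apply: mut_gt0; lra|lra].
    apply: (@le_of_derivative_le0 R (fun u => ln (g u) - gam * ln u)
      (fun u => g^`()%classic u / g u - gam / u) z y zy) => u uI.
      apply: is_deriveB.
        have gu : is_derive u 1 g (g^`()%classic u) by apply: DeriveDef; rewrite ?derive1E.
        have := @is_derive1_comp _ (@ln R) g u _ _ (is_derive1_ln (gpos u uI)) gu.
        by rewrite mulrC.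
      have u0 : 0 < u by lra.
      exact: (is_deriveZ gam (is_derive1_ln u0)).
    have u0 : 0 < u by lra.
    rewrite subr_le0 ler_pdivlMr// mulrC mulrA.
    have := ubg u ltac:(lra).
    rewrite (@deriv1_piece mut g (t j) u)//; last first.
    - by move=> w wI; apply: gE'; lra.
    - by lra.
    by rewrite gE'//; lra.
  have [jx|xj] := leP (t j) x; first exact: piece.
  by apply: (@le_trans _ _ (phi (t j))); [apply: piece => //; lra|apply: IH => //; lra].
have [j hj] : exists j, y <= t j.
  have := tlim; move/cvgryPge/(_ y) => [j _ hj]; exists j; exact: hj (leqnn j).
have := phi_le j x y x1 xy yK hj; rewrite /phi => h.
have x0 : 0 < x by lra. have y0 : 0 < y by lra.
have mx : 0 < mut x by apply: mut_gt0.
have my : 0 < mut y by apply: mut_gt0; lra.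
rewrite /powR gt_eqF ?divr_gt0// -[X in X * _](lnK my) -[leRHS](lnK mx) -expRD ler_expR.
by rewrite ln_div ?posrE//; lra.
Qed.

(** A negative value would make mut decrease from 1 to 2, by [mut_growth]. *)
Lemma gamma_ge0 K : 2 <= K -> 0 <= gamma mut K.
Proof.
move=> K2; have [mut_homo _ _ mut_gt0 _] := mutP.
have h := @mut_growth K 1 2 (lexx _) ltac:(lra) K2.
have m12 : mut 1 <= mut 2 by apply: mut_homo; lra.
have m2 : 0 < mut 2 by apply: mut_gt0; lra.
have {}h : (1 / 2) `^ gamma mut K <= 1.
  by rewrite -(ler_pM2l m2) mulr1; apply: le_trans m12.
move: h; rewrite /powR gt_eqF ?divr_gt0// -[leRHS]expR0 ler_expR.
rewrite ln_div ?posrE// ln1 sub0r mulrN oppr_le0 pmulr_lge0// ln_gt0//.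
by lra.
Qed.

End growth.

End growth_index.

Section remez_quasianalytic.
Context {R : realType}.

(** Multiplying mu by a changes the Bang degree but not the growth index, so the constant is that of
    mu itself. *)
Lemma remez_quasianalytic (mu : nat -> R) (mut : R -> R) (M0 a b0 m eps : R)
    (G : nat -> R -> R) (E : set R) (N : nat) :
  N = (2 * bang_degree (fun j => (a * mu j)%R) (b0 / M0)%R)%N ->
  interpolant mu mut -> 0 < mu 1%N ->
  (forall i j, (1 <= i)%N -> (i <= j)%N -> mu i <= mu j) ->
  (\sum_(1 <= j <oo) ((mu j)^-1)%:E = +oo)%E ->
  0 < a -> 0 < b0 -> b0 < M0 ->
  derivative_chain G ->
  (forall j x, 0 <= x <= 1 -> `|G j x| <= Mseq (fun j => a * mu j) M0 j) ->
  b0 <= `|G 0%N 0| ->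
  measurable E -> E `<=` `[0, 1]%classic -> 0 < m -> (m%:E <= lebesgue_measure E)%E ->
  (forall x, E x -> `|G 0%N x| <= eps) ->
  `|G 0%N 0| * m ^+ N <= C_ mut N * eps.
Proof.
move=> NE mutP mu1 mu_homo div a0 b00 b0M Gd GM hb mE E01 m0 mleE Geps.
have M00 : 0 < M0 by lra.
have mu_gt0 j : (1 <= j)%N -> 0 < mu j by move=> j1; apply: lt_le_trans mu1 _; exact: mu_homo.
pose lam j := a * mu j.
have lam0 j : (1 <= j)%N -> 0 < lam j by move=> j1; rewrite mulr_gt0 ?mu_gt0.
have divlam C : exists n, C < \sum_(1 <= j < n) (lam j)^-1.
  have [n hn] := ex_partial_sum_gt mu_gt0 div (C * a).
  exists n; under eq_bigr do rewrite /lam invfM.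
  by rewrite -mulr_sumr mulrC ltr_pdivlMr.
pose D := bang_degree lam (b0 / M0).
have [j0D hsum] := @bang_degreeP R lam (b0 / M0) lam0 divlam.
rewrite -/D in j0D hsum.
have b01 : 0 < b0 / M0 < 1 by rewrite divr_gt0//= ltr_pdivrMr// mul1r.
have D1 : (1 <= D)%N by exact: leq_trans (j0_ge1 b01) j0D.
rewrite -/lam -/D in NE.
have D2N : (D.+1 <= N)%N by rewrite NE; clear -D1; lia.
have N2 : 2 <= N%:R :> R by rewrite ler_nat; apply: leq_trans D2N; rewrite ltnS.
have m1 : m <= 1.
  rewrite -lee_fin; apply: (le_trans mleE).
  apply: (@le_trans _ _ (lebesgue_measure `[(0:R), 1]%classic)).
    by apply: le_measure; rewrite ?inE.
  by rewrite lebesgue_measure_itv /= lte_fin ltr01 oppr0 adde0.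
have [y [yE ysp]] := spaced_points_in D.+1 mE E01 m0 mleE.
rewrite NE /C_.
apply: (@remez_bang R G lam M0 (gamma mut (2 * D)%:R) (m / (2 * D.+2%:R)) eps m D (j0 (b0 / M0)) y) => //.
- move=> i j i1 ij; rewrite /lam ler_pM2l//; exact: mu_homo.
- by rewrite -NE; exact: (gamma_ge0 mutP).
- move=> i /andP[i1 iD]; rewrite /lam -mulrA ler_pM2l//.
  have [_ _ _ _ mutE] := mutP.
  by rewrite -!mutE//; apply: (mut_growth mutP); rewrite ?ler_nat ?ler1n// -NE.
- have := @expRN_j0_le R (b0 / M0); case/andP: b01 => h _ /(_ h).
  by rewrite ler_pdivlMr// => /le_trans; apply.
- by rewrite m0.
- by move=> i iD; have /E01 := yE i iD; rewrite /= in_itv.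
- by move=> i iD; apply: Geps; exact: yE.
Qed.

End remez_quasianalytic.

(** * Lebesgue measure on R^n *)

Section lebesgue_outer_measure.
Context {R : realType} {n : nat}.
Implicit Types (A : set 'rV[R]_n.+1).
Local Open Scope ereal_scope.

Lemma box_volume_ge0 (a b : 'rV[R]_n.+1) : (0 <= box_volume a b)%R.
Proof. by apply: prodr_ge0 => i _; rewrite le_max lexx. Qed.

Lemma lebesgue_rV_ge0 A : 0 <= lebesgue_rV A.
Proof.
apply: le_ereal_inf_tmp => _ [c _ <-]; apply: nneseries_ge0 => k _ _.
by rewrite lee_fin box_volume_ge0.
Qed.

Lemma le_lebesgue_rV A B : A `<=` B -> lebesgue_rV A <= lebesgue_rV B.
Proof.
move=> AB; apply: le_ereal_inf_tmp => _ [c cB <-]; apply: ereal_inf_lbound.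
by exists c => //; exact: subset_trans cB.
Qed.

Lemma lebesgue_rV_cover A (e : R) : lebesgue_rV A < +oo -> (0 < e)%R ->
  exists c : nat -> 'rV[R]_n.+1 * 'rV[R]_n.+1,
    A `<=` \bigcup_k box (c k).1 (c k).2 /\
    \sum_(k <oo) (box_volume (c k).1 (c k).2)%:E <= lebesgue_rV A + e%:E.
Proof.
move=> Aoo e0.
have Afin : lebesgue_rV A \is a fin_num by rewrite ge0_fin_numE// lebesgue_rV_ge0.
have [_ [c cA <-] /ltW h] := lb_ereal_inf_adherent e0 Afin.
by exists c.
Qed.

Lemma lebesgue_rV_le_sum A (c : nat -> 'rV[R]_n.+1 * 'rV[R]_n.+1) :
  A `<=` \bigcup_k box (c k).1 (c k).2 ->
  lebesgue_rV A <= \sum_(k <oo) (box_volume (c k).1 (c k).2)%:E.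
Proof. by move=> cA; apply: ereal_inf_lbound; exists c. Qed.

Lemma lebesgue_rV_box (a b : 'rV[R]_n.+1) A : A `<=` box a b ->
  lebesgue_rV A <= (box_volume a b)%:E.
Proof.
(* The cover is completed by empty boxes with lower corner 0 and upper corner -1, of volume 0. *)
move=> Aab; pose c (k : nat) : 'rV[R]_n.+1 * 'rV[R]_n.+1 := if k == 0%N then (a, b) else (const_mx 0%R, const_mx (- 1)%R).
apply: le_trans (lebesgue_rV_le_sum (c := c) _) _.
  by move=> x /Aab; exists 0%N.
rewrite nneseries_recl//; last by move=> k _; rewrite lee_fin box_volume_ge0.
rewrite /= eseries0 ?adde0// => k k0 _; rewrite /c gt_eqF//=.
rewrite /box_volume (bigD1 ord0)//=.
by rewrite !mxE subr0 max_l ?mul0r// oppr_le0.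
Qed.

(** This fails in dimension 0, where every box has volume 1 as an empty product; hence the dimension
    n + 1 here and below. *)
Lemma lebesgue_rV0 : lebesgue_rV (set0 : set 'rV[R]_n.+1) = 0.
Proof.
apply/eqP; rewrite eq_le lebesgue_rV_ge0 andbT.
apply: le_trans (@lebesgue_rV_box 0 0 set0 _) _ => //.
by rewrite /box_volume (bigD1 ord0)//= !mxE subr0 maxxx mul0r.
Qed.

Lemma lebesgue_rV_sigma_subadditive :
  sigma_subadditive (lebesgue_rV : set 'rV[R]_n.+1 -> \bar R).
Proof.
move=> F; have [[i ioo]|noo] := pselect (exists i, lebesgue_rV (F i) = +oo).
  by rewrite (eseries_pinfty _ _ ioo) ?leey// => k _; rewrite -ltNye (lt_le_trans _ (lebesgue_rV_ge0 _)).
apply/lee_addgt0Pr => e e0.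
rewrite (le_trans _ (epsilon_trick xpredT (fun k => lebesgue_rV_ge0 (F k)) (ltW e0)))//.
have /choice[G PG] : forall k, exists c : nat -> 'rV[R]_n.+1 * 'rV[R]_n.+1,
    F k `<=` \bigcup_j box (c j).1 (c j).2 /\
    \sum_(j <oo) (box_volume (c j).1 (c j).2)%:E <= lebesgue_rV (F k) + (e / (2 ^ k.+1)%:R)%:E.
  move=> k; apply: lebesgue_rV_cover; last by rewrite divr_gt0// ltr0n expn_gt0.
  by rewrite ltey; apply/eqP => h; apply: noo; exists k.
have /card_esym/ppcard_eqP[f] := card_nat2.
pose c m := G (f m).1 (f m).2.
pose v (p : nat * nat) := (box_volume (G p.1 p.2).1 (G p.1 p.2).2)%:E.
have v0 p : 0 <= v p by rewrite lee_fin box_volume_ge0.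
apply: (@le_trans _ _ (\sum_(m <oo) v (f m))).
  apply: (lebesgue_rV_le_sum (c := c)) => x [k _] /(PG k).1[j _ xkj].
  by exists (f^-1%FUN (k, j)) => //=; rewrite /c invK ?inE.
have -> : \sum_(m <oo) v (f m) = \sum_(k <oo) \sum_(j <oo) v (k, j).
  rewrite nneseries_esumT// [RHS]nneseries_esumT; last by move=> k; exact: nneseries_ge0.
  under [RHS]eq_esum do rewrite nneseries_esumT//.
  rewrite (@esum_esum _ _ _ setT (fun=> setT) (fun k j => v (k, j)))//.
  rewrite (@reindex_esum _ _ _ setT (setT `*`` (fun=> setT)) f (fun p => v (p.1, p.2))).
    by apply: eq_esum => m _; case: (f m).
  split; [by move=> m _; split|by move=> m m' _ _ h; apply: (@inj _ _ setT f); rewrite ?inE|].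
  by move=> p _; exists (f^-1%FUN p) => //; rewrite invK ?inE.
apply: lee_nneseries => k _; first by move=> _; exact: nneseries_ge0.
exact: (PG k).2.
Qed.

HB.instance Definition _ := isOuterMeasure.Build R 'rV[R]_n.+1 lebesgue_rV
  lebesgue_rV0 lebesgue_rV_ge0 le_lebesgue_rV lebesgue_rV_sigma_subadditive.

End lebesgue_outer_measure.

Section lebesgue_measure_rV.
Context {R : realType} {n : nat}.
Local Open Scope ereal_scope.

Definition rV_outer : {outer_measure set 'rV[R]_n.+1 -> \bar R} := lebesgue_rV.

(** A copy of the space whose measurable sets are the Caratheodory sets, so that product measures
    and Fubini's theorem apply to [lebesgue_rV]. *)
Definition rV_leb : Type := caratheodory_type rV_outer.

HB.instance Definition _ := Measurable.on rV_leb.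

Definition leb_rV : set rV_leb -> \bar R := rV_outer.

HB.instance Definition _ := Measure.on leb_rV.

(** Cutting each box of a cover at height t produces covers of the two parts whose volumes add up to
    at most the original volume. *)
Lemma caratheodory_halfspace (i : 'I_n.+1) (t : R) :
  lebesgue_measurable [set x : 'rV[R]_n.+1 | (x 0%R i <= t)%R].
Proof.
apply: (@le_caratheodory_measurable _ _ rV_outer) => X; rewrite /rV_outer /=.
have [Xoo|Xfin] := eqVneq (lebesgue_rV X) +oo; first by rewrite Xoo leey.
apply/lee_addgt0Pr => e e0.
have [|c [Xc le]] := @lebesgue_rV_cover R n X e _ e0; first by rewrite ltey.
apply: le_trans le.
pose c1 k := ((c k).1, (\row_j if j == i then Num.min ((c k).2 0%R i) t else (c k).2 0%R j)%R).
pose c2 k := ((\row_j if j == i then Num.max ((c k).1 0%R i) t else (c k).1 0%R j)%R, (c k).2).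
apply: (@le_trans _ _ (\sum_(k <oo) (box_volume (c1 k).1 (c1 k).2)%:E +
   \sum_(k <oo) (box_volume (c2 k).1 (c2 k).2)%:E)).
  apply: leeD; apply: lebesgue_rV_le_sum => x [/Xc[k _ xk] /= xt]; exists k => // j.
    have := xk j; rewrite /c1 /= !mxE; case: eqP => [->|//] /andP[-> h] /=.
    by rewrite le_min h.
  have := xk j; rewrite /c2 /= !mxE; case: eqP => [->|//] /andP[h ->].
  by rewrite andbT ge_max h; move/negP: xt; rewrite -ltNge => /ltW.
rewrite -nneseriesD; [|by move=> k _; rewrite lee_fin box_volume_ge0..].
apply: lee_nneseries => k _.
  by move=> _; rewrite -EFinD lee_fin addr_ge0 ?box_volume_ge0.
rewrite -EFinD lee_fin /box_volume (bigD1 i)//= [X in (_ + X <= _)%R](bigD1 i)//= [leRHS](bigD1 i)//= !mxE eqxx.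
set P := (\prod_(j | j != i) Num.max 0 ((c k).2 0 j - (c k).1 0 j))%R.
set P1 := (\prod_(j | j != i) _)%R; have -> : P1 = P.
  by apply: eq_bigr => j ji; rewrite mxE (negPf ji).
set P2 := (\prod_(j | j != i) Num.max 0 ((c k).2 0 j - fun_of_matrix _ _ _))%R; have -> : P2 = P.
  by apply: eq_bigr => j ji; rewrite mxE (negPf ji).
rewrite -mulrDl ler_wpM2r//.
  by apply: prodr_ge0 => j _; rewrite le_max lexx.
move: ((c k).1 0%R i) ((c k).2 0%R i) => a b.
by rewrite !maxEle !minEle; do ![case: ifP => ?]; lra.
Qed.

End lebesgue_measure_rV.

Section borel_rV.
Context {R : realType} {n : nat}.
Implicit Types (A B U : set 'rV[R]_n.+1).

Definition rV_measurable {d} {T : measurableType d} (phi : T -> 'rV[R]_n.+1) : Prop :=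
  forall i, measurable_fun [set: T] (fun t => phi t 0 i).

(* Measurability of the preimages under all coordinatewise measurable maps
   replaces the Borel sigma-algebra of R^n. *)
Definition borel_rV A : Prop :=
  forall d (T : measurableType d) (phi : T -> 'rV[R]_n.+1),
    rV_measurable phi -> measurable (phi @^-1` A).

Lemma borel_rVC A : borel_rV A -> borel_rV (~` A).
Proof. by move=> bA d T phi mphi; rewrite preimage_setC; apply: measurableC; exact: bA. Qed.

Lemma borel_rVI A B : borel_rV A -> borel_rV B -> borel_rV (A `&` B).
Proof.
by move=> bA bB d T phi mphi; rewrite preimage_setI; apply: measurableI; [exact: bA|exact: bB].
Qed.

Lemma borel_rVD A B : borel_rV A -> borel_rV B -> borel_rV (A `\` B).
Proof. by move=> bA bB; rewrite setDE; apply: borel_rVI => //; exact: borel_rVC. Qed.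

Lemma borel_rV_bigcup (F : nat -> set 'rV[R]_n.+1) :
  (forall k, borel_rV (F k)) -> borel_rV (\bigcup_k F k).
Proof.
move=> bF d T phi mphi; rewrite preimage_bigcup; apply: bigcupT_measurable => k.
exact: bF.
Qed.

Lemma borel_rV_box (a b : 'rV[R]_n.+1) : borel_rV (box a b).
Proof.
move=> d T phi mphi.
have -> : phi @^-1` box a b =
    \bigcap_(i in [set: 'I_n.+1]) ((fun t => phi t 0 i) @^-1` `[a 0 i, b 0 i]%classic).
  apply/seteqP; split => [t h i _|t h i]; first by rewrite /= in_itv /=; exact: h.
  by have := h i I; rewrite /= in_itv.
apply: fin_bigcap_measurable => // i _.
by rewrite -[X in measurable X]setTI; apply: mphi.
Qed.

(** The boxes of side 2/(k+1) centred at the points of the grid of mesh 1/(k+1), over all k, form a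
    countable family, enumerated through [unpickle]. Those contained in U cover it. *)
Lemma borel_rV_open U : open U -> borel_rV U.
Proof.
move=> oU.
pose c (p : nat * {ffun 'I_n.+1 -> int}) (s : R) : 'rV[R]_n.+1 :=
  \row_i ((p.2 i)%:~R / p.1.+1%:R + s / p.1.+1%:R).
pose F m : set 'rV[R]_n.+1 := if unpickle m is Some p then
  (if `[< box (c p (-1)) (c p 1) `<=` U >] then box (c p (-1)) (c p 1) else set0) else set0.
have -> : U = \bigcup_m F m.
  apply/seteqP; split => [x Ux|x [m _]]; last first.
    by rewrite /F; case: (unpickle m) => // p; case: ifPn => // /asboolP; exact.
  have [e /= e0 xeU] : nbhs_ball x U by apply/nbhs_ballP; exact: open_nbhs_nbhs.
  have [k hk] : exists k : nat, 2 / k.+1%:R < e.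
    exists (Num.truncn (2 / e)); rewrite ltr_pdivrMr// mulrC -ltr_pdivrMr//.
    exact: truncnS_gt.
  have k0 : 0 < k.+1%:R :> R by rewrite ltr0n.
  pose p : nat * {ffun 'I_n.+1 -> int} := (k, [ffun i => Num.floor (x 0 i * k.+1%:R)]).
  have xp i : (p.2 i)%:~R / k.+1%:R <= x 0 i < (p.2 i)%:~R / k.+1%:R + 1 / k.+1%:R.
    rewrite ffunE -mulrDl ler_pdivrMr// ltr_pdivlMr//.
    by rewrite floor_le_tmp//= -intrD1 floorD1_gt.
  have bU : box (c p (-1)) (c p 1) `<=` U.
    move=> y yp; apply: xeU; split => // i j; rewrite [i]ord1.
    rewrite /ball /= ltr_norml.
    have := yp j; have := xp j; rewrite !mxE /=.
    set u := (_%:~R / _); have -> : -1 / k.+1%:R = - (1 / k.+1%:R) :> R by rewrite mulNr.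
    have : 2 / k.+1%:R = 2 * (1 / k.+1%:R) :> R by rewrite mul1r.
    set w := 1 / _ => E; rewrite E in hk; lra.
  exists (pickle p) => //; rewrite /F pickleK; rewrite ifT; last exact/asboolP.
  move=> i; have := xp i; rewrite !mxE /=.
  set u := (_%:~R / _); have -> : -1 / k.+1%:R = - (1 / k.+1%:R) :> R by rewrite mulNr.
  have : 0 < 1 / k.+1%:R :> R by rewrite divr_gt0.
  by set w := 1 / _; lra.
apply: borel_rV_bigcup => m; rewrite /F; case: (unpickle m) => [p|].
  case: ifPn => _; first exact: borel_rV_box.
  by move=> d T phi _; rewrite preimage_set0; exact: measurable0.
by move=> d T phi _; rewrite preimage_set0; exact: measurable0.
Qed.

Lemma borel_rV_closed A : closed A -> borel_rV A.
Proof. by move=> cA; rewrite -[A]setCK; apply/borel_rVC/borel_rV_open/closed_openC. Qed.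

Lemma rV_leb_measurable_coord : rV_measurable (fun x : @rV_leb R n => (x : 'rV[R]_n.+1)).
Proof.
move=> i; apply: (measurability _ (RGenOInfty.measurableE R)) => //.
move=> _ [_ [t ->] <-]; rewrite setTI.
have -> : (fun x : @rV_leb R n => (x : 'rV[R]_n.+1) 0 i) @^-1` `]t, +oo[%classic =
    ~` [set x : 'rV[R]_n.+1 | x 0 i <= t].
  apply/seteqP; split => x /=; rewrite in_itv /= andbT; first by rewrite ltNge => /negP.
  by move/negP; rewrite -ltNge.
exact/caratheodory_measurable_setC/caratheodory_halfspace.
Qed.

Lemma borel_rV_measurable A : borel_rV A -> measurable (A : set (@rV_leb R n)).
Proof. by move=> bA; exact: (bA _ _ _ rV_leb_measurable_coord). Qed.

Lemma leb_rV_sigma_finite : sigma_finite [set: @rV_leb R n] (@leb_rV R n).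
Proof.
exists (fun k => box (const_mx (- k%:R)) (const_mx k%:R)).
  apply/seteqP; split => // x _.
  exists (Num.truncn (\sum_i `|(x : 'rV[R]_n.+1) 0 i|)).+1 => // i; rewrite !mxE -ler_norml.
  apply: (@le_trans _ _ (\sum_i `|(x : 'rV[R]_n.+1) 0 i|)).
    by rewrite (bigD1 i)//= lerDl sumr_ge0.
  exact/ltW/truncnS_gt.
move=> k; split; first exact/borel_rV_measurable/borel_rV_box.
exact: le_lt_trans (lebesgue_rV_box (@subset_refl _ _)) (ltry _).
Qed.

HB.instance Definition _ := Measure_isSigmaFinite.Build _ _ _ (@leb_rV R n) leb_rV_sigma_finite.

End borel_rV.

Section fubini_sections.
Context {R : realType} {d1 d2 : measure_display}.
Context {T1 : measurableType d1} {T2 : measurableType d2}.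
Variables (m1 : {sigma_finite_measure set T1 -> \bar R}).
Variables (m2 : {sigma_finite_measure set T2 -> \bar R}).
Variables (A : set (T1 * T2)) (J : set T1) (V : set T2).
Hypotheses (mA : measurable A) (mJ : measurable J) (mV : measurable V).
Local Open Scope ereal_scope.

Let B := A `&` (J `*` V).

Let mB : measurable B.
Proof. by apply: measurableI => //; exact: measurableX. Qed.

Let xsB s : m2 (xsection B s) = if s \in J then m2 (V `&` [set v | A (s, v)]) else 0.
Proof.
case: ifPn; rewrite ?notin_setE ?inE => Js.
  congr (m2 _); apply/seteqP; split => v; rewrite /xsection /= inE /B /=.
    by move=> [Asv [_ Vv]].
  by move=> [Vv Asv].
suff -> : xsection B s = set0 by rewrite measure0.
by apply/seteqP; split => v //; rewrite /xsection /= inE => -[_ []].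
Qed.

Let ysB v : m1 (ysection B v) = if v \in V then m1 (J `&` [set s | A (s, v)]) else 0.
Proof.
case: ifPn; rewrite ?notin_setE ?inE => Vv.
  congr (m1 _); apply/seteqP; split => s; rewrite /ysection /= inE /B /=.
    by move=> [Asv [Js _]].
  by move=> [Js Asv].
suff -> : ysection B v = set0 by rewrite measure0.
by apply/seteqP; split => s //; rewrite /ysection /= inE => -[_ []].
Qed.

Let intB : \int[m1]_s m2 (xsection B s) = \int[m2]_v m1 (ysection B v).
Proof.
have := indic_fubini_tonelli m1 m2 mB.
under eq_integral do rewrite (indic_fubini_tonelli_FE _ mB) /=.
by under [X in _ = X -> _]eq_integral do rewrite (indic_fubini_tonelli_GE _ mB) /=.
Qed.

Let mx : measurable_fun setT (fun s => m2 (xsection B s)).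
Proof. exact: measurable_fun_xsection. Qed.

Let my : measurable_fun setT (fun v => m1 (ysection B v)).
Proof. exact: measurable_fun_ysection. Qed.

Let integral_lower d (T : measurableType d) (m : {measure set T -> \bar R})
    (C : set T) (f : T -> \bar R) (h : R) :
  measurable C -> measurable_fun setT f -> (0 <= h)%R -> (forall x, 0 <= f x) ->
  (forall x, C x -> h%:E <= f x) -> h%:E * m C <= \int[m]_x f x.
Proof.
move=> mC mf h0 f0 hf; rewrite -integral_cst//.
apply: (@le_trans _ _ (\int[m]_(x in C) f x)).
  by apply: ge0_le_integral => //; exact: measurable_funTS.
exact: ge0_subset_integral.
Qed.

Let integral_upper d (T : measurableType d) (m : {measure set T -> \bar R})
    (C : set T) (f : T -> \bar R) (h : R) :
  measurable C -> measurable_fun setT f -> (0 <= h)%R -> (forall x, 0 <= f x) ->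
  (forall x, C x -> f x <= h%:E) -> (forall x, ~ C x -> f x = 0) -> \int[m]_x f x <= h%:E * m C.
Proof.
move=> mC mf h0 f0 hf fC; rewrite -integral_cst//.
have -> : \int[m]_x f x = \int[m]_(x in C) f x.
  rewrite [RHS]integral_mkcond; apply: eq_integral => x _; rewrite patchE.
  by case: ifPn => //; rewrite notin_setE => /fC.
by apply: ge0_le_integral => //; exact: measurable_funTS.
Qed.

(** Double counting: the measure of the part of A over J and V, computed by sections in either
    order, separates the two sides. *)
Lemma fubini_sections_le (h t : R) : (0 <= h)%R -> (0 <= t)%R ->
  (forall s, J s -> h%:E <= m2 (V `&` [set v | A (s, v)])) ->
  (forall v, V v -> m1 (J `&` [set s | A (s, v)]) <= t%:E) ->
  h%:E * m1 J <= t%:E * m2 V.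
Proof.
move=> h0 t0 hx hy; apply: (@le_trans _ _ (\int[m1]_s m2 (xsection B s))).
  by apply: integral_lower => // s Js; rewrite xsB ifT ?inE//; exact: hx.
rewrite intB; apply: integral_upper => // v Vv; rewrite ysB.
  by rewrite ifT ?inE//; exact: hy.
by rewrite ifF//; apply/negbTE; rewrite notin_setE.
Qed.

Lemma fubini_sections_ge (h t : R) : (0 <= h)%R -> (0 <= t)%R ->
  (forall s, J s -> m2 (V `&` [set v | A (s, v)]) <= h%:E) ->
  (forall v, V v -> t%:E <= m1 (J `&` [set s | A (s, v)])) ->
  t%:E * m2 V <= h%:E * m1 J.
Proof.
move=> h0 t0 hx hy; apply: (@le_trans _ _ (\int[m1]_s m2 (xsection B s))).
  by rewrite intB; apply: integral_lower => // v Vv; rewrite ysB ifT ?inE//; exact: hy.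
apply: integral_upper => // s Js; rewrite xsB.
  by rewrite ifT ?inE//; exact: hx.
by rewrite ifF//; apply/negbTE; rewrite notin_setE.
Qed.

End fubini_sections.

(** * Outer measure under Lipschitz maps *)

Section lebesgue_lipschitz.
Context {R : realType} {n : nat}.
Implicit Types (A : set 'rV[R]_n.+1) (a b : 'rV[R]_n.+1).

Lemma mx_norm_le (x : 'rV[R]_n.+1) (c : R) : (`|x| <= c) = [forall i, `|x 0 i| <= c].
Proof.
rewrite [leLHS]/Num.norm /= mx_normrE.
apply/idP/forallP => [h i|h].
  by apply: le_trans h; apply: (le_bigmax _ (fun ij => `|x ij.1 ij.2|) (0, i)).
apply: bigmax_le => [|[i j] _ /=]; last by rewrite ord1.
by have := h ord0; apply: le_trans.
Qed.

Lemma coord_le_norm (x : 'rV[R]_n.+1) i : `|x 0 i| <= `|x|.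
Proof. by have := lexx `|x|; rewrite mx_norm_le => /forallP/(_ i). Qed.

Lemma mx_norm_leP (x : 'rV[R]_n.+1) (c : R) :
  (`|x| <= c) <-> (forall i, `|x 0 i| <= c).
Proof. by rewrite mx_norm_le; split => [/forallP//|h]; apply/forallP. Qed.

Lemma lebesgue_rV_fin_union (I : finType) A (S : I -> set 'rV[R]_n.+1) :
  (forall x, A x -> exists j, S j x) -> (lebesgue_rV A <= \sum_j lebesgue_rV (S j))%E.
Proof.
move=> AS; rewrite -big_enum /=.
have {}AS x : A x -> exists2 j, j \in enum I & S j x.
  by move=> /AS[j Sj]; exists j; rewrite ?mem_enum.
elim: (enum I) A AS => [|i s IH] A AS.
  rewrite big_nil; suff -> : A = set0 by rewrite lebesgue_rV0.
  by apply/seteqP; split => x // /AS[j]; rewrite in_nil.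
rewrite big_cons; apply: (@le_trans _ _ (lebesgue_rV (S i `|` (A `\` S i)))).
  by apply: le_lebesgue_rV => x Ax; have [Sx|Sx] := pselect (S i x); [left|right].
apply: (le_trans (outer_measureU2 (@rV_outer R n) _ _)); apply: leeD2l.
apply: IH => x [/AS[j]]; rewrite inE => /orP[/eqP -> //|js Sx _].
by exists j.
Qed.

(** Continuity at 0 of the polynomial prod_i (l_i + X). It serves to thicken degenerate boxes at
    little cost. *)
Lemma prodD_le (l : 'I_n.+1 -> R) (e : R) : 0 < e ->
  exists2 th, 0 < th & \prod_i (l i + th) <= \prod_i l i + e.
Proof.
move=> e0; pose p : {poly R} := \prod_i ((l i)%:P + 'X).
have pE x : p.[x] = \prod_i (l i + x).
  by rewrite horner_prod; apply: eq_bigr => i _; rewrite !hornerE.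
have /cvgrPdist_lt/(_ e e0) := @continuous_horner R p 0.
rewrite /= -nearE => /nbhs_ballP[d /= d0 hd].
exists (d / 2); first by rewrite divr_gt0.
have : ball (0 : R) d (d / 2) by rewrite /ball /= sub0r normrN ger0_norm; lra.
move=> /hd /=; rewrite !pE ltr_distl => /andP[+ _].
have -> : \prod_i (l i + 0) = \prod_i l i by apply: eq_bigr => i _; rewrite addr0.
by move=> h; lra.
Qed.

Section lipschitz.
Variables (I : Type) (D : set I) (p q : I -> 'rV[R]_n.+1) (Lam : R).
Hypothesis Lam_gt0 : 0 < Lam.
Hypothesis pq : forall x y, D x -> D y -> `|p x - p y| <= Lam * `|q x - q y|.

Lemma lebesgue_rV_small (h : R) (S : set I) : 0 <= h -> S `<=` D ->
  (forall x y, S x -> S y -> `|q x - q y| <= h) ->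
  (lebesgue_rV (p @` S) <= ((2 * Lam * h) ^+ n.+1)%:E)%E.
Proof.
move=> h0 SD Sh; have [->|/set0P[x0 Sx0]] := eqVneq S set0.
  by rewrite image_set0 lebesgue_rV0 lee_fin exprn_ge0// mulr_ge0// mulr_ge0// ltW.
have r0 : 0 <= Lam * h by rewrite mulr_ge0// ltW.
have -> : (2 * Lam * h) ^+ n.+1 =
    box_volume (p x0 - const_mx (Lam * h)) (p x0 + const_mx (Lam * h)).
  rewrite /box_volume -[n.+1 in LHS]card_ord -prodr_const; apply: eq_bigr => i _.
  by rewrite !mxE max_r; lra.
apply: lebesgue_rV_box => _ [x Sx <-] i.
have : `|p x - p x0| <= Lam * h.
  apply: (le_trans (pq (SD _ Sx) (SD _ Sx0))); rewrite ler_wpM2l ?(ltW Lam_gt0)//.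
  exact: Sh.
move=> /mx_norm_leP/(_ i); rewrite !mxE ler_norml; lra.
Qed.

(** A sup-norm Lipschitz bound controls the image of a cube, not of an elongated box. The box is cut
    into cubes whose side h is at most every l_i; rounding l_i / h up costs at most a factor 2 in
    each direction, and each image lies in a cube of side 2 Lam h. *)
Lemma lebesgue_rV_lipschitz_box a (l : 'I_n.+1 -> R) : (forall i, 0 < l i) ->
  (lebesgue_rV (p @` (D `&` q @^-1` box a (a + \row_i l i))) <=
   ((4 * Lam) ^+ n.+1 * \prod_i l i)%:E)%E.
Proof.
move=> l0; pose h := \big[Num.min/1]_i l i.
have h0 : 0 < h by apply: lt_bigmin => // i _; exact: l0.
have hl i : h <= l i by exact: bigmin_le_cond.
pose N i := (Num.truncn (l i / h)).+1.
pose M := \max_i N i.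
have NM i : (N i <= M)%N by exact: (leq_bigmax i).
have M0 : (0 < M)%N by apply: leq_trans (NM ord0).
have ltN i : l i / h < (N i)%:R by exact: truncnS_gt.
have leN i : (N i)%:R * h <= 2 * l i.
  have le1 : (Num.truncn (l i / h))%:R <= l i / h.
    by rewrite truncn_le divr_ge0 ?ltW.
  rewrite /N -natr1 mulrDl mul1r.
  have : (Num.truncn (l i / h))%:R * h <= l i by rewrite -ler_pdivlMr.
  by have := hl i; lra.
pose S (j : {ffun 'I_n.+1 -> 'I_M}) : set I := [set x | D x /\ (forall i, (j i < N i)%N) /\
  forall i, a 0 i + (j i)%:R * h <= q x 0 i <= a 0 i + (j i).+1%:R * h].
apply: (@le_trans _ _ (\sum_j lebesgue_rV (p @` S j))%E).
  apply: lebesgue_rV_fin_union => _ [x [Dx xab] <-].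
  have jP i : exists k : 'I_M, (k < N i)%N /\
      a 0 i + k%:R * h <= q x 0 i <= a 0 i + k.+1%:R * h.
    have := xab i; rewrite !mxE => /andP[x1 x2].
    have u0 : 0 <= (q x 0 i - a 0 i) / h by rewrite divr_ge0 ?(ltW h0)//; lra.
    have kN : (Num.truncn ((q x 0%R i - a 0%R i) / h)%R < N i)%N.
      rewrite -(ltr_nat R); apply: le_lt_trans (ltN i).
      apply: (@le_trans _ _ ((q x 0 i - a 0 i) / h)); first by rewrite truncn_le.
      by rewrite ler_pM2r ?invr_gt0//; lra.
    exists (Ordinal (leq_trans kN (NM i))) => /=; split => //.
    have t1 : (Num.truncn ((q x 0 i - a 0 i) / h))%:R * h <= q x 0 i - a 0 i.
      by rewrite -ler_pdivlMr// truncn_le.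
    have t2 : q x 0 i - a 0 i <= (Num.truncn ((q x 0 i - a 0 i) / h)).+1%:R * h.
      by rewrite -ler_pdivrMr// ltW// truncnS_gt.
    by lra.
  have /choice[j hj] := jP.
  exists [ffun i => j i], x => //; split => //; split => i; rewrite ffunE; by have [] := hj i.
(* All coordinates share the index type ['I_M]; surplus cells get weight 0, so that the sum over
   cells factors into a product over coordinates. *)
pose w i (k : 'I_M) : R := if (k < N i)%N then 2 * Lam * h else 0.
have w0 i k : 0 <= w i k by rewrite /w; case: ifP => // _; rewrite !mulr_ge0// ltW.
apply: (@le_trans _ _ (\sum_(j : {ffun 'I_n.+1 -> 'I_M}) (\prod_i w i (j i))%:E)%E).
  apply: lee_sum => j _.
  have [jN|] := boolP [forall i, (j i < N i)%N]; last first.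
    move=> /forallPn[i ji].
    have -> : S j = set0.
      by apply/seteqP; split => x // -[_ [/(_ i) h' _]]; move: ji; rewrite h'.
    by rewrite image_set0 lebesgue_rV0 lee_fin prodr_ge0.
  have -> : \prod_i w i (j i) = (2 * Lam * h) ^+ n.+1.
    rewrite -[n.+1 in RHS]card_ord -prodr_const; apply: eq_bigr => i _.
    by rewrite /w (forallP jN i).
  apply: lebesgue_rV_small; first exact: ltW.
    by move=> x [].
  move=> x y [_ [_ hx]] [_ [_ hy]]; apply/mx_norm_leP => i; rewrite !mxE.
  by have := hx i; have := hy i; rewrite -natr1 mulrDl mul1r ler_norml; lra.
rewrite sumEFin lee_fin -(bigA_distr_bigA w).
have -> : (4 * Lam) ^+ n.+1 * \prod_i l i = \prod_i (4 * Lam * l i).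
  by rewrite big_split /= prodr_const card_ord.
apply: ler_prod => i _; rewrite sumr_ge0//=.
have -> : \sum_j w i j = (N i)%:R * (2 * Lam * h).
  rewrite /w -big_mkcond /= -(big_ord_widen M (fun=> 2 * Lam * h) (NM i)).
  by rewrite sumr_const card_ord [RHS]mulr_natl.
have := leN i; rewrite -(ler_pM2l (_ : 0 < 2 * Lam)); last by rewrite mulr_gt0.
by lra.
Qed.

(** The hypothesis says that p is a Lipschitz function of q. Using two maps on a common index set
    covers images (q = id) and also sets on which a map expands distances (p = id), without naming
    an inverse map. *)
Lemma lebesgue_rV_lipschitz :
  (lebesgue_rV (p @` D) <= ((4 * Lam) ^+ n.+1)%:E * lebesgue_rV (q @` D))%E.
Proof.
set C := (4 * Lam) ^+ n.+1.
have C0 : 0 < C by rewrite exprn_gt0// mulr_gt0.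
have [->|qfin] := eqVneq (lebesgue_rV (q @` D)) +oo%E.
  by rewrite gt0_muley ?leey// lte_fin.
apply/lee_addgt0Pr => e e0.
have e20 : 0 < e / C / 2 by rewrite !divr_gt0.
have [||c [qc lec]] := @lebesgue_rV_cover R n (q @` D) (e / C / 2); rewrite ?ltey//.
pose V k := box_volume (c k).1 (c k).2.
pose ek (k : nat) : R := e / C / 2 / (2 ^ k.+1)%:R.
have ek0 k : 0 < ek k by rewrite /ek divr_gt0// ltr0n expn_gt0.
(* Covering boxes may have empty sides, which the box lemma excludes. The sides are lengthened by th
   k at a cost ek k that is summable over k. *)
have /choice[th hth] : forall k, exists th : R, 0 < th /\
    \prod_i (Num.max 0 ((c k).2 0 i - (c k).1 0 i) + th) <= V k + ek k.
  by move=> k; have [th ? ?] := prodD_le (fun i => Num.max 0 ((c k).2 0 i - (c k).1 0 i)) (ek0 k); exists th.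
pose l k i := Num.max 0 ((c k).2 0 i - (c k).1 0 i) + th k.
have l0 k i : 0 < l k i.
  by rewrite ltr_wpDl ?le_max ?lexx//; have [] := hth k.
pose P k := p @` (D `&` q @^-1` box (c k).1 ((c k).1 + \row_i l k i)).
apply: (@le_trans _ _ (lebesgue_rV (\bigcup_k P k))).
  apply: le_lebesgue_rV => _ [x Dx <-].
  have [k _ qk] : (\bigcup_k box (c k).1 (c k).2) (q x) by apply: qc; exists x.
  exists k => //; exists x => //; split => // i; rewrite !mxE.
  have /andP[-> h] /= := qk i; apply: (le_trans h).
  rewrite /l; have [th0 _] := hth k.
  have : (c k).2 0 i - (c k).1 0 i <= Num.max 0 ((c k).2 0 i - (c k).1 0 i).
    by rewrite le_max lexx orbT.
  by lra.
apply: (le_trans (lebesgue_rV_sigma_subadditive P)).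
apply: (@le_trans _ _ (\sum_(k <oo) (C%:E * (V k + ek k)%:E))%E).
  apply: lee_nneseries => k _; first by move=> _; exact: lebesgue_rV_ge0.
  apply: (le_trans (lebesgue_rV_lipschitz_box _ (l0 k))).
  by rewrite -EFinM lee_fin ler_pM2l//; have [] := hth k.
rewrite nneseriesZl; last first.
  by move=> k _; rewrite lee_fin addr_ge0 ?(ltW (ek0 k))// box_volume_ge0.
have V0 k : (0 <= (V k)%:E)%E by rewrite lee_fin box_volume_ge0.
have : (\sum_(k <oo) (V k + ek k)%:E <= lebesgue_rV (q @` D) + (e / C)%:E)%E.
  have e2 : 0 <= e / C / 2 by exact: ltW.
  apply: (le_trans (epsilon_trick xpredT V0 e2)).
  rewrite [X in (_ <= _ + X%:E)%E](_ : e / C = e / C / 2 + e / C / 2); last by lra.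
  by rewrite EFinD addeA leeD2r.
have Cfin : (0 <= C%:E)%E by rewrite lee_fin ltW.
move=> /(lee_wpmul2l Cfin) /le_trans; apply.
rewrite ge0_muleDr ?lebesgue_rV_ge0//; last by rewrite lee_fin divr_ge0// ltW.
by rewrite leeD2l// -EFinM lee_fin mulrC divfK// gt_eqF.
Qed.

End lipschitz.
End lebesgue_lipschitz.

(** * Sublevel sets and preimages of polynomial maps *)

Section polynomial_remez.
Context {R : realType}.

(** Having degree at most D, p is its own interpolant at D + 1 separated points of E. *)
Lemma poly_remez (p : {poly R}) (D : nat) (E : set R) (m eps : R) :
  (size p <= D.+1)%N -> measurable E -> E `<=` `[0, 1]%classic -> 0 < m ->
  (m%:E <= lebesgue_measure E)%E -> (forall s, E s -> `|p.[s]| <= eps) ->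
  `|p.[0]| * m ^+ D <= (4 * D.+1%:R) ^+ D * eps.
Proof.
move=> szp mE E01 m0 mleE pE.
have D0 : 0 < D.+1%:R :> R by rewrite ltr0n.
pose del := m / (2 * D.+1%:R).
have del0 : 0 < del by rewrite divr_gt0// mulr_gt0.
have [y [yE yspD]] := spaced_points_in D mE E01 m0 mleE.
have eps0 : 0 <= eps by apply: le_trans (pE _ (yE 0%N isT)).
have y01 i : (i <= D)%N -> 0 <= y i <= 1.
  by move=> iD; have /E01 := yE i iD; rewrite /= in_itv.
have [P [szP Py Pd]] := @interpolation_bound R D y (fun i => p.[y i]) del eps del0 eps0 y01 yspD
  (fun i iD => pE _ (yE i iD)).
have pP : p = P.
  apply/eqP; rewrite -subr_eq0; apply/negPn/negP => nz.
  have yinj : {in iota 0 D.+1 &, injective y}.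
    move=> i j; rewrite !mem_iota /= !add0n !ltnS => iD jD yij.
    apply/eqP; apply/negPn/negP; rewrite neq_ltn => /orP[] h.
    - have := yspD i j h jD; rewrite yij gerDl.
      by rewrite leNgt mulr_gt0// ltr0n subn_gt0.
    - have := yspD j i h iD; rewrite yij gerDl.
      by rewrite leNgt mulr_gt0// ltr0n subn_gt0.
  have := @max_poly_roots _ (p - P) [seq y i | i <- iota 0 D.+1] nz.
  rewrite size_map size_iota map_inj_in_uniq ?iota_uniq//.
  have -> : all (root (p - P)) [seq y i | i <- iota 0 D.+1].
    apply/allP => _ /mapP[i + ->]; rewrite mem_iota /= add0n ltnS => iD.
    by rewrite rootE !hornerE Py// subrr.
  move=> /(_ isT isT); apply/negP; rewrite -leqNgt.
  by apply: (leq_trans (size_polyD _ _)); rewrite size_polyN geq_max szp szP.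
have := Pd 0%N 0; rewrite lexx ler01 derivn0 ffactn0 mulr1 -pP => /(_ isT) p0.
have mD : 0 <= m ^+ D by rewrite exprn_ge0 ?ltW.
apply: (le_trans (ler_wpM2r mD p0)).
rewrite -mulrA mulrC ler_wpM2r// mulrAC -exprMn /del.
have -> : 2 / (m / (2 * D.+1%:R)) * m = 4 * D.+1%:R :> R.
  by move: D0; set c := D.+1%:R => c0; clearbody c; field; rewrite !gt_eqF.
rewrite ler_pdivrMr ?ltr0n ?fact_gt0// -[leLHS]mulr1 ler_wpM2l ?exprn_ge0 ?mulr_ge0 ?(ltW D0)//.
by rewrite ler1n fact_gt0.
Qed.

End polynomial_remez.

Section mpoly_facts.
Context {R : realType} {n : nat}.
Implicit Types (P : mpoly n R).

Lemma mnm_le_msize P (D : nat) m i : (mmeasure mdeg P <= D.+1)%N -> m \in msupp P ->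
  (m i <= D)%N.
Proof.
move=> szP mP; have := leq_trans (msize_mdeg_lt mP) szP; rewrite ltnS.
apply: leq_trans; rewrite mdegE (bigD1 i)//=; exact: leq_addr.
Qed.

(** The polynomial Q i k put in place of x_i^k need not be a k-th power, and the degree bound
    concerns only exponents that occur. This freedom is what [power_segment_polynomial] exploits. *)
Lemma mpoly_substitution P (D : nat) (Q : 'I_n -> nat -> {poly R}) :
  (mmeasure mdeg P <= D.+1)%N ->
  (forall m, m \in msupp P -> forall i, (size (Q i (m i)) <= (m i).+1)%N) ->
  let p := \sum_(m <- msupp P) mcoeff m P *: \prod_i Q i (m i) in
  (size p <= D.+1)%N /\
  forall s, p.[s] = \sum_(m <- msupp P) mcoeff m P * \prod_i (Q i (m i)).[s].
Proof.
move=> szP szQ p; split; last first.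
  move=> s; rewrite /p horner_sum; apply: eq_bigr => m _.
  by rewrite hornerZ horner_prod.
rewrite /p big_seq; apply: (leq_trans (size_sum _ _ _)); apply/bigmax_leqP_seq => m mP _.
apply: (leq_trans (size_scale_leq _ _)); apply: (leq_trans (size_prod_leq _ _)).
have mD := leq_trans (msize_mdeg_lt mP) szP.
apply: leq_trans mD; rewrite leq_subLR.
have -> : #|[pred _ : 'I_n | true]| = (\sum_(i < n) 1)%N by rewrite sum1_card.
rewrite addnS ltnS mdegE -big_split /=; apply: leq_sum => i _.
by rewrite add1n szQ.
Qed.

Lemma meval_line P (D : nat) (a u : 'I_n -> R) : (mmeasure mdeg P <= D.+1)%N ->
  exists p : {poly R}, (size p <= D.+1)%N /\
    forall s, p.[s] = meval (fun i => a i + s * u i) P.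
Proof.
move=> szP; pose q i : {poly R} := (a i)%:P + u i *: 'X.
have szq i : (size (q i) <= 2)%N.
  apply: (leq_trans (size_polyD _ _)); rewrite geq_max (leq_trans (size_polyC_leq1 _))//=.
  by apply: (leq_trans (size_scale_leq _ _)); rewrite size_polyX.
have [|szp pE] := @mpoly_substitution P D (fun i k => q i ^+ k) szP.
  move=> m _ i; apply: (leq_trans (size_poly_exp_leq _ _)); rewrite ltnS.
  by rewrite -[leqRHS]mul1n leq_mul2r; apply/orP; right; rewrite -ltnS; case: (size _) (szq i).
eexists; split; first exact: szp.
move=> s; rewrite pE mevalE; apply: eq_bigr => m _; congr (_ * _); apply: eq_bigr => i _.
by rewrite horner_exp /q !hornerE mulrC.
Qed.

Lemma measurable_meval d (T : measurableType d) (phi : T -> 'I_n -> R) P :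
  (forall i, measurable_fun [set: T] (fun t => phi t i)) ->
  measurable_fun [set: T] (fun t => meval (phi t) P).
Proof.
move=> mphi; under eq_fun do rewrite mevalE.
apply: measurable_sum => m; apply: measurable_funM; first exact: measurable_cst.
by apply: measurable_prod => i _; exact: measurable_funX.
Qed.

(* Inverting the Vandermonde matrix of the nodes recovers every coefficient of P
   from its values on a grid. *)
Lemma coef_norm_le_value (D : nat) : exists2 c : R, 0 < c &
  forall P, (mmeasure mdeg P <= D.+1)%N ->
    exists2 y : 'rV[R]_n, unit_cube y & c * coef_norm P <= `|meval (fun i => y 0 i) P|.
Proof.
pose t (g : 'I_D.+1) : R := g%:R / D.+1%:R.
pose V : 'M[R]_D.+1 := Vandermonde D.+1 (\row_g t g).
have Vunit : V \in unitmx.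
  rewrite unitmxE det_Vandermonde unitfE.
  apply/prodf_neq0 => i _; apply/prodf_neq0 => j ij; rewrite !mxE subr_eq0 /t.
  have d0 : D.+1%:R != 0 :> R by rewrite pnatr_eq0.
  by rewrite (inj_eq (mulIf (invr_neq0 d0))) eqr_nat gt_eqF.
pose L (r g : 'I_D.+1) := invmx V g r.
have LE (r s : 'I_D.+1) : \sum_g L r g * t g ^+ s = (r == s)%:R.
  have := congr1 (fun M : 'M[R]_D.+1 => M s r) (mulmxV Vunit).
  rewrite !mxE eq_sym => <-; apply: eq_bigr => g _.
  by rewrite /L /V !mxE mulrC.
pose Lam := \sum_(r : {ffun 'I_n -> 'I_D.+1}) \sum_(g : {ffun 'I_n -> 'I_D.+1}) \prod_i `|L (r i) (g i)|.
have Lam0 : 0 <= Lam by apply: sumr_ge0 => r _; apply: sumr_ge0 => g _; exact: prodr_ge0.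
pose pt (g : {ffun 'I_n -> 'I_D.+1}) : 'rV[R]_n := \row_i t (g i).
exists (1 + Lam)^-1 => [|P szP]; first by rewrite invr_gt0; lra.
pose g0 : {ffun 'I_n -> 'I_D.+1} := [ffun=> ord0].
pose vl (g : {ffun 'I_n -> 'I_D.+1}) : R := `|meval (fun i => pt g 0 i) P|.
have vl0 g : 0 <= vl g by exact: normr_ge0.
case: (@arg_maxP _ _ _ g0 xpredT vl isT) => g _ gmax.
exists (pt g).
  move=> i; rewrite mxE /t divr_ge0//= ler_pdivrMr ?ltr0n// mul1r ler_nat ltnW//.
(* After expansion, the contribution of a monomial is a product over coordinates of the sums in
   [LE]; it vanishes as soon as one exponent differs from that of m. *)
have ffE (m : multinom n) (r : {ffun 'I_n -> 'I_D.+1}) : (forall i, r i = m i :> nat) -> m \in msupp P ->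
    mcoeff m P = \sum_(g' : {ffun 'I_n -> 'I_D.+1}) (\prod_i L (r i) (g' i)) * meval (fun i => pt g' 0 i) P.
  move=> rm mP.
  under eq_bigr do rewrite mevalE mulr_sumr.
  rewrite exchange_big /= (bigD1_seq m)//= [X in _ + X]big1_seq ?addr0; last first.
    move=> m' /andP[m'm m'P].
    under eq_bigr do rewrite mulrCA -big_split /=.
    rewrite -mulr_sumr.
    pose r' : {ffun 'I_n -> 'I_D.+1} := [ffun i => inord (m' i)].
    have r'E i : r' i = m' i :> nat by rewrite ffunE inordK// ltnS (mnm_le_msize _ szP).
    under eq_bigr do under eq_bigr do rewrite mxE -r'E.
    rewrite -(bigA_distr_bigA (fun i g => L (r i) g * t g ^+ r' i)).
    have [i ri] : exists i, r i != r' i.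
      apply/not_existsP => h; move/eqP: m'm; apply; apply/mnmP => i; rewrite -rm -r'E.
      by apply/eqP; rewrite eq_sym; apply/negPn/negP => /h.
    by rewrite (bigD1 i)//= LE (negPf ri) mul0r mulr0.
  under eq_bigr do rewrite mulrCA -big_split /=.
  rewrite -mulr_sumr.
  under eq_bigr do under eq_bigr do rewrite mxE -rm.
  rewrite -(bigA_distr_bigA (fun i g => L (r i) g * t g ^+ r i)).
  rewrite big1 ?mulr1// => i _; by rewrite LE eqxx.
suff : coef_norm P <= (1 + Lam) * vl g by rewrite ler_pdivrMl//; lra.
pose rm (m : multinom n) : {ffun 'I_n -> 'I_D.+1} := [ffun i => inord (m i)].
have rmE (m : multinom n) i : m \in msupp P -> rm m i = m i :> nat.
  by move=> mP; rewrite ffunE inordK// ltnS (mnm_le_msize _ szP).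
apply: (@le_trans _ _ (Lam * vl g)); last by apply: ler_wpM2r; [exact: normr_ge0|lra].
apply: (@le_trans _ _ (\sum_(m <- msupp P) (\sum_(g' : {ffun 'I_n -> 'I_D.+1}) \prod_i `|L (rm m i) (g' i)|) * vl g)).
  rewrite /coef_norm big_seq [leRHS]big_seq; apply: ler_sum => m mP.
  rewrite (ffE m (rm m))//; last by move=> i; exact: rmE.
  apply: (le_trans (ler_norm_sum _ _ _)); rewrite mulr_suml; apply: ler_sum => g' _.
  by rewrite normrM normr_prod ler_wpM2l ?prodr_ge0//; exact: gmax.
rewrite -mulr_suml ler_wpM2r ?vl0//.
rewrite -(big_map rm xpredT (fun r => \sum_(g' : {ffun 'I_n -> 'I_D.+1}) \prod_i `|L (r i) (g' i)|)).
have urm : uniq [seq rm m | m <- msupp P].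
  rewrite map_inj_in_uniq ?msupp_uniq// => m m' mP m'P h.
  by apply/mnmP => i; rewrite -rmE// h rmE.
rewrite big_uniq//= big_mkcond /=; apply: ler_sum => r _; case: ifP => // _.
by apply: sumr_ge0 => g' _; exact: prodr_ge0.
Qed.

End mpoly_facts.

Section polynomial_sublevel.
Context {R : realType} {n : nat}.
Implicit Types (P : mpoly n.+1 R).

Lemma borel_rV_meval_le P (c : R) :
  borel_rV [set x : 'rV[R]_n.+1 | `|meval (fun i => x 0 i) P| <= c].
Proof.
move=> d T phi mphi.
have mf : measurable_fun [set: T] (fun t => `|meval (fun i => phi t 0 i) P|).
  by apply: measurableT_comp => //; exact: measurable_meval.
have := mf measurableT `]-oo, c]%classic (measurable_itv _); rewrite setTI.
by congr measurable; apply/seteqP; split => t /=; rewrite in_itv.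
Qed.

Lemma borel_unit_cube : borel_rV (@unit_cube R n.+1).
Proof.
have -> : @unit_cube R n.+1 = box (const_mx 0) (const_mx 1).
  by apply/seteqP; split => x h i; have := h i; rewrite !mxE.
exact: borel_rV_box.
Qed.

Lemma rV_measurable_homothety (y : 'rV[R]_n.+1) :
  rV_measurable (fun p : measurableTypeR R * @rV_leb R n =>
    y + p.1 *: ((p.2 : 'rV[R]_n.+1) - y)).
Proof.
move=> i; under eq_fun do rewrite !mxE.
apply: measurable_funD; first exact: measurable_cst.
apply: measurable_funM; first exact: measurable_fst.
apply: measurable_funD; last exact: measurable_cst.
exact: (measurableT_comp (rV_leb_measurable_coord i) measurable_snd).
Qed.

(* Fubini: S is large and is the image under a homothety of each section of A. *)
Lemma homothety_section (y : 'rV[R]_n.+1) (rho h : R) (S : set 'rV[R]_n.+1) :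
  borel_rV S -> 0 < rho -> (forall x, S x -> `|x - y| <= rho) ->
  0 < h -> (h%:E <= lebesgue_rV S)%E ->
  exists v, let F := `[2^-1, 1]%classic `&` [set s : R | S (y + s *: (v - y))] in
    measurable F /\ ((h / (4 * (16 * rho) ^+ n.+1))%:E < lebesgue_measure F)%E.
Proof.
move=> bS rho0 Srho h0 hS.
pose A := (fun p : measurableTypeR R * @rV_leb R n => y + p.1 *: ((p.2 : 'rV[R]_n.+1) - y)) @^-1` S.
have mA : measurable A by apply: bS; exact: rV_measurable_homothety.
pose J : set (measurableTypeR R) := `[2^-1, 1]%classic.
have mJ : measurable J by exact: measurable_itv.
(* As s >= 1/2, the preimages y + (x - y)/s of the points x of S stay within 2 rho of y. *)
pose V : set (@rV_leb R n) := box (y - const_mx (2 * rho)) (y + const_mx (2 * rho)).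
have mV : measurable V by exact/borel_rV_measurable/borel_rV_box.
have mF v : measurable (J `&` [set s | A (s, v)]).
  apply: measurableI => //; have := measurable_ysection v mA.
  by congr measurable; apply/seteqP; split => s; rewrite /ysection /= inE.
apply: contrapT => nv.
have rho40 : 0 < (16 * rho) ^+ n.+1 by rewrite exprn_gt0// mulr_gt0.
set t := h / _ in nv; have t0 : 0 < t by rewrite divr_gt0// mulr_gt0.
have hv v : V v -> (lebesgue_measure (J `&` [set s | A (s, v)]) <= t%:E)%E.
  move=> _; rewrite leNgt; apply/negP => lt; apply: nv; exists v; split => //; exact: mF.
pose c : R := (4 * 1) ^+ n.+1.
have c0 : 0 < c by rewrite exprn_gt0// mulr1.
have hc0 : 0 <= h / c by rewrite divr_ge0// ltW.
have hs s : J s -> ((h / c)%:E <= leb_rV (V `&` [set v | A (s, v)]))%E.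
  rewrite /J /= in_itv /= => /andP[s1 s2].
  have s0 : 0 < s by lra.
  have SV : S `<=` (fun v : 'rV[R]_n.+1 => y + s *: (v - y)) @` (V `&` [set v | A (s, v)]).
    move=> x Sx; have E : y + s *: (y + s^-1 *: (x - y) - y) = x.
      by rewrite addrAC subrr add0r scalerA divff ?gt_eqF// scale1r addrC subrK.
    exists (y + s^-1 *: (x - y)) => //; split; last by rewrite /A /= E.
    have si : s^-1 <= 2 by rewrite -[leRHS]invrK lef_pV2 ?posrE// invr_gt0.
    have si0 : 0 < s^-1 by rewrite invr_gt0.
    move=> i; rewrite !mxE; have : `|s^-1 * (x - y) 0 i| <= 2 * rho.
      rewrite normrM gtr0_norm//; apply: ler_pM => //; first exact: ltW.
      exact: le_trans (coord_le_norm _ _) (Srho x Sx).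
    by rewrite !mxE ler_norml => /andP[? ?]; apply/andP; split; lra.
  have := le_trans (le_lebesgue_rV SV) (@lebesgue_rV_lipschitz R n _ _ (fun v => y + s *: (v - y)) id 1 ltr01 _).
  rewrite image_id => le.
  rewrite EFinM lee_pdivrMr// muleC; apply: (le_trans hS); apply: le.
  move=> v w _ _ /=; rewrite mul1r opprD addrACA subrr add0r -scalerBr opprB addrA subrK.
  by rewrite normrZ gtr0_norm// ler_piMl.
have : ((h / c)%:E * lebesgue_measure J <= t%:E * leb_rV V)%E.
  have F := fubini_sections_le mA mJ mV hc0 (ltW t0) hs hv.
  exact F.
(* With c = 4^(n+1), Fubini would give h/(2c) <= t (4 rho)^(n+1) = h/(4c). *)
apply/negP; rewrite -ltNge.
have -> : lebesgue_measure J = (2^-1)%:E.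
  rewrite lebesgue_measure_itv /= lte_fin ifT; last by lra.
  by rewrite -EFinD; congr (_%:E); lra.
have Vle : (leb_rV V <= ((4 * rho) ^+ n.+1)%:E)%E.
  apply: (le_trans (lebesgue_rV_box (@subset_refl _ _))); rewrite lee_fin /box_volume.
  rewrite le_eqVlt; apply/orP; left; apply/eqP.
  rewrite -[n.+1 in RHS]card_ord -prodr_const; apply: eq_bigr => i _; rewrite !mxE.
  by rewrite max_r; lra.
have t0E : (0 <= t%:E)%E by rewrite lee_fin ltW.
apply: (le_lt_trans (lee_wpmul2l t0E Vle)).
rewrite -!EFinM lte_fin /t /c mulr1.
have -> : (16 * rho) ^+ n.+1 = 4 ^+ n.+1 * (4 * rho) ^+ n.+1.
  by rewrite -exprMn mulrA -natrM.
have := exprn_gt0 n.+1 (mulr_gt0 (ltr0n R 4) rho0).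
have : 0 < 4 ^+ n.+1 :> R by rewrite exprn_gt0.
set u := 4 ^+ n.+1; set w := (4 * rho) ^+ _ => u0 w0.
have -> : h / (4 * (u * w)) * w = h / u / 2 / 2 by clearbody u w; field; rewrite !gt_eqF.
have : 0 < h / u by rewrite divr_gt0.
by set e := h / u; lra.
Qed.

(* Rays through a point where P is large reduce the claim to poly_remez. *)
Lemma polynomial_sublevel (D : nat) :
  exists2 c : R, 0 < c & forall tau P, 0 < tau -> (mmeasure mdeg P <= D.+1)%N ->
    0 < coef_norm P ->
    (lebesgue_rV (unit_cube `&`
       [set x : 'rV[R]_n.+1 | (`|meval (fun i => x 0 i) P| <= c * coef_norm P * tau ^+ D)%R])
     <= tau%:E)%E.
Proof.
have [c0 c00 hc0] := @coef_norm_le_value R n.+1 D.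
pose K : R := 4 * (16 * 1) ^+ n.+1.
have K0 : 0 < K by rewrite mulr_gt0// exprn_gt0// mulr1.
pose B : R := (4 * D.+1%:R) ^+ D * K ^+ D.
have B0 : 0 < B by rewrite mulr_gt0 ?exprn_gt0// mulr_gt0// ltr0n.
(* B collects the losses of [poly_remez] and of [homothety_section]; the factor 2 makes the
   contradiction strict. *)
exists (c0 / (2 * B)) => [|tau P tau0 szP delta0].
  by apply: divr_gt0; rewrite // mulr_gt0.
set delta := coef_norm P in delta0 *.
pose c := c0 * delta / (2 * B).
have -> : c0 / (2 * B) * delta = c by rewrite /c mulrAC.
set S := _ `&` _; rewrite leNgt; apply/negP => /ltW tauS.
have bS : borel_rV S by apply: borel_rVI; [exact: borel_unit_cube|exact: borel_rV_meval_le].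
have [y y01 Py] := hc0 P szP.
have S1 x : S x -> `|x - y| <= 1.
  move=> [x01 _]; apply/mx_norm_leP => i; rewrite !mxE ler_norml.
  by have := x01 i; have := y01 i; move=> /andP[? ?] /andP[? ?]; apply/andP; split; lra.
have [v [mF]] := homothety_section bS ltr01 S1 tau0 tauS; rewrite -/K.
set F := _ `&` _ in mF *; set t := tau / K => tF.
have t0 : 0 < t by rewrite divr_gt0.
have [p [szp pE]] := @meval_line R n.+1 P D (fun i => y 0 i) (fun i => v 0 i - y 0 i) szP.
have := @poly_remez R p D _ t (c * tau ^+ D) szp mF _ t0 (ltW tF).
have -> : p.[0] = meval (fun i => y 0 i) P.
  by rewrite pE; apply: meval_eq => i; rewrite mul0r addr0.
move=> H; suff : ~~ (`|meval (fun i => y 0 i) P| * t ^+ D <= (4 * D.+1%:R) ^+ D * (c * tau ^+ D)).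
  apply/negP/negPn; apply: H => [s [+ _]|s [Js [_ /=]]].
    by rewrite /= !in_itv /= => /andP[s1 s2]; apply/andP; split; lra.
  rewrite pE; apply: le_trans; rewrite le_eqVlt; apply/orP; left; apply/eqP.
  by congr `|_|; apply: meval_eq => i; rewrite !mxE.
rewrite -ltNge.
apply: (@lt_le_trans _ _ (c0 * delta * t ^+ D)); last by rewrite ler_pM2r ?exprn_gt0.
rewrite /t expr_div_n [ltRHS]mulrA ltr_pdivlMr ?exprn_gt0//.
have -> : (4 * D.+1%:R) ^+ D * (c * tau ^+ D) * K ^+ D = (c0 * delta * tau ^+ D) / 2.
  rewrite [LHS](_ : _ = B * c * tau ^+ D); last by rewrite /B; ring.
  by rewrite /c; clearbody B; field; rewrite gt_eqF.
have : 0 < c0 * delta * tau ^+ D by rewrite !mulr_gt0// exprn_gt0.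
by set u := _ * tau ^+ D; lra.
Qed.

End polynomial_sublevel.

(** * Uniform second-order Taylor estimates for polynomials on the cube *)

Section quadratic_approximation.
Context {R : realType} {n : nat}.
Implicit Types (P Q : mpoly n.+1 R) (x y : 'rV[R]_n.+1) (C : R).

Let ev x P : R := meval (fun i => x 0 i) P.

(** A C^2 bound expressed through the Taylor remainder, so that no second derivatives occur and the
    property passes to products. *)
Definition tame C P : Prop := forall x y, unit_cube x -> unit_cube y ->
  [/\ `|ev x P| <= C, forall i, `|ev x (mderiv i P)| <= C &
      `|ev y P - ev x P - \sum_i ev x (mderiv i P) * (y 0 i - x 0 i)| <= C * `|y - x| ^+ 2].

Let T : R := (n.+3)%:R ^+ 2.

Let T1 : 1 <= T.
Proof. by rewrite /T exprn_ege1// ler1n. Qed.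

Let cube0 : @unit_cube R n.+1 0.
Proof. by move=> i; rewrite mxE lexx ler01. Qed.

Lemma tame_ge0 C P : tame C P -> 0 <= C.
Proof. by move=> /(_ 0 0 cube0 cube0) [h _ _]; exact: le_trans (normr_ge0 _) h. Qed.

Let cube_dist x y : unit_cube x -> unit_cube y -> `|y - x| <= 1.
Proof.
move=> hx hy; apply/mx_norm_leP => i; rewrite !mxE.
by have := hx i; have := hy i; rewrite ler_norml => /andP[? ?] /andP[? ?]; apply/andP; split; lra.
Qed.

Lemma tame_lipschitz C P x y : tame C P -> unit_cube x -> unit_cube y ->
  `|ev y P - ev x P| <= C * n.+2%:R * `|y - x|.
Proof.
move=> tP hx hy; have C0 := tame_ge0 tP; have [_ h1 h2] := tP x y hx hy.
set S := \sum_i _ in h2; set u := `|y - x| in h2 *.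
have u0 : 0 <= u by exact: normr_ge0.
have u1 : u <= 1 by exact: cube_dist.
have hS : `|S| <= C * n.+1%:R * u.
  apply: (le_trans (ler_norm_sum _ _ _)).
  apply: (@le_trans _ _ (\sum_(i < n.+1) C * u)); last first.
    by rewrite sumr_const card_ord mulrAC mulr_natr.
  apply: ler_sum => i _; rewrite normrM ler_pM//.
  by have := coord_le_norm (y - x) i; rewrite !mxE.
have -> : ev y P - ev x P = (ev y P - ev x P - S) + S by rewrite subrK.
apply: (le_trans (ler_normD _ _)); apply: (le_trans (lerD h2 hS)).
rewrite -[n.+2%:R]natr1 [C * (_ + 1)]mulrDr mulr1 mulrDl addrC lerD2l.
by rewrite expr2 ler_wpM2l// ler_piMl.
Qed.

(** The remainder of P Q is that of P times Q, plus P times that of Q, plus the product of the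
    increments, which is quadratic by [tame_lipschitz]. The constants add up to 2 + (n+2)^2 <= T. *)
Lemma tameM C C' P Q : tame C P -> tame C' Q -> tame (C * C' * T) (P * Q).
Proof.
move=> tP tQ x y hx hy.
have C0 := tame_ge0 tP; have C0' := tame_ge0 tQ.
have CC : 0 <= C * C' by rewrite mulr_ge0.
have [p0 p1 p2] := tP x y hx hy; have [q0 q1 q2] := tQ x y hx hy.
have lp := tame_lipschitz tP hx hy; have lq := tame_lipschitz tQ hx hy.
have dM i : ev x (mderiv i (P * Q)) = ev x (mderiv i P) * ev x Q + ev x P * ev x (mderiv i Q).
  by rewrite /ev mderivM mevalD !mevalM.
have T4 : 4 <= T by rewrite /T -natrX ler_nat; case: (n) => // k; rewrite !mulnS; lia.
split.
- rewrite /ev mevalM normrM; apply: le_trans (_ : C * C' <= _); first exact: ler_pM.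
  by rewrite ler_peMr.
- move=> i; rewrite dM; apply: (le_trans (ler_normD _ _)); rewrite !normrM.
  apply: le_trans (_ : C * C' * 2 <= _); last by rewrite ler_wpM2l//; lra.
  by rewrite -natr1 mulrDr mulr1 lerD// ler_pM.
have -> : ev y (P * Q) - ev x (P * Q) - \sum_i ev x (mderiv i (P * Q)) * (y 0 i - x 0 i) =
  (ev y P - ev x P - \sum_i ev x (mderiv i P) * (y 0 i - x 0 i)) * ev x Q +
  ev x P * (ev y Q - ev x Q - \sum_i ev x (mderiv i Q) * (y 0 i - x 0 i)) +
  (ev y P - ev x P) * (ev y Q - ev x Q).
  rewrite (_ : \sum_i ev x (mderiv i (P * Q)) * (y 0 i - x 0 i) =
     ev x Q * \sum_i ev x (mderiv i P) * (y 0 i - x 0 i) + ev x P * \sum_i ev x (mderiv i Q) * (y 0 i - x 0 i)).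
    have -> : forall z, ev z (P * Q) = ev z P * ev z Q by move=> z; exact: mevalM.
    ring.
  rewrite !mulr_sumr -big_split /=; apply: eq_bigr => i _; rewrite dM; ring.
set u := `|y - x| in p2 q2 lp lq *; set a := ev y P - _ - _ in p2 *; set b := ev y Q - _ - _ in q2 *.
have u0 : 0 <= u by exact: normr_ge0.
apply: (le_trans (ler_normD _ _)); apply: (le_trans (lerD (ler_normD _ _) (lexx _))); rewrite !normrM.
apply: (@le_trans _ _ (C * u ^+ 2 * C' + C * (C' * u ^+ 2) + (C * n.+2%:R * u) * (C' * n.+2%:R * u))).
  by rewrite !lerD// ler_pM.
rewrite [leLHS](_ : _ = C * C' * u ^+ 2 * (2 + n.+2%:R ^+ 2)); last by ring.
rewrite [leRHS](_ : _ = C * C' * u ^+ 2 * T); last by ring.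
rewrite ler_wpM2l//; first by rewrite mulr_ge0// exprn_ge0.
have w1 : 1 <= n.+2%:R :> R by rewrite ler1n.
have -> : T = (n.+2%:R + 1) ^+ 2 by rewrite natr1.
by move: w1; set w := n.+2%:R => w1; rewrite sqrrD1 -mulr_natl; lra.
Qed.

Lemma tame1 : tame 1 1.
Proof.
move=> x y hx hy; rewrite /ev; split => [|i|].
- by rewrite rmorph1 normr1.
- by rewrite -mpolyC1 mderivC rmorph0 normr0.
rewrite big1; first by rewrite !rmorph1 !subrr normr0 mul1r exprn_ge0.
by move=> i _; rewrite -mpolyC1 mderivC rmorph0 mul0r.
Qed.

Lemma tameX i : tame 1 (mpolyX R (mnm1 i)).
Proof.
move=> x y hx hy; rewrite /ev.
have dE j : meval (fun i => x 0 i) (mderiv j (mpolyX R (mnm1 i))) = (i == j)%:R.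
  rewrite mderivX mnmE; case: eqVneq => [->|_]; first last.
    by rewrite scale0r raddf0.
  rewrite scale1r (_ : mnm_sub (mnm1 j) (mnm1 j) = mnm0) ?mpolyX0 ?rmorph1//.
  by apply/mnmP => k; rewrite !mnmE subnn.
split => [|j|].
- by rewrite mevalXU; have /andP[? ?] := hx i; rewrite ger0_norm.
- by rewrite dE normr_nat lern1; case: (i == j).
rewrite (bigD1 i)//= big1 ?addr0 => [|j ji]; last by rewrite dE eq_sym (negPf ji) mul0r.
by rewrite dE eqxx !mevalXU [true%:R * _]mul1r subrr normr0 mul1r exprn_ge0.
Qed.

Lemma tame_monomial (m : multinom n.+1) : tame (T ^+ mdeg m) (mpolyX R m).
Proof.
have [k] := ubnP (mdeg m); elim: k m => // k IH m mk.
have [->|m0] := eqVneq m mnm0.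
  by rewrite mdeg0 expr0 mpolyX0; exact: tame1.
have [i mi] : exists i, m i != 0%N.
  apply/not_existsP => h; move/eqP: m0; apply; apply/mnmP => i.
  by rewrite mnmE; apply/eqP/negPn/negP; exact: h.
have mE : m = mnm_add (mnm1 i) (mnm_sub m (mnm1 i)).
  apply/mnmP => j; rewrite !mnmE; case: eqVneq => [<-|_] /=; last by rewrite subn0.
  by rewrite subnKC// lt0n.
have dE : mdeg m = (mdeg (mnm_sub m (mnm1 i))).+1 by rewrite {1}mE mdegD mdeg1.
rewrite {2}mE mpolyXD dE exprS mulrC.
have := tameM (tameX i) (IH (mnm_sub m (mnm1 i)) _); rewrite mul1r; apply.
by rewrite -ltnS -dE.
Qed.

Lemma tame_poly (D : nat) P : (mmeasure mdeg P <= D.+1)%N -> tame (coef_norm P * T ^+ D) P.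
Proof.
move=> szP x y hx hy.
have T0 : 0 <= T ^+ D by rewrite exprn_ge0// (le_trans ler01 T1).
have hm (m : multinom n.+1) : m \in msupp P ->
   [/\ `|ev x (mpolyX R m)| <= T ^+ D, forall i, `|ev x (mderiv i (mpolyX R m))| <= T ^+ D &
      `|ev y (mpolyX R m) - ev x (mpolyX R m) - \sum_i ev x (mderiv i (mpolyX R m)) * (y 0 i - x 0 i)| <= T ^+ D * `|y - x| ^+ 2].
  move=> mP; have hT : T ^+ mdeg m <= T ^+ D.
    have := leq_trans (msize_mdeg_lt mP) szP; rewrite ltnS; exact: ler_weXn2l.
  have [h0 h1 h2] := tame_monomial m hx hy; split => [|i|].
  - exact: le_trans h0 hT.
  - exact: le_trans (h1 i) hT.
  - by apply: (le_trans h2); rewrite ler_wpM2r// exprn_ge0.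
have evE z : ev z P = \sum_(m <- msupp P) mcoeff m P * ev z (mpolyX R m).
  rewrite {1}/ev {1}(mpolyE P) rmorph_sum /=; apply: eq_bigr => m _; by rewrite mevalZ.
have devE z i : ev z (mderiv i P) = \sum_(m <- msupp P) mcoeff m P * ev z (mderiv i (mpolyX R m)).
  have -> : mderiv i P = \sum_(m <- msupp P) mcoeff m P *: mderiv i (mpolyX R m).
    by rewrite {1}(mpolyE P) linear_sum; apply: eq_bigr => m _; rewrite linearZ.
  rewrite {1}/ev rmorph_sum /=; apply: eq_bigr => m _.
  by rewrite mevalZ.
split => [|i|].
- rewrite evE mulr_suml; apply: (le_trans (ler_norm_sum _ _ _)); rewrite big_seq [leRHS]big_seq.
  by apply: ler_sum => m mP; rewrite normrM ler_wpM2l//; have [] := hm m mP.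
- rewrite devE mulr_suml; apply: (le_trans (ler_norm_sum _ _ _)); rewrite big_seq [leRHS]big_seq.
  by apply: ler_sum => m mP; rewrite normrM ler_wpM2l//; have [_ + _] := hm m mP; exact.
have -> : ev y P - ev x P - \sum_i ev x (mderiv i P) * (y 0 i - x 0 i) =
   \sum_(m <- msupp P) mcoeff m P * (ev y (mpolyX R m) - ev x (mpolyX R m) - \sum_i ev x (mderiv i (mpolyX R m)) * (y 0 i - x 0 i)).
  under [RHS]eq_bigr do rewrite !mulrBr.
  rewrite !sumrB -!evE; congr (_ - _).
  under [RHS]eq_bigr do rewrite mulr_sumr.
  rewrite exchange_big /=; apply: eq_bigr => i _; rewrite devE mulr_suml.
  by apply: eq_bigr => m _; rewrite mulrA.
rewrite -mulrA mulr_suml; apply: (le_trans (ler_norm_sum _ _ _)); rewrite big_seq [leRHS]big_seq.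
by apply: ler_sum => m mP; rewrite normrM ler_wpM2l//; have [] := hm m mP.
Qed.

End quadratic_approximation.

Section polynomial_map_preimage.
Context {R : realType} {n : nat}.
Implicit Types (P : 'I_n.+1 -> mpoly n.+1 R) (x y : 'rV[R]_n.+1).

Lemma tame_le (B B' : R) (p : mpoly n.+1 R) : B <= B' -> tame B p -> tame B' p.
Proof.
move=> BB' tp x y hx hy; have [h0 h1 h2] := tp x y hx hy; split => [|i|].
- exact: le_trans BB'.
- exact: le_trans (h1 i) BB'.
- by apply: (le_trans h2); rewrite ler_wpM2r// exprn_ge0.
Qed.

Lemma msize_Jac P (d : nat) : (forall j, (mmeasure mdeg (P j) <= d.+1)%N) ->
  (mmeasure mdeg (Jac P) <= (n.+1 * d.+2).+1)%N.
Proof.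
move=> szP; apply: (leq_trans (mmeasure_sum _ _ _ _)); apply/bigmax_leqP => s _.
have hprod (r : seq 'I_n.+1) (F : 'I_n.+1 -> mpoly n.+1 R) :
    (forall i, (mmeasure mdeg (F i) <= d.+1)%N) ->
    (mmeasure mdeg (\prod_(i <- r) F i) <= (size r * d.+2).+1)%N.
  move=> szF; elim: r => [|i r IH]; first by rewrite big_nil mmeasure1.
  rewrite big_cons; apply: (leq_trans (msizeM_le _ _)).
  by rewrite /= mulSn ltnS (leq_trans (leq_add (szF i) IH))// addnS -addSn.
have szM i : (mmeasure mdeg ((\matrix_(j, i) mderiv i (P j)) i (s i)) <= d.+1)%N.
  rewrite mxE; apply: (leq_trans (mmeasure_sum _ _ _ _)).
  rewrite big_seq; apply/bigmax_leqP_seq => m _ mP.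
  apply: (leq_trans (mmeasureZ_le _ _ _)); rewrite mmeasureX ltnS.
  apply: (@leq_trans (mdeg m)); last by rewrite -ltnS (leq_trans (msize_mdeg_lt mP)).
  exact: mdegB.
have := hprod (enum 'I_n.+1) _ szM; rewrite size_enum_ord big_enum /=.
by rewrite -signr_odd; case: (odd _); rewrite ?expr1 ?mulN1r ?mmeasureN ?expr0 ?mul1r.
Qed.

(** Bounds the sup-norm operator norm of the adjugate of a matrix with entries at most B, where B >=
    1: n + 1 cofactors per row, each a sum of at most (n+1)! products. *)
Definition adjugate_bound (B : R) : R := n.+1%:R * ((n.+1)`!%:R * B ^+ n.+1).

Lemma adjugate_bound_gt0 (B : R) : 0 < B -> 0 < adjugate_bound B.
Proof. by move=> B0; rewrite /adjugate_bound !mulr_gt0 ?exprn_gt0// ltr0n fact_gt0. Qed.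

Lemma cofactor_le (M : 'M[R]_n.+1) (B : R) i j : 1 <= B -> (forall i j, `|M i j| <= B) ->
  `|cofactor M i j| <= (n.+1)`!%:R * B ^+ n.+1.
Proof.
move=> B1 MB; rewrite expand_cofactor; apply: (le_trans (ler_norm_sum _ _ _)).
apply: (@le_trans _ _ (\sum_(s : {perm 'I_n.+1}) B ^+ n.+1)); last first.
  by rewrite sumr_const card_Sn mulr_natl.
rewrite [leRHS](bigID (fun s : {perm 'I_n.+1} => s i == j)) /=.
have B0 : 0 <= B by rewrite (le_trans ler01).
apply: ler_wpDr; first by apply: sumr_ge0 => s _; rewrite exprn_ge0.
apply: ler_sum => s _; rewrite normrM normrX normrN1 expr1n mul1r normr_prod.
apply: (@le_trans _ _ (\prod_(k | i != k) B)); first by apply: ler_prod => k _; rewrite normr_ge0 MB.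
rewrite prodr_const; apply: ler_weXn2l => //.
by rewrite -[leqRHS](card_ord n.+1) max_card.
Qed.

(** Multiply the first-order expansion of P y - P x by the adjugate of the Jacobian matrix at x:
    this isolates Jac(x) (y - x), up to the quadratic remainder. For y close to x the remainder is
    absorbed by half of the left side. *)
Lemma tame_local_injectivity P (B eps : R) x y :
  1 <= B -> (forall j, tame B (P j)) -> unit_cube x -> unit_cube y ->
  eps <= `|meval (fun i => x 0 i) (Jac P)| ->
  2 * (adjugate_bound B * B) * `|y - x| <= eps ->
  eps * `|y - x| <= 2 * adjugate_bound B * `|polymap P y - polymap P x|.
Proof.
move=> B1 tP hx hy Jx.
pose M : 'M[R]_n.+1 := \matrix_(j, i) meval (fun i => x 0 i) (mderiv i (P j)).
move: Jx; have -> : meval (fun i => x 0 i) (Jac P) = \det M.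
  by rewrite /Jac -det_map_mx; congr (\det _); apply/matrixP => j i; rewrite !mxE.
move=> dM; set u := `|y - x|; set G := adjugate_bound B => hu.
have u0 : 0 <= u by exact: normr_ge0.
have MB i j : `|M i j| <= B by rewrite mxE; have [_ + _] := tP i x y hx hy; exact.
pose w : 'cV[R]_n.+1 := (y - x)^T.
pose dR := polymap P y - polymap P x.
pose r : 'cV[R]_n.+1 := dR^T - M *m w.
have rB j : `|r j 0| <= B * u ^+ 2.
  have [_ _] := tP j x y hx hy; congr (`|_| <= _); rewrite !mxE; congr (_ - _).
  by apply: eq_bigr => i _; rewrite !mxE.
have key i : \det M * (y - x) 0 i = \sum_j cofactor M j i * (dR 0 j - r j 0).
  have := congr1 (fun A : 'M[R]_n.+1 => (A *m w) i 0) (mul_adj_mx M).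
  rewrite mul_scalar_mx -mulmxA [in RHS]mxE [in LHS]mxE [w i 0]mxE => <-.
  by apply: eq_bigr => j _; rewrite [in LHS]mxE /r !mxE opprB addrC subrK.
have hi i : `|\det M| * `|(y - x) 0 i| <= G * (`|dR| + B * u ^+ 2).
  rewrite -normrM key; apply: (le_trans (ler_norm_sum _ _ _)).
  apply: (@le_trans _ _ (\sum_(j < n.+1) (n.+1)`!%:R * B ^+ n.+1 * (`|dR| + B * u ^+ 2))).
    apply: ler_sum => j _; rewrite normrM ler_pM ?normr_ge0 ?cofactor_le//.
    by apply: (le_trans (ler_normB _ _)); rewrite lerD ?rB ?coord_le_norm.
  by rewrite sumr_const card_ord /G /adjugate_bound -[leLHS]mulr_natl !mulrA.
have {}hi : eps * u <= G * (`|dR| + B * u ^+ 2).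
  apply: (@le_trans _ _ (`|\det M| * u)); first by rewrite ler_wpM2r.
  have [dz|dnz] := eqVneq (\det M) 0.
    have := hi 0; rewrite dz normr0 !mul0r; exact.
  have d0 : 0 < `|\det M| by rewrite normr_gt0.
  rewrite mulrC -ler_pdivlMr//; apply/mx_norm_leP => i.
  by rewrite ler_pdivlMr// mulrC.
have : G * B * u * u <= eps / 2 * u by rewrite ler_wpM2r//; lra.
rewrite mulrDr [G * (B * _)]mulrA expr2 mulrA in hi.
rewrite -/dR; lra.
Qed.

(* On each cell of a fine enough grid, polymap P has a Lipschitz inverse where
   the Jacobian is not small. *)
Lemma polymap_preimage_nondegenerate P (B eps : R) (H : set 'rV[R]_n.+1) :
  1 <= B -> (forall j, tame B (P j)) -> 0 < eps ->
  (lebesgue_rV [set x | [/\ unit_cube x, (eps <= `|meval (fun i => x 0 i) (Jac P)|)%R & H (polymap P x)]]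
    <= (((2 * (adjugate_bound B * B) / eps + 1) * (8 * adjugate_bound B / eps)) ^+ n.+1)%:E * lebesgue_rV H)%E.
Proof.
move=> B1 tP eps0; set X := [set x | _]; set G := adjugate_bound B.
have G0 : 0 < G by apply: adjugate_bound_gt0; lra.
have B0 : 0 <= B by lra.
have GB : 0 <= 2 * (G * B) by apply: mulr_ge0 => //; apply: mulr_ge0 => //; exact: ltW.
have a0 : 0 <= 2 * (G * B) / eps by rewrite divr_ge0// ltW.
(* The mesh 1/(N+1) is fine enough for [tame_local_injectivity], while N + 1 stays below the first
   factor of the constant. *)
have [N [N1 N2]] : exists N : nat, N.+1%:R <= 2 * (G * B) / eps + 1 /\ 2 * (G * B) / N.+1%:R <= eps.
  have /andP[t1 t2] := truncn_itv a0; exists (Num.truncn (2 * (G * B) / eps)); split.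
    by rewrite -natr1 lerD2r.
  by rewrite ler_pdivrMr ?ltr0n// -ler_pdivrMl// mulrC; exact: ltW.
have N0 : 0 < N.+1%:R :> R by rewrite ltr0n.
pose S (g : {ffun 'I_n.+1 -> 'I_N.+1}) : set 'rV[R]_n.+1 :=
  [set x | X x /\ forall i, (g i)%:R <= x 0 i * N.+1%:R <= (g i)%:R + 1].
apply: (@le_trans _ _ (\sum_g lebesgue_rV (S g))%E).
  apply: lebesgue_rV_fin_union => x Xx.
  have gP i : exists k : 'I_N.+1, k%:R <= x 0 i * N.+1%:R <= k%:R + 1.
    have [/(_ i)/andP[x0 x1] _ _] := Xx.
    have xN0 : 0 <= x 0 i * N.+1%:R by rewrite mulr_ge0 // ltW.
    have /andP[t1 t2] := truncn_itv xN0.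
    have [lt|ge] := ltnP (Num.truncn (x 0 i * N.+1%:R)) N.+1.
      by exists (Ordinal lt); rewrite /= natr1 t1 ltW.
    exists ord_max => /=; rewrite natr1 ler_piMl ?(ltW N0)// andbT.
    by apply: le_trans t1; rewrite ler_nat ltnW.
  have /choice[g hg] := gP; exists [ffun i => g i]; split => // i; by rewrite ffunE; exact: hg.
have L0 : 0 < 2 * G / eps by apply: divr_gt0 => //; apply: mulr_gt0.
apply: (@le_trans _ _ (\sum_(g : {ffun 'I_n.+1 -> 'I_N.+1}) ((4 * (2 * G / eps)) ^+ n.+1)%:E * lebesgue_rV H)%E).
  apply: lee_sum => g _; rewrite -[S g]image_id.
  apply: (@le_trans _ _ (((4 * (2 * G / eps)) ^+ n.+1)%:E * lebesgue_rV (polymap P @` S g))%E); last first.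
    apply: lee_wpmul2l; first by rewrite lee_fin exprn_ge0// mulr_ge0// ltW.
    by apply: le_lebesgue_rV => _ [x [[_ _ ?] _] <-].
  apply: lebesgue_rV_lipschitz => // y x [[y1 _ _] yg] [[x1 Jx _] xg] /=.
  rewrite mulrAC ler_pdivlMr// mulrC; apply: tame_local_injectivity => //.
  apply: le_trans N2; apply: ler_wpM2l => //.
  apply/mx_norm_leP => i; rewrite !mxE -[N.+1%:R^-1]mul1r ler_pdivlMr//.
  rewrite -[X in _ * X]gtr0_norm// -normrM mulrBl.
  by have := yg i; have := xg i; rewrite ler_norml => /andP[? ?] /andP[? ?]; apply/andP; split; lra.
rewrite -ge0_sume_distrl => [|g _]; last by rewrite lee_fin exprn_ge0// mulr_ge0// ltW.
apply: lee_wpmul2r; first exact: lebesgue_rV_ge0.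
rewrite sumEFin sumr_const card_ffun !card_ord lee_fin -[leLHS]mulr_natl natrX.
have -> : 4 * (2 * G / eps) = 8 * G / eps by rewrite !mulrA; congr (_ * _ / _); rewrite -natrM.
rewrite [leRHS]exprMn.
apply: ler_wpM2r; first by apply/exprn_ge0/divr_ge0/ltW => //; apply: mulr_ge0 => //; exact: ltW.
by apply: lerXn2r => //; rewrite nnegrE ?addr_ge0// ltW.
Qed.

(** Split the cube at the threshold eps = c1 tau^D for the Jacobian. Below it, [polynomial_sublevel]
    gives tau/2; above it, the Lipschitz bound loses eps^(-2(n+1)), so the power p = 2 D (n+1) + 1
    of tau leaves another tau/2. The constants are uniform over all P with the given bounds. *)
Lemma polymap_preimage (d : nat) (A delta : R) : 0 < delta ->
  exists2 c : R, 0 < c & exists p : nat, forall P (H : set 'rV[R]_n.+1) (tau : R),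
    (forall j, (mmeasure mdeg (P j) <= d.+1)%N) -> (forall j, coef_norm (P j) <= A) ->
    delta <= coef_norm (Jac P) -> 0 < tau -> tau <= 1 ->
    (lebesgue_rV H <= (c * tau ^+ p)%:E)%E ->
    (lebesgue_rV [set x | unit_cube x /\ H (polymap P x)] <= tau%:E)%E.
Proof.
move=> delta0; have [D DE] : exists D, D = (n.+1 * d.+2)%N by exists (n.+1 * d.+2)%N.
have [c' c'0 hc'] := @polynomial_sublevel R n D.
pose c0 := c' * delta.
have c00 : 0 < c0 by exact: mulr_gt0.
pose B := Num.max 1 (A * n.+3%:R ^+ 2 ^+ d).
have B1 : 1 <= B by rewrite le_max lexx.
have B0 : 0 < B by lra.
set G := adjugate_bound B.
have G0 : 0 < G by exact: adjugate_bound_gt0.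
pose c1 := c0 / 2 ^+ D.
have c10 : 0 < c1 by rewrite divr_gt0// exprn_gt0.
have GB : 0 <= 2 * (G * B) by rewrite mulr_ge0// mulr_ge0// ltW.
pose W := (2 * (G * B) / c1 + 1) * (8 * G / c1).
have W0 : 0 < W.
  apply: mulr_gt0; last by apply: divr_gt0 => //; apply: mulr_gt0.
  by apply: ltr_wpDl => //; apply: divr_ge0 => //; exact: ltW.
exists (1 / (2 * W ^+ n.+1)); first by rewrite divr_gt0// mulr_gt0// exprn_gt0.
exists (2 * D * n.+1).+1 => P H tau szP PA dJ tau0 tau1 hH.
pose eps := c1 * tau ^+ D.
have tD : 0 < tau ^+ D by exact: exprn_gt0.
have eps0 : 0 < eps by exact: mulr_gt0.
have tP j : tame B (P j).
  apply: tame_le (tame_poly (szP j)); rewrite le_max; apply/orP; right.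
  by apply: ler_wpM2r => //; rewrite !exprn_ge0.
have t20 : 0 < tau / 2 by rewrite divr_gt0.
have szJ : (mmeasure mdeg (Jac P) <= D.+1)%N by rewrite DE msize_Jac.
have h1 := hc' (tau / 2) (Jac P) t20 szJ (lt_le_trans delta0 dJ).
have h2 := polymap_preimage_nondegenerate H B1 tP eps0.
pose S1 := unit_cube `&` [set x : 'rV[R]_n.+1 | `|meval (fun i => x 0 i) (Jac P)| <= c0 * (tau / 2) ^+ D].
pose S2 := [set x | [/\ unit_cube x, (eps <= `|meval (fun i => x 0 i) (Jac P)|)%R & H (polymap P x)]].
apply: (@le_trans _ _ (\sum_(b : bool) lebesgue_rV (if b then S1 else S2))%E).
  apply: lebesgue_rV_fin_union => x [x1 Hx].
  have [le|lt] := leP (`|meval (fun i => x 0 i) (Jac P)|) (c0 * (tau / 2) ^+ D); first by exists true.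
  exists false; split => //; apply: le_trans (ltW lt).
  by rewrite /eps /c1 expr_div_n [leRHS]mulrA [leLHS]mulrAC.
rewrite big_bool /= [tau in leRHS](_ : _ = tau / 2 + tau / 2); last by lra.
rewrite EFinD; apply: leeD.
  apply: le_trans h1; apply: le_lebesgue_rV => x [x1 xJ]; split => //; apply: (le_trans xJ).
  by rewrite ler_wpM2r ?exprn_ge0 ?(ltW t20)// ler_wpM2l// ltW.
apply: (le_trans h2); rewrite -/G.
have Q0 : 0 <= (2 * (G * B) / eps + 1) * (8 * G / eps).
  by rewrite mulr_ge0 ?addr_ge0// divr_ge0 ?(ltW eps0)// mulr_ge0// ltW.
apply: (le_trans (lee_wpmul2l _ hH)); first by rewrite lee_fin exprn_ge0.
rewrite -EFinM lee_fin.
have canc (a : R) : a / (c1 * tau ^+ D) * tau ^+ D = a / c1.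
  by rewrite invfM mulrA divfK// gt_eqF.
have QW : (2 * (G * B) / eps + 1) * (8 * G / eps) * tau ^+ (2 * D) <= W.
  rewrite mulnC exprM expr2 mulrACA; apply: ler_pM.
  - by rewrite mulr_ge0 ?addr_ge0 ?(ltW tD)// divr_ge0// ltW.
  - by rewrite mulr_ge0 ?(ltW tD)// divr_ge0 ?(ltW eps0)// mulr_ge0// ltW.
  - rewrite mulrDl mul1r /eps; apply: lerD; last by rewrite exprn_ile1// ltW.
    by rewrite canc.
  - by rewrite /eps canc.
have t2D : 0 <= tau ^+ (2 * D) by rewrite exprn_ge0// ltW.
set Q := _ * (8 * G / eps) in Q0 QW *.
have QWk : Q ^+ n.+1 * tau ^+ (2 * D * n.+1) <= W ^+ n.+1.
  by rewrite exprM -exprMn; apply: lerXn2r => //; rewrite nnegrE; [exact: mulr_ge0|exact: ltW].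
have Wk : 0 < W ^+ n.+1 by exact: exprn_gt0.
have -> : Q ^+ n.+1 * (1 / (2 * W ^+ n.+1) * tau ^+ (2 * D * n.+1).+1) =
    Q ^+ n.+1 * tau ^+ (2 * D * n.+1) / W ^+ n.+1 * (tau / 2).
  move: Wk; rewrite [tau ^+ _.+1]exprSr; set w := W ^+ n.+1; set q := Q ^+ n.+1; set u := tau ^+ _ => w0.
  by clearbody w q u; field; rewrite gt_eqF.
by rewrite ler_piMl ?(ltW t20)// ler_pdivrMr// mul1r.
Qed.

End polynomial_map_preimage.

(** * Curves in admissible sets *)

Section rays.
Context {R : realType} {n : nat}.
Implicit Types (P : 'I_n.+1 -> mpoly n.+1 R) (x y a v : 'rV[R]_n.+1) (G K H : set 'rV[R]_n.+1).

Definition root_map (q : nat) x : 'rV[R]_n.+1 := \row_i (x 0 i `^ (q%:R)^-1).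

Definition power_segment (q : nat) a v (s : R) : 'rV[R]_n.+1 := a + s ^+ q *: (v - a).

Lemma rootK (q : nat) (t : R) : (1 <= q)%N -> 0 <= t -> (t `^ (q%:R)^-1) ^+ q = t.
Proof.
move=> q1 t0; rewrite -powR_mulrn ?powR_ge0// -powRrM mulVf ?powRr1//.
by rewrite pnatr_eq0 -lt0n.
Qed.

Lemma root_ge0_le1 (q : nat) (t : R) : 0 <= t -> t <= 1 -> 0 <= t `^ (q%:R)^-1 <= 1.
Proof.
move=> t0 t1; have e1 : 1 `^ (q%:R)^-1 = 1 :> R by rewrite powR1.
rewrite powR_ge0/= -[leRHS]e1.
by apply: ge0_ler_powR => //; rewrite ?invr_ge0 ?nnegrE.
Qed.

Lemma root_map_cube (q : nat) x : unit_cube x -> unit_cube (root_map q x).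
Proof. by move=> x1 i; rewrite mxE; have /andP[? ?] := x1 i; exact: root_ge0_le1. Qed.

Lemma root_expanding (q : nat) (t u : R) : (1 <= q)%N -> 0 <= t <= 1 -> 0 <= u <= 1 ->
  `|t - u| <= q%:R * `|t `^ (q%:R)^-1 - u `^ (q%:R)^-1|.
Proof.
move=> q1 /andP[t0 t1] /andP[u0 u1].
rewrite -{1}(rootK q1 t0) -{1}(rootK q1 u0) subrXX normrM mulrC ler_wpM2r//.
apply: (le_trans (ler_norm_sum _ _ _)).
apply: (@le_trans _ _ (\sum_(i < q) 1)); last by rewrite sumr_const card_ord.
have /andP[? ?] := root_ge0_le1 q t0 t1; have /andP[? ?] := root_ge0_le1 q u0 u1.
apply: ler_sum => i _; rewrite ger0_norm ?mulr_ge0 ?exprn_ge0//.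
by rewrite mulr_ile1 ?exprn_ge0 ?exprn_ile1.
Qed.

(** The coordinatewise q-th power, inverse to [root_map], is q-Lipschitz on the cube. *)
Lemma lebesgue_rV_root_map (q : nat) G : (1 <= q)%N -> G `<=` unit_cube ->
  (lebesgue_rV G <= ((4 * q%:R) ^+ n.+1)%:E * lebesgue_rV (root_map q @` G))%E.
Proof.
move=> q1 G1; rewrite -{1}[G]image_id.
apply: lebesgue_rV_lipschitz => [|x y Gx Gy]; first by rewrite ltr0n.
apply/mx_norm_leP => i; rewrite !mxE.
apply: (le_trans (root_expanding q1 (G1 x Gx i) (G1 y Gy i))); rewrite ler_wpM2l//.
by have := coord_le_norm (root_map q x - root_map q y) i; rewrite !mxE.
Qed.

Lemma borel_polymap_root P (q : nat) H : borel_rV H -> borel_rV [set x | H (polymap P (root_map q x))].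
Proof.
move=> bH d T phi mphi; apply: (bH d T (fun t => polymap P (root_map q (phi t)))) => j.
under eq_fun do rewrite mxE; apply: measurable_meval => i.
under eq_fun do rewrite mxE.
by apply: (measurableT_comp (f := fun t : R => t `^ (q%:R)^-1)); [exact: measurable_powR|exact: mphi].
Qed.

Lemma rV_measurable_power_segment (q : nat) a :
  rV_measurable (fun p : measurableTypeR R * @rV_leb R n => power_segment q a p.2 p.1).
Proof.
move=> i; under eq_fun do rewrite !mxE.
apply: measurable_funD; first exact: measurable_cst.
apply: measurable_funM; first by apply: measurable_funX; exact: measurable_fst.
apply: measurable_funD; last exact: measurable_cst.
exact: (measurableT_comp (rV_leb_measurable_coord i) measurable_snd).
Qed.

(* Fubini over [tau/2, 1] x K: if every v failed, G would be too large. *)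
Lemma power_segment_avoiding (q : nat) (delta tau : R) K G a :
  borel_rV K -> borel_rV G -> 0 < delta -> (delta%:E <= lebesgue_rV K)%E -> 0 < tau -> tau <= 1 ->
  (((4 * (2 / tau) ^+ q) ^+ n.+1)%:E * lebesgue_rV G < (delta * (tau / 2))%:E)%E ->
  exists2 v, K v &
    (lebesgue_measure (`[0%R, 1%R] `&` [set s | G (power_segment q a v s)]) <= tau%:E)%E.
Proof.
move=> bK bG delta0 dK tau0 tau1 hG; apply: contrapT => nv.
have {}nv v : K v -> (tau%:E < lebesgue_measure (`[0%R, 1%R] `&` [set s | G (power_segment q a v s)]))%E.
  by move=> Kv; rewrite ltNge; apply/negP => h; apply: nv; exists v.
pose A := (fun p : measurableTypeR R * @rV_leb R n => power_segment q a p.2 p.1) @^-1` G.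
have mA : measurable A by apply: bG; exact: rV_measurable_power_segment.
(* Near s = 0 the map v |-> a + s^q (v - a) contracts too strongly. Dropping s < tau/2 costs half of
   the allowed time and leaves an inverse with Lipschitz constant (2/tau)^q. *)
pose J : set (measurableTypeR R) := `[tau / 2, 1]%classic.
have mJ : measurable J by exact: measurable_itv.
have mK : measurable (K : set (@rV_leb R n)) by exact: borel_rV_measurable.
set c := _ ^+ n.+1 in hG.
have t20 : 0 < tau / 2 by lra.
have c0 : 0 < c.
  by rewrite exprn_gt0// mulr_gt0// exprn_gt0// divr_gt0.
have Gfin : (lebesgue_rV G \is a fin_num)%E.
  rewrite ge0_fin_numE ?lebesgue_rV_ge0// ltey; apply/eqP => Goo.
  by move: hG; rewrite Goo gt0_muley ?lte_fin// ltNge leey.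
pose h := c * fine (lebesgue_rV G).
have hE : (h%:E = c%:E * lebesgue_rV G)%E by rewrite EFinM fineK.
have h0 : 0 <= h by rewrite /h mulr_ge0 ?(ltW c0)// fine_ge0// lebesgue_rV_ge0.
have hs s : J s -> (leb_rV (K `&` [set v | A (s, v)]) <= h%:E)%E.
  rewrite /J /= in_itv /= => /andP[s1 s2]; have s0 : 0 < s by lra.
  have sq0 : 0 < s ^+ q by exact: exprn_gt0.
  rewrite /leb_rV -[X in (lebesgue_rV X <= _)%E]image_id hE.
  apply: (@le_trans _ _ (((4 * s ^- q) ^+ n.+1)%:E *
     lebesgue_rV ((fun v => power_segment q a v s) @` (K `&` [set v | A (s, v)])))%E).
    apply: lebesgue_rV_lipschitz; first by rewrite invr_gt0.
    move=> v w _ _; rewrite /power_segment opprD addrACA subrr add0r -scalerBr.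
    by rewrite opprB addrA subrK normrZ gtr0_norm// mulKf// gt_eqF.
  apply: lee_pmul => //; first by rewrite lee_fin exprn_ge0// mulr_ge0// invr_ge0 ltW.
  - exact: lebesgue_rV_ge0.
  - rewrite lee_fin; apply: lerXn2r; rewrite ?nnegrE.
    + by rewrite mulr_ge0// invr_ge0 ltW.
    + by rewrite mulr_ge0// exprn_ge0// divr_ge0// ltW.
    + rewrite ler_wpM2l// -exprVn; apply: lerXn2r; rewrite ?nnegrE ?invr_ge0 ?divr_ge0 ?(ltW s0) ?(ltW tau0)//.
      by rewrite -[2 / tau]invf_div lef_pV2.
  - by apply: le_lebesgue_rV => _ [v [_ Av] <-].
have hv v : K v -> ((tau / 2)%:E <= lebesgue_measure (J `&` [set s | A (s, v)]))%E.
  move=> Kv; have := nv v Kv.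
  pose S : set R := [set s | G (power_segment q a v s)].
  change ((tau%:E < lebesgue_measure (`[0%R, 1%R] `&` S))%E ->
    ((tau / 2)%:E <= lebesgue_measure ((J : set R) `&` S))%E).
  have mS : measurable (S : set (measurableTypeR R)).
    have := measurable_ysection (v : @rV_leb R n) mA.
    by congr measurable; apply/seteqP; split => s; rewrite /ysection /= inE.
  have le1 : (lebesgue_measure (`[0%R, 1%R] `&` S) <= (tau / 2)%:E + lebesgue_measure (J `&` S))%E.
    have -> : ((tau / 2)%:E = lebesgue_measure (`[0%R, (tau / 2)%R] : set R))%E.
      by rewrite lebesgue_measure_itv /= lte_fin t20 oppr0 adde0.
    apply: le_trans (measureU2 _ _ _) => //; last exact: measurableI.
    apply: le_measure; rewrite ?inE; [exact: measurableI|by apply: measurableU => //; exact: measurableI|].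
    move=> s [/=]; rewrite in_itv /= => /andP[s1 s2] Ss.
    have [le|gt] := leP s (tau / 2); first by left; rewrite /= in_itv /= s1.
    by right; split => //; rewrite /J /= in_itv /= (ltW gt).
  rewrite [tau in X in X -> _](_ : _ = tau / 2 + tau / 2); last by lra.
  move=> /lt_le_trans/(_ le1); rewrite EFinD => /ltW.
  by rewrite leeD2lE.
have : ((tau / 2)%:E * leb_rV K <= h%:E * lebesgue_measure J)%E.
  have F := fubini_sections_ge mA mJ mK h0 (ltW t20) hs hv.
  exact F.
apply/negP; rewrite -ltNge.
have J1 : (lebesgue_measure J <= 1%:E)%E.
  rewrite lebesgue_measure_itv /=; case: ifP => _; rewrite ?lee_fin//.
  by rewrite -?EFinD ?lee_fin; lra.
apply: (@le_lt_trans _ _ h%:E); first by rewrite -[leRHS]mule1 lee_wpmul2l.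
rewrite hE; apply: (lt_le_trans hG); rewrite mulrC EFinM; apply: lee_wpmul2l => //.
by rewrite lee_fin ltW.
Qed.

End rays.

Section admissible_curves.
Context {R : realType} {n : nat}.
Implicit Types (P : 'I_n.+1 -> mpoly n.+1 R) (x y a v w : 'rV[R]_n.+1) (G K H : set 'rV[R]_n.+1).

(** Admissibility bounds the coefficients of the Jacobian, not those of the maps. The latter are
    bounded because K is: if a coefficient norm were huge, the whole set of measure delta would lie
    in a sublevel set of measure at most delta/2. *)
Lemma coef_norm_bounded (d : nat) (delta r : R) : 0 < delta ->
  exists A : R, forall (p : mpoly n.+1 R) K, (mmeasure mdeg p <= d.+1)%N -> K `<=` unit_cube ->
    (delta%:E <= lebesgue_rV K)%E -> (forall x, K x -> `|meval (fun i => x 0 i) p| <= r) ->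
    coef_norm p <= A.
Proof.
move=> delta0; have [c c0 hc] := @polynomial_sublevel R n d.
have t0 : 0 < delta / 2 by lra.
have ct0 : 0 < c * (delta / 2) ^+ d by rewrite mulr_gt0// exprn_gt0.
exists (`|r| / (c * (delta / 2) ^+ d)) => p K szp K1 dK pK; rewrite leNgt; apply/negP => lt.
have p0 : 0 < coef_norm p by apply: le_lt_trans lt; rewrite divr_ge0// ltW.
have := hc _ _ t0 szp p0; apply/negP; rewrite -ltNge.
apply: (@lt_le_trans _ _ delta%:E); first by rewrite lte_fin; lra.
apply: (le_trans dK); apply: le_lebesgue_rV => x Kx; split; first exact: K1.
apply: (le_trans (pK x Kx)); apply: (le_trans (ler_norm r)).
by move: (ltW lt); rewrite ler_pdivrMr// mulrA [coef_norm p * c]mulrC.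
Qed.

Lemma poly_eq_nonneg (p q : {poly R}) : (forall t, 0 <= t -> p.[t] = q.[t]) -> p = q.
Proof.
move=> pq; apply/eqP; rewrite -subr_eq0; apply/negPn/negP => nz.
have : (size [seq (i%:R : R) | i <- iota 0 (size (p - q)%R)] < size (p - q)%R)%N.
  apply: max_poly_roots => //.
    by apply/allP => _ /mapP[i _ ->]; rewrite rootE !hornerE pq// subrr.
  rewrite map_inj_in_uniq ?iota_uniq// => i j _ _ /eqP; by rewrite eqr_nat => /eqP.
by rewrite size_map size_iota ltnn.
Qed.

Lemma mpoly_eq0_cube (p : mpoly n.+1 R) m :
  (forall y, unit_cube y -> meval (fun i => y 0 i) p = 0) -> mcoeff m p = 0.
Proof.
move=> p0; have [c c0 hc] := @coef_norm_le_value R n.+1 (mmeasure mdeg p).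
have [y y1 hy] := hc p (leqnSn _).
have : c * coef_norm p <= 0 by rewrite (le_trans hy)// p0// normr0.
rewrite pmulr_rle0// => cp; apply/eqP/negPn/negP => nz.
have mp : m \in msupp p by rewrite mcoeff_msupp.
have : coef_norm p < `|mcoeff m p| by apply: (le_lt_trans cp); rewrite normr_gt0.
rewrite /coef_norm (bigD1_seq m)//= ltNge lerDl; apply/negP/negPn.
by apply: sumr_ge0.
Qed.

Let evset (z : 'rV[R]_n.+1) i (u : R) (p : mpoly n.+1 R) : R :=
  meval (fun l => if l == i then u else z 0 l) p.

(* Polynomial dependence on x_i forces the exponents of x_i^(1/q) to be
   multiples of q. *)
Lemma polynomial_in_dvd (q : nat) P Y i j m : (1 <= q)%N ->
  (forall x, orthant x -> Y x = polymap P (root_map q x)) ->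
  polynomial_in i Y -> m \in msupp (P j) -> (q %| m i)%N.
Proof.
move=> q1 YP pY mP; apply/negPn/negP => qm.
set k := m i in qm.
(* Q gathers the monomials of degree k in x_i. At z it takes the value F_k z_i^k, where F is P j
   with all variables but the i-th frozen at z. *)
pose Q : mpoly n.+1 R := \sum_(m' <- msupp (P j) | m' i == k) mcoeff m' (P j) *: mpolyX R m'.
have Qm : mcoeff m Q = mcoeff m (P j).
  rewrite /Q big_mkcond raddf_sum /= (bigD1_seq m)//= eqxx mcoeffZ mcoeffX eqxx mulr1.
  rewrite big1 ?addr0// => m' m'm; case: ifP => _; last by rewrite mcoeff0.
  by rewrite mcoeffZ mcoeffX (negPf m'm) mulr0.
suff : mcoeff m Q = 0 by rewrite Qm => /eqP; rewrite mcoeff_eq0 mP.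
apply: mpoly_eq0_cube => z z1.
pose F : {poly R} := \sum_(m' <- msupp (P j))
  (mcoeff m' (P j) * \prod_(l | l != i) z 0 l ^+ m' l) *: 'X^(m' i).
have FE u : F.[u] = evset z i u (P j).
  rewrite /F horner_sum /evset mevalE; apply: eq_bigr => m' _.
  rewrite hornerZ hornerXn [in RHS](bigD1 i)//= eqxx -mulrA; congr (_ * _); rewrite mulrC; congr (_ * _).
  by apply: eq_bigr => l /negPf ->.
have z0 l : 0 <= z 0 l by have /andP[] := z1 l.
pose x : 'rV[R]_n.+1 := \row_l (z 0 l ^+ q).
have xo : orthant x by move=> l; rewrite mxE exprn_ge0.
have [p hp] := pY x xo j.
have powK (t : R) : 0 <= t -> (t ^+ q) `^ (q%:R)^-1 = t.
  by move=> t0; rewrite -powR_mulrn// -powRrM mulfV ?powRr1// pnatr_eq0 -lt0n.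
(* The variable u of F is the q-th root of the i-th coordinate of the argument of Y, so F is a
   polynomial in u^q and F_k = 0 unless q divides k. *)
have FpE : F = p \Po 'X^q.
  apply: poly_eq_nonneg => u u0; rewrite horner_comp hornerXn -hp ?exprn_ge0// FE.
  rewrite YP; last by move=> l; rewrite mxE; case: eqP => _; rewrite ?exprn_ge0.
  rewrite mxE; apply: meval_eq => l; rewrite !mxE; case: eqP => _; first by rewrite powK.
  by rewrite powK.
have Fk : F`_k = 0 by rewrite FpE coef_comp_poly_Xn// (negPf qm).
have -> : meval (fun l => z 0 l) Q = F`_k * z 0 i ^+ k.
  rewrite /F coef_sum /Q raddf_sum /= mulr_suml big_mkcond /=; apply: eq_bigr => m' _.
  rewrite coefZ coefXn eq_sym; case: eqVneq => [m'k|_]; last by rewrite mulr0 mul0r.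
  rewrite mevalZ mevalX (bigD1 i)//= -m'k mulr1 -mulrA; congr (_ * _); exact: mulrC.
by rewrite Fk mul0r.
Qed.

(** If a_i = 0, the root of s^q v_i is linear in s. Otherwise the exponents k of the i-th variable
    are multiples of q, and (a_i + s^q (v_i - a_i))^(k/q) has degree at most k in s. Either way the
    degree does not grow. *)
Lemma power_segment_polynomial (q d : nat) P Y a v j : (1 <= q)%N ->
  (mmeasure mdeg (P j) <= d.+1)%N ->
  (forall x, orthant x -> Y x = polymap P (root_map q x)) ->
  (forall i, ~ polynomial_in i Y -> a 0 i = 0) -> unit_cube a -> unit_cube v ->
  exists p : {poly R}, (size p <= d.+1)%N /\
    forall s, 0 <= s <= 1 -> Y (power_segment q a v s) 0 j = p.[s].
Proof.
move=> q1 szP YP aY a1 v1.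
pose Q i k : {poly R} := if a 0 i == 0 then (v 0 i `^ (q%:R)^-1 *: 'X) ^+ k
  else ((a 0 i)%:P + (v 0 i - a 0 i) *: 'X^q) ^+ (k %/ q).
have dvd m i : m \in msupp (P j) -> a 0 i != 0 -> (q %| m i)%N.
  move=> mP ai; apply: (polynomial_in_dvd q1 YP _ mP); apply: contrapT => /aY ai0.
  by rewrite ai0 eqxx in ai.
have [|szp pE] := @mpoly_substitution R n.+1 (P j) d Q szP.
  move=> m mP i; rewrite /Q; case: eqP => [_|/eqP ai].
    apply: (leq_trans (size_poly_exp_leq _ _)); rewrite ltnS -[leqRHS]mul1n leq_mul2r.
    apply/orP; right; rewrite -subn1 leq_subLR; apply: (leq_trans (size_scale_leq _ _)).
    by rewrite size_polyX.
  apply: (leq_trans (size_poly_exp_leq _ _)); rewrite ltnS.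
  rewrite -[leqRHS](divnK (dvd m i mP ai)) [leqRHS]mulnC leq_mul2r.
  apply/orP; right; rewrite -subn1 leq_subLR add1n; apply: (leq_trans (size_polyD _ _)).
  rewrite geq_max (leq_trans (size_polyC_leq1 _))//= (leq_trans (size_scale_leq _ _))//.
  by rewrite size_polyXn.
eexists; split; first exact: szp.
move=> s /andP[s0 s1].
have sq0 : 0 <= s ^+ q by exact: exprn_ge0.
have sq1 : s ^+ q <= 1 by exact: exprn_ile1.
have seg0 i : 0 <= a 0 i + s ^+ q * (v 0 i - a 0 i).
  have /andP[ai0 _] := a1 i; have /andP[vi0 _] := v1 i.
  rewrite [X in 0 <= X](_ : _ = (1 - s ^+ q) * a 0 i + s ^+ q * v 0 i); last by ring.
  by rewrite addr_ge0// mulr_ge0// subr_ge0.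
rewrite YP; last by move=> i; rewrite !mxE.
rewrite mxE pE mevalE !big_seq; apply: eq_bigr => m mP; congr (_ * _); apply: eq_bigr => i _.
rewrite !mxE /Q; case: eqP => [ai|/eqP ai].
  rewrite ai add0r subr0 powRM//; last by have /andP[] := v1 i.
  rewrite horner_exp !hornerE mulrC; congr ((_ * _) ^+ _).
  by rewrite -powR_mulrn// -powRrM mulfV ?powRr1// pnatr_eq0 -lt0n.
rewrite horner_exp !hornerE -{1}(divnK (dvd m i mP ai)) mulnC exprM rootK//.
by rewrite [(v 0 i - a 0 i) * _]mulrC.
Qed.

(** The constants c and p must not depend on w: they come from the uniform bounds delta_i, the
    degree, q, and the radius of K. *)
Lemma admissible_curves (d : nat) K : admissible d K ->
  exists2 c : R, 0 < c & exists p : nat, forall w H (tau : R), K w -> borel_rV H ->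
    0 < tau -> tau <= 1 -> (lebesgue_rV H <= (c * tau ^+ p)%:E)%E ->
    exists g : R -> 'rV[R]_n.+1,
      [/\ g 0 = w, forall s, 0 <= s <= 1 -> K (g s),
          forall j, exists C : {poly R}, (size C <= d.+1)%N /\
            forall s, 0 <= s <= 1 -> g s 0 j = C.[s] &
          (lebesgue_measure (`[0%R, 1%R] `&` [set s | H (g s)]) <= tau%:E)%E].
Proof.
move=> [d1 [w0 Kw0] cK [Kw [aw [Y [[hcol [delta1 [delta2 [delta3 [q [P [d10 d20 d30 q1 hP]]]]]]] Yaw KE]]]]].
have [r hr] : exists r : R, forall x, K x -> `|x| <= r.
  have [M [_ hM]] := compact_bounded cK; exists (M + 1) => x Kx; apply: (hM (M + 1)) => //.
  by rewrite ltrDl.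
set T := (4 * q%:R) ^+ n.+1 : R.
have q0 : 0 < q%:R :> R by rewrite ltr0n.
have T0 : 0 < T by rewrite exprn_gt0// mulr_gt0.
have [A hA] := @coef_norm_bounded d (delta1 / T) r (divr_gt0 d10 T0).
have [c0 c00 [p0 hp0]] := @polymap_preimage R n d A delta2 d20.
(* The set G below has measure at most T c1 tau^p1. With p1 = q (n+1) + 1 this cancels
   (2/tau)^(q(n+1)) and leaves at most delta1 tau / 4, below the delta1 tau / 2 that
   [power_segment_avoiding] allows. *)
pose c1 : R := Num.min 1 (delta1 / (4 * T * (4 * 2 ^+ q) ^+ n.+1)).
have c10 : 0 < c1.
  rewrite lt_min ltr01 /= divr_gt0// mulr_gt0 ?mulr_gt0// exprn_gt0// mulr_gt0// exprn_gt0//.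
pose p1 := (q * n.+1).+1.
exists (c0 * c1 ^+ p0); first by rewrite mulr_gt0// exprn_gt0.
exists (p1 * p0)%N => w H tau Kww bH tau0 tau1 hH.
have [szP [[star dKw] YP dJ aY]] := hP w Kww.
have [cKw Kw1 Kwa] := hcol w Kww.
have YP' x : orthant x -> Y w x = polymap (P w) (root_map q x) by exact: YP.
have cube_orthant x : unit_cube x -> orthant x by move=> x1 i; have /andP[] := x1 i.
have YK x : Kw w x -> K (Y w x) by move=> Kwx; rewrite KE; exists w => //; exists x.
have PA j : coef_norm (P w j) <= A.
  apply: (hA _ (root_map q @` Kw w)) => //.
  - by move=> _ [x Kx <-]; apply: root_map_cube; exact: Kw1.
  - rewrite EFinM muleC lee_pdivrMl//.
    exact: le_trans dKw (lebesgue_rV_root_map q1 Kw1).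
  - move=> _ [x Kx <-]; have := coord_le_norm (Y w x) j; rewrite YP' ?mxE; last exact/cube_orthant/Kw1.
    by move=> /le_trans; apply; rewrite -YP'; [exact/hr/YK|exact/cube_orthant/Kw1].
pose G := unit_cube `&` [set x | H (polymap (P w) (root_map q x))].
have bG : borel_rV G by apply: borel_rVI; [exact: borel_unit_cube|exact: borel_polymap_root].
pose tau' := c1 * tau ^+ p1.
have tp0 : 0 < tau ^+ p1 by rewrite exprn_gt0.
have t'0 : 0 < tau' by rewrite mulr_gt0.
have t'1 : tau' <= 1.
  apply: mulr_ile1; rewrite ?(ltW c10) ?(ltW tp0) ?exprn_ile1 ?(ltW tau0)//.
  by rewrite ge_min lexx.
have Gle : (lebesgue_rV G <= (T * tau')%:E)%E.
  apply: (le_trans (@lebesgue_rV_root_map R n q G q1 _)); first by move=> x [].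
  rewrite EFinM; apply: lee_wpmul2l; first by rewrite lee_fin ltW.
  have := hp0 (P w) H tau' szP PA; case/andP: dJ => dJ _.
  move=> /(_ dJ t'0 t'1) h; apply: le_trans (h _).
    by apply: le_lebesgue_rV => _ [x [x1 Hx] <-]; split => //; exact: root_map_cube.
  by apply: (le_trans hH); rewrite lee_fin /tau' exprMn -exprM mulrA.
have bKw : borel_rV (Kw w) by apply: borel_rV_closed; exact: compact_closed.
have [|v Kv hv] := @power_segment_avoiding R n q delta1 tau (Kw w) G (aw w) bKw bG d10 dKw tau0 tau1.
  apply: (@le_lt_trans _ _ (((4 * (2 / tau) ^+ q) ^+ n.+1)%:E * (T * tau')%:E)%E).
    by apply: lee_wpmul2l => //; rewrite lee_fin exprn_ge0// mulr_ge0// exprn_ge0// divr_ge0// ltW.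
  rewrite -EFinM lte_fin.
  have c1le : c1 <= delta1 / (4 * T * (4 * 2 ^+ q) ^+ n.+1) by rewrite ge_min lexx orbT.
  have W0 : 0 < (4 * 2 ^+ q) ^+ n.+1 :> R by rewrite exprn_gt0// mulr_gt0// exprn_gt0.
  have -> : (4 * (2 / tau) ^+ q) ^+ n.+1 * (T * tau') = (T * (4 * 2 ^+ q) ^+ n.+1 * c1) * tau.
    rewrite /tau' /p1 [tau ^+ _.+1]exprSr !exprMn !exprVn -!exprM.
    have tqn : tau ^+ (q * n.+1) != 0 by rewrite expf_neq0// gt_eqF.
    move: tqn; set u := tau ^+ _ => u0; set e := 4 ^+ n.+1; set f := (2 ^+ _).
    by clearbody u e f T c1; field.
  have {}c1le : T * (4 * 2 ^+ q) ^+ n.+1 * c1 <= delta1 / 4.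
    move: c1le; rewrite ler_pdivlMr ?mulr_gt0// => h.
    by rewrite ler_pdivlMr//; apply: le_trans h; rewrite le_eqVlt; apply/orP; left; apply/eqP; ring.
  apply: (@le_lt_trans _ _ (delta1 / 4 * tau)); first by rewrite ler_wpM2r// ltW.
  have : 0 < delta1 * tau by exact: mulr_gt0.
  lra.
exists (fun s => Y w (power_segment q (aw w) v s)).
have segK s : 0 <= s <= 1 -> Kw w (power_segment q (aw w) v s).
  move=> /andP[s0 s1]; have -> : power_segment q (aw w) v s = (1 - s ^+ q) *: aw w + s ^+ q *: v.
    by apply/rowP => i; rewrite !mxE; ring.
  by apply: star => //; [exact: exprn_ge0|exact: exprn_ile1].
split.
- by rewrite /power_segment expr0n gtn_eqF// scale0r addr0 Yaw.
- by move=> s s01; exact/YK/segK.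
- move=> j; have [C [szC CE]] := @power_segment_polynomial q d (P w) (Y w) (aw w) v j q1 (szP j) YP' aY (Kw1 _ Kwa) (Kw1 _ Kv).
  by exists C.
- apply: le_trans hv; rewrite le_eqVlt; apply/orP; left; apply/eqP; congr lebesgue_measure.
  apply/seteqP; split => s [s01 Hs]; split => //; have := s01; rewrite /= in_itv /= => /segK Ks.
    by split => /=; [exact: Kw1|rewrite -YP'//; exact/cube_orthant/Kw1].
  by case: Hs => _ /=; rewrite -YP'//; exact/cube_orthant/Kw1.
Qed.

End admissible_curves.

Section segments.
Context {R : realType} {n : nat}.
Implicit Types (x y a v w : 'rV[R]_n.+1) (E K : set 'rV[R]_n.+1).

Lemma lebesgue_measure_scale (s : R) (A : set R) : 0 < s -> measurable A ->
  lebesgue_measure A = (s%:E * lebesgue_measure (( *%R s) @^-1` A))%E.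
Proof.
move=> s0 mA.
pose m := mscale (NngNum (ltW s0)) (@lebesgue_measure R).
rewrite (_ : (s%:E * _)%E = pushforward m ( *%R s : _ -> measurableTypeR R) A)//.
have mf : measurable_fun [set: measurableTypeR R] ( *%R s : measurableTypeR R -> measurableTypeR R).
  exact: mulrl_measurable.
apply: lebesgue_measure_unique => //=.
move=> _ [[a b]] _ <-; rewrite /m /pushforward /mscale /=.
have -> : ( *%R s) @^-1` `]a, b] = `]a / s, b / s]%classic.
  by apply/seteqP; split => x /=; rewrite !in_itv /= ltr_pdivrMr// ler_pdivlMr// ![s * x]mulrC.
rewrite !lebesgue_measure_itv /= !lte_fin ltr_pM2r ?invr_gt0//; case: ifP => _; last by rewrite mule0.
by rewrite -!EFinD -EFinM -mulrBl mulrC divfK// gt_eqF.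
Qed.

(** The ray of [homothety_section] may end outside K. It is cut at its last point in K and rescaled;
    no point of E is lost, and rescaling by a factor s0 <= 1 can only increase the fraction spent in
    E. With both ends in K, the segment stays in L and within the diameter of K. *)
Lemma segment_through_set w K E (rho h : R) :
  compact K -> (forall x, K x -> `|x - w| <= rho) -> 0 < rho -> borel_rV E -> E `<=` K ->
  0 < h -> (h%:E <= lebesgue_rV E)%E ->
  exists2 v, K v & let F := `[0, 1]%classic `&` [set s : R | E (w + s *: (v - w))] in
    measurable F /\ ((h / (4 * (16 * rho) ^+ n.+1))%:E <= lebesgue_measure F)%E.
Proof.
move=> cK Krho rho0 bE EK h0 hE.
have [v [mF hF]] := homothety_section bE rho0 (fun x Ex => Krho x (EK x Ex)) h0 hE.
set F := _ `&` _ in mF hF; set t := h / _ in hF *.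
have t0 : 0 < t by rewrite divr_gt0// mulr_gt0// exprn_gt0// mulr_gt0.
pose ell (s : R) := w + s *: (v - w).
have cell : continuous ell.
  by move=> s; apply: (@continuousD R 'rV[R]_n.+1 R (fun=> w) (fun t : R => t *: (v - w))); [exact: cst_continuous|exact: (@scalel_continuous R 'rV[R]_n.+1)].
pose S : set R := `[0, 1]%classic `&` ell @^-1` K.
have cS : compact S.
  apply: (@subclosed_compact R _ `[0, 1]%classic); [|exact: segment_compact|by move=> s []].
  apply: closedI; first exact: itv_closed.
  by apply: closed_comp => [s _|]; [exact: cell|exact: compact_closed].
have FS : F `<=` S.
  move=> s [/=]; rewrite in_itv /= => /andP[s1 s2] Es; split; last exact: EK.
  by rewrite /= in_itv /= s2 andbT; lra.
have [s1 Fs1] : F !=set0.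
  apply/set0P/eqP => F0; move: hF; rewrite F0 measure0 lte_fin; apply/negP; rewrite -leNgt.
  exact: ltW.
have cid : {within S, continuous (id : R -> R)}.
  by apply: continuous_subspaceT => x; exact: cvg_id.
have [s0 S0 s0max] := @compact_EVT_max R R id S (ex_intro _ s1 (FS s1 Fs1)) cS cid.
rewrite inE in S0; case: S0 => /=; rewrite in_itv /= => /andP[_ s01] Kv0.
have s00 : 0 < s0.
  have := s0max s1; rewrite inE => /(_ (FS s1 Fs1)); case: Fs1 => /=; rewrite in_itv /= => /andP[? _] _; lra.
exists (ell s0) => //; set F2 := _ `&` _.
have F2E : F2 = `[0, 1]%classic `&` [set u | E (w + (s0 * u) *: (v - w))].
  apply/seteqP; split => u [u01 Eu]; split => //; move: Eu;
  by rewrite /= /ell [w + _ - w]addrAC subrr add0r scalerA [u * s0]mulrC.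
have mE2 (s : R) : measurable [set u : R | E (w + (s * u) *: (v - w))].
  apply: (bE _ (measurableTypeR R) (fun u => w + (s * u) *: (v - w))) => i.
  under eq_fun do rewrite !mxE; apply: measurable_funD; first exact: measurable_cst.
  by apply: measurable_funM; [apply: measurable_funM|]; exact: measurable_cst || exact: measurable_id.
have mF2 : measurable F2 by rewrite F2E; apply: measurableI.
split => //; apply: (le_trans (ltW hF)); rewrite (lebesgue_measure_scale s00 mF).
have mF3 : measurable (( *%R s0) @^-1` F).
  by rewrite -[X in measurable X]setTI; apply: mulrl_measurable.
apply: (@le_trans _ _ (lebesgue_measure (( *%R s0) @^-1` F))).
  by rewrite gee_pMl// lte_fin.
apply: le_measure; rewrite ?inE//.
rewrite F2E => u [/=]; rewrite !in_itv /= => /andP[u1 u2] Eu; split => //=.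
have su := s0max (s0 * u); rewrite inE in su.
have {}su : s0 * u <= s0 by apply: su; apply: FS; split => //=; rewrite in_itv /= u1.
have u0 : 0 < u by rewrite -(pmulr_rgt0 _ s00); lra.
by rewrite (ltW u0) /= -(ler_pM2l s00) mulr1.
Qed.

Lemma lebesgue_rV_borelD E K : borel_rV E -> E `<=` K ->
  lebesgue_rV K = (lebesgue_rV E + lebesgue_rV (K `\` E))%E.
Proof.
move=> bE EK; have := borel_rV_measurable bE K; rewrite setDE.
by have -> : K `&` E = E by apply/setIidPr.
Qed.

(** Remove from the box a countable cover by boxes of the complement of E with small excess, and
    take the union of the results. The Borel set obtained has measurable traces on curves. *)
Lemma lebesgue_rV_inner_borel E a b : lebesgue_measurable E -> E `<=` box a b ->
  exists F, [/\ borel_rV F, F `<=` E & lebesgue_rV F = lebesgue_rV E].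
Proof.
move=> mE EB; set B := box a b in EB *.
have finB A : A `<=` B -> (lebesgue_rV A \is a fin_num)%E.
  move=> AB; rewrite ge0_fin_numE ?lebesgue_rV_ge0//.
  exact: le_lt_trans (lebesgue_rV_box AB) (ltry _).
have DB : B `\` E `<=` B by move=> x [].
have BE : lebesgue_rV B = (lebesgue_rV E + lebesgue_rV (B `\` E))%E.
  by have := mE B; rewrite setDE (_ : B `&` E = E)//; apply/setIidPr.
have approx k : exists F, [/\ borel_rV F, F `<=` E & (lebesgue_rV E <= lebesgue_rV F + (k.+1%:R^-1)%:E)%E].
  have k0 : 0 < k.+1%:R^-1 :> R by rewrite invr_gt0 ltr0n.
  have [|c [cc lec]] := @lebesgue_rV_cover R n (B `\` E) _ _ k0.
    by rewrite ltey_eq finB.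
  exists (B `\` \bigcup_k box (c k).1 (c k).2); split.
  - apply: borel_rVD; first exact: borel_rV_box.
    by apply: borel_rV_bigcup => j; exact: borel_rV_box.
  - by move=> x [Bx nx]; apply: contrapT => nE; apply: nx; exact: cc.
  set U := \bigcup_k _; set F := B `\` U.
  have le1 : (lebesgue_rV B <= lebesgue_rV F + (lebesgue_rV (B `\` E) + (k.+1%:R^-1)%:E))%E.
    apply: (@le_trans _ _ (\sum_(b : bool) lebesgue_rV (if b then F else U))%E).
      apply: lebesgue_rV_fin_union => x Bx.
      by have [Ux|nUx] := pselect (U x); [exists false|exists true].
    rewrite big_bool /= leeD2l//; exact: le_trans (lebesgue_rV_le_sum (@subset_refl _ _)) lec.
  have fE := finB E EB; have fD := finB _ DB.
  have fF : (lebesgue_rV F \is a fin_num)%E by apply: finB => x [].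
  move: le1; rewrite BE -(fineK fE) -(fineK fD) -(fineK fF) -!EFinD !lee_fin.
  by set i := k.+1%:R^-1; set x := fine _; set y := fine _; set z := fine _ => h; lra.
have /choice[G hG] := approx; exists (\bigcup_k G k); split.
- by apply: borel_rV_bigcup => k; have [] := hG k.
- by move=> x [k _]; have [_ + _] := hG k; exact.
apply/eqP; rewrite eq_le; apply/andP; split.
  by apply: le_lebesgue_rV => x [k _]; have [_ + _] := hG k; exact.
apply/lee_addgt0Pr => e e0.
have [k hk] : exists k : nat, k.+1%:R^-1 < e.
  exists (Num.truncn e^-1); rewrite -[ltRHS]invrK ltf_pV2 ?posrE ?invr_gt0//; exact: truncnS_gt.
have [_ _ h] := hG k; apply: (le_trans h); apply: leeD; last by rewrite lee_fin ltW.
by apply: le_lebesgue_rV => x Gx; exists k.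
Qed.

End segments.

(** * Derivatives along polynomial curves *)

Section partial_derivatives.
Context {R : realType} {n : nat}.
Implicit Types (f g : 'rV[R]_n.+1 -> R) (x y e u : 'rV[R]_n.+1) (U : set 'rV[R]_n.+1).

Let ev (i : 'I_n.+1) : 'rV[R]_n.+1 := delta_mx 0 i.

Lemma is_derive_of_cvg (h : R -> R) (t l : R) :
  (fun s => s^-1 * (h (t + s) - h t)) @ 0^' --> l -> is_derive t 1 h l.
Proof.
move=> hl; have E : (fun s : R => s^-1 *: ((h \o shift t) (s *: 1) - h t)) = (fun s => s^-1 * (h (t + s) - h t)).
  apply/funext => s /=; have -> : s *: 1 = s :> R by exact: mulr1.
  by rewrite [s + t]addrC.
apply: DeriveDef; first by rewrite /derivable E; apply: cvgP hl.
by rewrite /derive E; apply: cvg_lim.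
Qed.

Lemma is_derive_line f y e (t : R) : derivable f (y + t *: e) e ->
  is_derive t 1 (fun s => f (y + s *: e)) ('D_e f (y + t *: e)).
Proof.
move=> df; apply: is_derive_of_cvg.
have -> : (fun s => s^-1 * (f (y + (t + s) *: e) - f (y + t *: e))) =
    (fun s => s^-1 *: ((f \o shift (y + t *: e)) (s *: e) - f (y + t *: e))).
  by apply/funext => s /=; rewrite scalerDl addrA [_ + s *: e]addrC.
exact: df.
Qed.

Lemma line_mvt f y e (h : R) : (forall s, `|s| <= `|h| -> derivable f (y + s *: e) e) ->
  exists2 th, `|th| <= `|h| & f (y + h *: e) - f y = h * 'D_e f (y + th *: e).
Proof.
move=> df; pose phi s := f (y + s *: e); pose dphi s := 'D_e f (y + s *: e).
have phiE : phi 0 = f y by rewrite /phi scale0r addr0.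
have der (s : R) : `|s| <= `|h| -> is_derive s 1 phi (dphi s).
  by move=> sh; apply: is_derive_line; exact: df.
have [h0|h0] := leP 0 h.
  have ab s : 0 <= s <= h -> `|s| <= `|h| by move=> /andP[? ?]; rewrite !ger0_norm.
  have [||c] := @MVT_segment R phi dphi 0 h h0.
  - by move=> s; rewrite in_itv /= => /andP[? ?]; apply/der/ab; rewrite !ltW.
  - by apply: (is_derive_within_continuous (df := dphi)) => s sh; apply/der/ab.
  rewrite in_itv /= => ch; rewrite subr0 mulrC phiE => E; exists c => //; exact: ab.
have ab s : h <= s <= 0 -> `|s| <= `|h|.
  by move=> /andP[? ?]; rewrite !ler0_norm ?lerN2// ltW.
have [||c] := @MVT_segment R phi dphi h 0 (ltW h0).
- by move=> s; rewrite in_itv /= => /andP[? ?]; apply/der/ab; rewrite !ltW.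
- by apply: (is_derive_within_continuous (df := dphi)) => s sh; apply/der/ab.
rewrite in_itv /= => ch; rewrite sub0r phiE => E; exists c; first exact: ab.
by rewrite -[LHS]opprB [f y - _]E mulrN opprK mulrC.
Qed.

Lemma norm_delta i : `|ev i| <= 1.
Proof.
apply/mx_norm_leP => j; rewrite mxE eqxx /=.
by case: eqP => _; rewrite ?normr1 ?normr0.
Qed.

Lemma continuous_ballP f x (e : R) : {for x, continuous f} -> 0 < e ->
  exists2 r, 0 < r & forall y, `|y - x| < r -> `|f y - f x| <= e.
Proof.
move=> cf e0; have /cvgrPdist_le/(_ e e0)/nbhs_ballP[r /= r0 hr] := cf.
by exists r => // y yx; rewrite distrC; apply: hr; rewrite -ball_normE /= distrC.
Qed.

Lemma second_difference f i j x (h : R) : 0 < h ->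
  (forall y, `|y - x| <= h + h -> derivable f y (ev i)) ->
  (forall y, `|y - x| <= h + h -> derivable (partial i f) y (ev j)) ->
  exists2 p, `|p - x| <= h + h &
    f (x + h *: ev i + h *: ev j) - f (x + h *: ev i) - (f (x + h *: ev j) - f x) =
    h * h * partial j (partial i f) p.
Proof.
move=> h0 di dj.
have segx (s t : R) : 0 <= s <= h -> `|t| <= h -> `|x + s *: ev i + t *: ev j - x| <= h + h.
  move=> /andP[s0 sh] th; rewrite -(addrA x) [x + _]addrC addrK.
  apply: (le_trans (ler_normD _ _)); apply: lerD; rewrite normrZ.
    by apply: le_trans sh; rewrite ger0_norm// ler_piMr// norm_delta.
  by apply: le_trans th; rewrite ler_piMr// norm_delta.
pose phi s := f (x + h *: ev j + s *: ev i) - f (x + s *: ev i).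
pose dphi s := partial i f (x + h *: ev j + s *: ev i) - partial i f (x + s *: ev i).
have der s : 0 <= s <= h -> is_derive s 1 phi (dphi s).
  move=> sh; apply: is_deriveB; apply: is_derive_line; apply: di.
    by rewrite [x + h *: _ + _]addrAC; apply: segx => //; rewrite ger0_norm// ltW.
  by have := segx s 0 sh; rewrite scale0r addr0 normr0; apply; exact: ltW.
have [||c] := @MVT_segment R phi dphi 0 h (ltW h0).
- by move=> s; rewrite in_itv /= => /andP[? ?]; apply: der; rewrite !ltW.
- exact: is_derive_within_continuous der.
rewrite in_itv /= => ch; rewrite subr0 /phi /dphi !scale0r !addr0.
have [|th th1] := @line_mvt (partial i f) (x + c *: ev i) (ev j) h.
  by move=> s sh; apply/dj/segx => //; rewrite (gtr0_norm h0) in sh.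
rewrite [x + c *: _ + h *: _]addrAC => -> E; exists (x + c *: ev i + th *: ev j).
  by apply: segx => //; rewrite (gtr0_norm h0) in th1.
rewrite [x + h *: ev i + _]addrAC [LHS](_ : _ = f (x + h *: ev j + h *: ev i) - f (x + h *: ev i) - (f (x + h *: ev j) - f x))//.
by rewrite E mulrC mulrA.
Qed.

(** The second difference of f is symmetric in i and j, and equals h^2 times either mixed partial
    derivative at a point near x. *)
Lemma schwarz f i j x U : open U -> U x ->
  (forall y, U y -> [/\ derivable f y (ev i), derivable f y (ev j),
     derivable (partial i f) y (ev j) & derivable (partial j f) y (ev i)]) ->
  {for x, continuous (partial i (partial j f))} ->
  {for x, continuous (partial j (partial i f))} ->
  partial i (partial j f) x = partial j (partial i f) x.
Proof.
move=> oU Ux dU c1 c2; apply/eqP; rewrite -subr_eq0 -normr_eq0 eq_le normr_ge0 andbT.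
apply/ler_addgt0Pl => e e0; rewrite addr0.
have e20 : 0 < e / 2 by rewrite divr_gt0.
have [r1 r10 h1] := continuous_ballP c1 e20.
have [r2 r20 h2] := continuous_ballP c2 e20.
have [r3 /= r30 h3] : nbhs_ball x U by apply/nbhs_ballP; exact: open_nbhs_nbhs.
pose h := Num.min r1 (Num.min r2 r3) / 3.
have m0 : 0 < Num.min r1 (Num.min r2 r3) by rewrite !lt_min r10 r20.
have h0 : 0 < h by rewrite divr_gt0.
have hh : h + h < Num.min r1 (Num.min r2 r3) by rewrite /h; set w := Num.min _ _ in m0 *; lra.
have [hr1 hr2 hr3] : [/\ h + h < r1, h + h < r2 & h + h < r3].
  by move: hh; rewrite !lt_min => /and3P[].
have hU y : `|y - x| <= h + h -> U y.
  by move=> yx; apply: h3; rewrite -ball_normE /= distrC (le_lt_trans yx).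
have [p px pE] := @second_difference f i j x h h0
  (fun y yx => let: And4 a _ _ _ := dU y (hU y yx) in a)
  (fun y yx => let: And4 _ _ a _ := dU y (hU y yx) in a).
have [q qx qE] := @second_difference f j i x h h0
  (fun y yx => let: And4 _ a _ _ := dU y (hU y yx) in a)
  (fun y yx => let: And4 _ _ _ a := dU y (hU y yx) in a).
have pq : partial j (partial i f) p = partial i (partial j f) q.
  have hh0 : h * h != 0 by rewrite mulf_neq0// gt_eqF.
  move: pE qE; generalize (partial j (partial i f) p) (partial i (partial j f) q) => a b pE qE.
  have E : h * h * a = h * h * b.
    rewrite -pE -qE [x + h *: ev i + _]addrAC -!addrA; congr (_ + _).
    by rewrite !opprB addrCA [in RHS]addrCA; congr (_ + _); rewrite addrC.
  exact: (mulfI hh0 E).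
have a1 := h1 q (le_lt_trans qx hr1); have a2 := h2 p (le_lt_trans px hr2).
move: a1 a2; rewrite pq; generalize (partial i (partial j f) q) (partial i (partial j f) x) (partial j (partial i f) x).
move=> a b c; rewrite distrC => a1 a2; apply: (le_trans (ler_distD a b c)).
by rewrite [leRHS]splitr; apply: lerD.
Qed.

(** Move from x to x + u one coordinate at a time, through the points z k, and apply the mean value
    theorem to each move. *)
Lemma partial_expansion g x (r : R) : 0 < r ->
  (forall i y, `|y - x| < r -> derivable g y (ev i)) ->
  (forall i, {for x, continuous (partial i g)}) ->
  forall eps, 0 < eps -> exists2 del, 0 < del & forall u, `|u| < del ->
    `|g (x + u) - g x - \sum_i partial i g x * u 0 i| <= eps * `|u|.
Proof.
move=> r0 dg cg eps eps0; have e0 : 0 < eps / n.+1%:R by rewrite divr_gt0.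
have /choice[rr hrr] : forall i, exists r', 0 < r' /\ forall y, `|y - x| < r' -> `|partial i g y - partial i g x| <= eps / n.+1%:R.
  by move=> i; have [r' r'0 hr'] := continuous_ballP (cg i) e0; exists r'.
pose del := Num.min r (\big[Num.min/r]_i rr i).
exists del; first by rewrite lt_min r0 /=; apply: lt_bigmin => // i _; have [] := hrr i.
move=> u ud; have [ur urr] : `|u| < r /\ forall i, `|u| < rr i.
  move: ud; rewrite lt_min => /andP[-> h]; split => // i; apply: (lt_le_trans h); exact: bigmin_le_cond.
pose z (k : nat) : 'rV[R]_n.+1 := x + \row_i (if (i < k)%N then u 0 i else 0).
have z0 : z 0%N = x by rewrite /z; apply/rowP => i; rewrite !mxE addr0.
have zn : z n.+1 = x + u by rewrite /z; apply/rowP => i; rewrite !mxE ltn_ord.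
have zS (k : 'I_n.+1) : z k.+1 = z k + u 0 k *: ev k.
  apply/rowP => i; rewrite !mxE eqxx /= -addrA; congr (_ + _).
  rewrite ltnS leq_eqVlt -(inj_eq val_inj) /=; case: eqVneq => [ik|_].
    by rewrite (val_inj ik) ltnn add0r mulr1.
  by rewrite mulr0 addr0.
have zu (k : 'I_n.+1) (th : R) : `|th| <= `|u 0 k| -> `|z k + th *: ev k - x| <= `|u|.
  move=> thu; apply/mx_norm_leP => i; rewrite !mxE eqxx /=.
  rewrite -(addrA (x 0 i)) [x 0 i + _]addrC addrK.
  case: eqVneq => [->|_]; first by rewrite ltnn add0r mulr1 (le_trans thu)// coord_le_norm.
  by rewrite mulr0 addr0; case: ifP => _; rewrite ?coord_le_norm// normr0.
have /choice[th hth] : forall k : 'I_n.+1, exists th : R, `|th| <= `|u 0 k| /\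
    g (z k.+1) - g (z k) = u 0 k * partial k g (z k + th *: ev k).
  move=> k; have [|th th1 E] := @line_mvt g (z k) (ev k) (u 0 k).
    by move=> s sh; apply: dg; apply: le_lt_trans ur; exact: zu.
  by exists th; rewrite zS.
have -> : g (x + u) - g x = \sum_(k < n.+1) (g (z k.+1) - g (z k)).
  by rewrite -(big_mkord xpredT (fun k => g (z k.+1) - g (z k))) telescope_sumr// zn z0.
rewrite -sumrB; apply: (le_trans (ler_norm_sum _ _ _)).
apply: (@le_trans _ _ (\sum_(k < n.+1) eps / n.+1%:R * `|u|)); last first.
  by rewrite sumr_const card_ord -[leLHS]mulr_natl mulrA mulrCA divff ?mulr1// pnatr_eq0.
apply: ler_sum => k _; have [th1 ->] := hth k.
rewrite [partial k g x * _]mulrC -mulrBr normrM mulrC ler_pM//; last exact: coord_le_norm.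
by have [_] := hrr k; apply; apply: le_lt_trans (urr k); exact: zu.
Qed.

Lemma is_derive_comp_curve g (C : 'I_n.+1 -> {poly R}) (s r : R) :
  let gam t : 'rV[R]_n.+1 := \row_k (C k).[t] in
  0 < r -> (forall i y, `|y - gam s| < r -> derivable g y (ev i)) ->
  (forall i, {for gam s, continuous (partial i g)}) ->
  is_derive s 1 (fun t => g (gam t)) (\sum_k partial k g (gam s) * (C k)^`().[s]).
Proof.
move=> gam r0 dg cg; apply: is_derive_of_cvg.
pose u h := gam (s + h) - gam s.
have quot k : (fun h => h^-1 * u h 0 k) @ 0^' --> (C k)^`().[s].
  have dC := @is_derive_poly R (C k) s.
  have := @ex_derive _ _ _ _ _ _ _ dC; have := @derive_val _ _ _ _ _ _ _ dC.
  rewrite /derivable => E /cvg_ex[l hl]; move: (hl) => /cvg_lim El.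
  have El2 : l = (C k)^`().[s] by rewrite -E; apply/esym; exact: El.
  rewrite -El2; have -> : (fun h => h^-1 * u h 0 k) =
      (fun h : R => h^-1 *: (((horner (C k)) \o shift s) (h *: 1) - (C k).[s])).
    apply/funext => h /=; rewrite /u !mxE /shift /=; have -> : h *: 1 = h :> R by exact: mulr1.
    by rewrite [s + h]addrC.
  exact: hl.
pose S1 h := \sum_k partial k g (gam s) * (h^-1 * u h 0 k).
pose S2 h := \sum_k `|h^-1 * u h 0 k|.
have c1 : S1 @ 0^' --> \sum_k partial k g (gam s) * (C k)^`().[s].
  by apply: cvg_big => [|k _]; [exact: add_continuous|]; apply: cvgMr; exact: quot.
have c2 : S2 @ 0^' --> \sum_k `|(C k)^`().[s]|.
  by apply: cvg_big => [|k _]; [exact: add_continuous|]; apply: cvg_norm; exact: quot.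
set b := \sum_k `|_| in c2.
have b0 : 0 <= b by apply: sumr_ge0.
apply/cvgrPdist_le => e e0; have e20 : 0 < e / 2 by rewrite divr_gt0.
have eb0 : 0 < e / 2 / (b + 1) by rewrite divr_gt0// ltr_wpDl.
have [del del0 hdel] := partial_expansion r0 dg cg eb0.
have db0 : 0 < del / (b + 1) by rewrite divr_gt0// ltr_wpDl.
have /cvgrPdist_le/(_ _ e20) n1 := c1.
have /cvgrPdist_le/(_ _ ltr01) n2 := c2.
near=> h.
have h0 : h != 0 by near: h; exact: nbhs_dnbhs_neq.
have uh : `|u h| <= (b + 1) * `|h|.
  apply/mx_norm_leP => k; rewrite -ler_pdivrMr ?normr_gt0//.
  have S2b : S2 h <= b + 1.
    by have : `|b - S2 h| <= 1 by [near: h]; rewrite ler_norml => /andP[? _]; lra.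
  apply: le_trans S2b; rewrite /S2 (bigD1 k)//= [`|h^-1 * _|]normrM normfV mulrC lerDl.
  exact: sumr_ge0.
have ud : `|u h| < del.
  apply: (le_lt_trans uh); rewrite mulrC -ltr_pdivlMr ?ltr_wpDl//.
  near: h; apply: dnbhs0_lt; exact: db0.
have := hdel (u h) ud; rewrite {1}/u subrKC.
set A := g (gam (s + h)) - g (gam s); set T := \sum_i _ => AT.
have -> : \sum_k partial k g (gam s) * (C k)^`().[s] - h^-1 * A =
   (\sum_k partial k g (gam s) * (C k)^`().[s] - S1 h) - h^-1 * (A - T).
  have -> : S1 h = h^-1 * T by rewrite /S1 /T mulr_sumr; apply: eq_bigr => k _; rewrite mulrCA.
  by set X := \sum_k _; clearbody A T X; ring.
apply: (le_trans (ler_normB _ _)).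
have : `|h^-1 * (A - T)| <= e / 2.
  rewrite normrM normfV ler_pdivrMl ?normr_gt0//; apply: (le_trans AT).
  rewrite mulrAC ler_pdivrMr ?ltr_wpDl//.
  apply: (le_trans (ler_wpM2l (ltW e20) uh)).
  by rewrite [leLHS]mulrA [leLHS]mulrC [leLHS]mulrA.
have : `|\sum_k partial k g (gam s) * (C k)^`().[s] - S1 h| <= e / 2 by near: h.
lra.
Unshelve. all: by end_near.
Qed.

End partial_derivatives.

(** * Sums of partial derivatives over words *)

Section words.
Context {R : realType} {n : nat}.
Implicit Types (F : seq 'I_n.+1 -> R).

(** Words of length m replace multi-indices: differentiating along a curve prepends a letter, so the
    chain rule becomes a plain recursion without multinomial coefficients. *)
Fixpoint wsum (m : nat) F : R :=
  if m is m'.+1 then \sum_k wsum m' (fun w => F (k :: w)) else F [::].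

Lemma wsum_le m F F' : (forall w, size w = m -> F w <= F' w) -> wsum m F <= wsum m F'.
Proof.
elim: m F F' => [|m IH] F F' FF' /=; first exact: FF'.
by apply: ler_sum => k _; apply: IH => w wm; apply: FF'; rewrite /= wm.
Qed.

Lemma wsumZ m F (c : R) : wsum m (fun w => c * F w) = c * wsum m F.
Proof.
elim: m F => [|m IH] F //=; rewrite mulr_sumr; apply: eq_bigr => k _; exact: IH.
Qed.

Lemma wsum_sum m (I : Type) (r : seq I) (F : I -> seq 'I_n.+1 -> R) :
  wsum m (fun w => \sum_(i <- r) F i w) = \sum_(i <- r) wsum m (F i).
Proof.
elim: m F => [|m IH] F //=; rewrite exchange_big /=; apply: eq_bigr => k _; exact: IH.
Qed.

(* Each alpha with |alpha| = m is the content of m!/alpha! words of length m. *)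
Lemma wsum_counts (N m : nat) (g : ('I_n.+1 -> nat) -> R) : (m <= N)%N ->
  wsum m (fun w => g (fun i => count_mem i w)) =
  \sum_(alpha : {ffun 'I_n.+1 -> 'I_N.+1} | (\sum_i alpha i)%N == m)
    m`!%:R / (\prod_i (alpha i)`!)%:R * g (fun i => alpha i).
Proof.
elim: m g => [|m IH] g mN /=.
  rewrite (bigD1 [ffun=> ord0])/=; last by rewrite big1// => i _; rewrite ffunE.
  rewrite [X in _ + X]big1 ?addr0 => [|a /andP[/eqP a0 /negP na]].
    rewrite big1 ?fact0 ?divr1 ?mul1r => [|i _]; last by rewrite ffunE.
    by congr g; apply/funext => i; rewrite ffunE.
  exfalso; apply: na; apply/eqP/ffunP => i; rewrite ffunE; apply: val_inj => /=.
  by apply/eqP; rewrite -leqn0 -[leqRHS]a0 (bigD1 i)//= leq_addr.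
pose ind k i : nat := (k == i :> 'I_n.+1).
pose inc k (a : {ffun 'I_n.+1 -> 'I_N.+1}) : {ffun 'I_n.+1 -> 'I_N.+1} := [ffun i => inord (a i + ind k i)].
pose dec k (a : {ffun 'I_n.+1 -> 'I_N.+1}) : {ffun 'I_n.+1 -> 'I_N.+1} := [ffun i => inord (a i - ind k i)].
have sind k : (\sum_i ind k i = 1)%N.
  by rewrite /ind (bigD1 k)//= eqxx big1 // => i; rewrite eq_sym => /negPf ->.
have le_sum (a : {ffun 'I_n.+1 -> 'I_N.+1}) i : (a i <= \sum_i a i)%N by rewrite (bigD1 i)//= leq_addr.
have incE k (a : {ffun 'I_n.+1 -> 'I_N.+1}) i : (\sum_i a i)%N == m -> inc k a i = (a i + ind k i)%N :> nat.
  move=> /eqP am; rewrite ffunE inordK// ltnS; apply: leq_trans mN.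
  apply: (@leq_trans (\sum_i a i + 1)); last by rewrite am addn1.
  by apply: leq_add; rewrite ?le_sum// /ind leq_b1.
have decE k (a : {ffun 'I_n.+1 -> 'I_N.+1}) i : dec k a i = (a i - ind k i)%N :> nat.
  by rewrite ffunE inordK// ltnS (leq_trans (leq_subr _ _))// -ltnS.
(* For words starting with k, put b = alpha + e_k; then m!/alpha! = b_k m!/b!. Summing over k gives
   the factor sum_k b_k = m + 1. *)
have step k : wsum m (fun w => g (fun i => count_mem i (k :: w))) =
    \sum_(b : {ffun 'I_n.+1 -> 'I_N.+1} | (\sum_i b i)%N == m.+1)
      (b k)%:R * (m`!%:R / (\prod_i (b i)`!)%:R) * g (fun i => b i).
  have -> : wsum m (fun w => g (fun i => count_mem i (k :: w))) =
      wsum m (fun w => g (fun i => (count_mem i w + ind k i)%N)).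
    by congr wsum; apply/funext => w; congr g; apply/funext => i; rewrite /= addnC.
  rewrite (IH (fun c => g (fun i => (c i + ind k i)%N)) (ltnW mN)).
  rewrite [RHS](bigID (fun b : {ffun 'I_n.+1 -> 'I_N.+1} => 0 < b k)%N) /= [X in _ = _ + X]big1 ?addr0; last first.
    by move=> b /andP[_]; rewrite lt0n negbK => /eqP ->; rewrite !mul0r.
  rewrite (reindex_onto (dec k) (inc k)) /=; last first.
    move=> a am; apply/ffunP => i; apply: val_inj; rewrite /= decE incE//.
    by rewrite addnK.
  have Pb (b : {ffun 'I_n.+1 -> 'I_N.+1}) : ((\sum_i dec k b i)%N == m) && (inc k (dec k b) == b) =
      ((\sum_i b i)%N == m.+1) && (0 < b k)%N.
    have [bk|] := ltnP 0 (b k); last first.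
      rewrite leqn0 => /eqP bk; rewrite andbF; apply/negP => /andP[dm /eqP/ffunP/(_ k)/(congr1 val)] /=.
      by rewrite incE// decE bk /ind eqxx.
    have bi i : (ind k i <= b i)%N by rewrite /ind; case: eqP => [<-|].
    have s1 : (\sum_i dec k b i + 1 = \sum_i b i)%N.
      by rewrite -(sind k) -big_split; apply: eq_bigr => i _; rewrite /= decE subnK.
    rewrite andbT -s1 addn1 eqSS; case: eqP => //= dm; apply/eqP/ffunP => i; apply: val_inj.
    by rewrite /= incE ?decE ?subnK//; apply/eqP.
  rewrite (eq_bigl _ _ Pb); apply: eq_bigr => b /andP[bm bk].
  have bi i : (ind k i <= b i)%N by rewrite /ind; case: eqP => [<-|].
  congr (_ * _); last by congr g; apply/funext => i; rewrite decE subnK.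
  have -> : (\prod_i (b i)`! = b k * \prod_i (dec k b i)`!)%N.
    rewrite (bigD1 k)//= [in RHS](bigD1 k)//= mulnA; congr (_ * _)%N.
      by rewrite decE /ind eqxx subn1; case: (nat_of_ord (b k)) bk => // q _; rewrite factS.
    by apply: eq_bigr => i ik; rewrite decE /ind eq_sym (negPf ik) subn0.
  have bk0 : (b k)%:R != 0 :> R by rewrite pnatr_eq0 -lt0n.
  by rewrite natrM invfM mulrCA mulVKf.
rewrite (eq_bigr _ (fun k _ => step k)) exchange_big /=; apply: eq_bigr => b /eqP bm.
rewrite -mulr_suml -mulr_suml; congr (_ * _); rewrite -natr_sum bm factS natrM mulrA.
by [].
Qed.

End words.

Section smooth_partials.
Context {R : realType} {n : nat}.
Implicit Types (f g : 'rV[R]_n.+1 -> R) (x y : 'rV[R]_n.+1) (U : set 'rV[R]_n.+1) (w : seq 'I_n.+1).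

Lemma partials_eq_on U f g w : open U -> (forall y, U y -> f y = g y) ->
  forall y, U y -> partials w f y = partials w g y.
Proof.
move=> oU fg; elim: w => [|i w IH] y Uy /=; first exact: fg.
apply: near_eq_derive; near=> z; apply: IH; near: z; exact: open_nbhs_nbhs.
Unshelve. all: by end_near.
Qed.

Variables (U : set 'rV[R]_n.+1) (f : 'rV[R]_n.+1 -> R).
Hypotheses (oU : open U) (Cf : Cinfty_on U f).

Lemma partials_move i a b x : U x -> partials (a ++ i :: b) f x = partials (i :: a ++ b) f x.
Proof.
elim: a x => [|k a IH] x Ux //=.
rewrite -[LHS]/(partials [:: k] (partials (a ++ i :: b) f) x) (partials_eq_on [:: k] oU IH Ux) /=.
apply: (schwarz oU Ux) => [y Uy||].
- by split; [apply: (Cf (a ++ b) Uy).2|apply: (Cf (a ++ b) Uy).2|apply: (Cf (k :: a ++ b) Uy).2|apply: (Cf (i :: a ++ b) Uy).2].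
- exact: (Cf (k :: i :: a ++ b) Ux).1.
- exact: (Cf (i :: k :: a ++ b) Ux).1.
Qed.

Lemma partials_perm w w' x : perm_eq w w' -> U x -> partials w f x = partials w' f x.
Proof.
elim: w w' x => [|i w IH] w' x ww' Ux; first by rewrite perm_sym in ww'; rewrite (perm_nilP ww').
have iw' : i \in w' by rewrite -(perm_mem ww') mem_head.
case/splitPr: iw' ww' => a b; rewrite perm_sym -[X in perm_eq (a ++ X)]cat1s perm_catCA /= perm_cons => abw.
rewrite partials_move//=; apply: (partials_eq_on [:: i] oU _ Ux) => y Uy.
by apply: IH => //; rewrite perm_sym.
Qed.

Lemma multi_partialE alpha g : multi_partial alpha g =
  partials (flatten [seq nseq (alpha i) i | i <- enum 'I_n.+1]) g.
Proof.
rewrite /multi_partial /partials; elim: (enum _) => [|i s IH] //=.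
by rewrite foldr_cat -IH; elim: (alpha i) => //= k ->.
Qed.

Lemma partials_multi_partial w x : U x ->
  partials w f x = multi_partial (fun i => count_mem i w) f x.
Proof.
move=> Ux; rewrite multi_partialE; apply: partials_perm => //.
apply/allP => i _ /=; rewrite count_flatten -map_comp sumnE big_map big_enum /=.
rewrite (bigD1 i)//= count_nseq /= eqxx mul1n big1 ?addn0// => k /negPf ki.
by rewrite count_nseq /= ki mul0n.
Qed.

End smooth_partials.

(** The weights j!/alpha! in the definition of smoothness are exactly what makes it a bound for the
    sum over words. *)
Lemma mu_smooth_wsum {R : realType} {n : nat} (mu : nat -> R) M0 (L U : set 'rV[R]_n.+1) f m x :
  open U -> L `<=` U -> Cinfty_on U f -> mu_smooth mu M0 L f -> L x ->
  wsum m (fun w => `|partials w f x|) <= Mseq mu M0 m.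
Proof.
move=> oU LU Cf [_ smooth] Lx; apply: le_trans (smooth m x Lx).
rewrite -(wsum_counts (fun c => `|multi_partial c f x|) (leqnn m)).
by apply: wsum_le => w _; rewrite (partials_multi_partial oU Cf)//; exact: LU.
Qed.

(** * Taylor coefficients of a composite function by recursion *)

Section normalized_derivatives.
Context {R : realType} {I : Type}.
Variables (r : seq I) (Phi : seq I -> R -> R) (c : I -> nat -> R -> R).

(* d j w is the j-th Taylor coefficient of Phi w when the curve with Taylor
   coefficients c k p drives the system Phi w' = \sum_k c k 1 * Phi (k :: w). *)
Lemma ex_normalized_derivatives : exists d : nat -> seq I -> R -> R,
  (forall w s, d 0%N w s = Phi w s) /\
  forall j w s, d j.+1 w s =
    j.+1%:R^-1 * \sum_(k <- r) \sum_(p < j.+1) p.+1%:R * c k p.+1 s * d (j - p)%N (k :: w) s.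
Proof.
(* The recursive calls have order j - p, which is not structural; hence the fuel and [DE], its
   independence of the amount. *)
pose fix D (fuel j : nat) (w : seq I) (s : R) {struct fuel} : R :=
  if fuel is fuel'.+1 then
    if j is j'.+1 then j'.+1%:R^-1 *
      \sum_(k <- r) \sum_(p < j'.+1) p.+1%:R * c k p.+1 s * D fuel' (j' - p)%N (k :: w) s
    else Phi w s
  else 0.
have D0 fuel w s : D fuel.+1 0%N w s = Phi w s by [].
have DS fuel j w s : D fuel.+1 j.+1 w s = j.+1%:R^-1 *
  \sum_(k <- r) \sum_(p < j.+1) p.+1%:R * c k p.+1 s * D fuel (j - p)%N (k :: w) s by [].
move: D D0 DS => D D0 DS.
have DE fuel j w s : (j < fuel)%N -> D fuel j w s = D j.+1 j w s.
  have [m] := ubnP fuel; elim: m => // m IH in fuel j w s *.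
  case: fuel => // fuel; rewrite ltnS => fm; case: j => [|j]; first by rewrite !D0.
  rewrite ltnS => jf; rewrite !DS.
  congr (_ * _); apply: eq_bigr => k _; apply: eq_bigr => p _; congr (_ * _).
  rewrite IH//; last by rewrite (leq_ltn_trans (leq_subr _ _)).
  by rewrite [RHS]IH ?(leq_ltn_trans jf fm) ?ltnS ?leq_subr.
exists (fun j => D j.+1 j); split => // j w s; rewrite DS.
congr (_ * _); apply: eq_bigr => k _; apply: eq_bigr => p _.
by rewrite DE// ltnS leq_subr.
Qed.

Variable d : nat -> seq I -> R -> R.
Hypothesis d0 : forall w s, d 0%N w s = Phi w s.
Hypothesis dS : forall j w s, d j.+1 w s =
  j.+1%:R^-1 * \sum_(k <- r) \sum_(p < j.+1) p.+1%:R * c k p.+1 s * d (j - p)%N (k :: w) s.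

Lemma is_derive_bigsum (J : Type) (t : seq J) (h dh : J -> R -> R) (s : R) :
  (forall i, is_derive s 1 (h i) (dh i s)) ->
  is_derive s 1 (fun x => \sum_(i <- t) h i x) (\sum_(i <- t) dh i s).
Proof.
move=> hd; elim: t => [|i t IH].
  by under eq_fun do rewrite big_nil; rewrite big_nil; exact: is_derive_cst.
under eq_fun do rewrite big_cons; rewrite big_cons.
by apply: is_deriveD.
Qed.

(** After an index shift in the first sum, the weights p and j + 1 - p add up to j + 1. *)
Lemma taylor_coefficient_identity (j : nat) (u e : nat -> R) :
  \sum_(p < j.+1) p.+1%:R * (p.+2%:R * u p.+2 * e (j - p)%N + u p.+1 * ((j - p).+1%:R * e (j - p).+1)) =
  j.+1%:R * \sum_(p < j.+2) p.+1%:R * u p.+1 * e (j.+1 - p)%N.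
Proof.
under eq_bigr do rewrite mulrDr.
rewrite big_split /=.
have -> : \sum_(p < j.+1) p.+1%:R * (p.+2%:R * u p.+2 * e (j - p)%N) =
    \sum_(p < j.+2) p%:R * (p.+1%:R * u p.+1 * e (j.+1 - p)%N).
  by rewrite [RHS]big_ord_recl mul0r add0r; apply: eq_bigr => p _; rewrite subSS.
have -> : \sum_(p < j.+1) p.+1%:R * (u p.+1 * ((j - p).+1%:R * e (j - p).+1)) =
    \sum_(p < j.+2) (j.+1 - p)%:R * (p.+1%:R * u p.+1 * e (j.+1 - p)%N).
  rewrite [RHS]big_ord_recr /= subnn mul0r addr0; apply: eq_bigr => p _.
  have pj : (p <= j)%N by rewrite -ltnS.
  rewrite (subSn pj); move: (e _) (u _) ((j - p).+1%:R) (p.+1%:R) => x y z v; ring.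
rewrite -big_split mulr_sumr; apply: eq_bigr => p _; rewrite /= -mulrDl -natrD subnKC//.
by rewrite -ltnS.
Qed.

Lemma is_derive_normalized (T : set R) :
  (forall w (s : R), T s -> is_derive s 1 (Phi w) (\sum_(k <- r) c k 1%N s * Phi (k :: w) s)) ->
  (forall k p (s : R), is_derive s 1 (c k p) (p.+1%:R * c k p.+1 s)) ->
  forall j w (s : R), T s -> is_derive s 1 (d j w) (j.+1%:R * d j.+1 w s).
Proof.
move=> dPhi dc j; have [m] := ubnP j; elim: m => // m IH in j *; rewrite ltnS => jm w s Ts.
case: j jm => [|j] jm.
  have -> : d 0%N w = Phi w by apply/funext => x; exact: d0.
  apply: is_derive_eq (dPhi w s Ts) _; rewrite dS invr1 !mul1r; apply: eq_bigr => k _.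
  by rewrite big_ord1 mul1r d0.
have -> : d j.+1 w = (fun x => j.+1%:R^-1 * \sum_(k <- r) \sum_(p < j.+1) p.+1%:R * c k p.+1 x * d (j - p)%N (k :: w) x).
  by apply/funext => x; exact: dS.
pose dh k (p : 'I_j.+1) x := p.+1%:R * (p.+2%:R * c k p.+2 x * d (j - p)%N (k :: w) x +
   c k p.+1 x * ((j - p).+1%:R * d (j - p).+1 (k :: w) x)).
have H : is_derive s 1 (fun x => \sum_(k <- r) \sum_(p < j.+1) p.+1%:R * c k p.+1 x * d (j - p)%N (k :: w) x)
    (\sum_(k <- r) \sum_(p < j.+1) dh k p s).
  apply: (@is_derive_bigsum I r _ (fun k x => \sum_(p < j.+1) dh k p x) s) => k.
  apply: (@is_derive_bigsum _ _ _ (dh k) s) => p.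
  have D1 := dc k p.+1 s; have D2 := IH (j - p)%N (leq_ltn_trans (leq_subr _ _) jm) (k :: w) s Ts.
  have D3 := @is_deriveM R _ _ _ _ _ _ _ D1 D2.
  have -> : (fun x => p.+1%:R * c k p.+1 x * d (j - p)%N (k :: w) x) =
      (fun x => p.+1%:R *: ((c k p.+1 * d (j - p)%N (k :: w)) : R -> R) x).
    by apply/funext => x; rewrite /= -mulrA.
  apply: is_derive_eq (is_deriveZ _ D3) _.
  rewrite /dh; have cE (x y : R) : x *: y = x * y by []. rewrite !cE; ring.
have -> : (fun x => j.+1%:R^-1 * \sum_(k <- r) \sum_(p < j.+1) p.+1%:R * c k p.+1 x * d (j - p)%N (k :: w) x) =
  (fun x => j.+1%:R^-1 *: (fun x => \sum_(k <- r) \sum_(p < j.+1) p.+1%:R * c k p.+1 x * d (j - p)%N (k :: w) x) x) by [].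
apply: is_derive_eq (is_deriveZ _ H) _.
rewrite dS mulVKf ?pnatr_eq0//.
under eq_bigr do rewrite (taylor_coefficient_identity j (fun p => c _ p s) (fun l => d l _ s)).
by rewrite -mulr_sumr [LHS]mulKf// pnatr_eq0.
Qed.

End normalized_derivatives.

Lemma deriv_nderivn (R : realType) (p : {poly R}) m : (p^`N(m))^`() = p^`N(m.+1) *+ m.+1.
Proof.
apply/polyP => i; rewrite coef_deriv coefMn !coef_nderivn -!mulrnA addnS addSn.
by congr (_ *+ _); rewrite [RHS]mulnC mul_bin_left subSn ?leq_addr// addKn mulnC.
Qed.

Section composition.
Context {R : realType} {n : nat}.

(** The assumption mu_m >= m makes M (q+l) / l! nondecreasing in l. All terms of the recursion are
    thus compared with the same quantity M (q+j+1) / j!, and the remaining weights sum to at most 1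
    by the condition on bet. *)
Lemma normalized_derivative_bound (Phi : seq 'I_n.+1 -> R) (c : 'I_n.+1 -> nat -> R)
    (d : nat -> seq 'I_n.+1 -> R) (M mu bet : nat -> R) (a : R) :
  (forall w, d 0%N w = Phi w) ->
  (forall j w, d j.+1 w =
    j.+1%:R^-1 * \sum_k \sum_(p < j.+1) p.+1%:R * c k p.+1 * d (j - p)%N (k :: w)) ->
  (forall m, wsum m (fun w => `|Phi w|) <= M m) ->
  (forall m, 0 <= M m) -> (forall m, M m.+1 = M m * mu m.+1) -> (forall m, m.+1%:R <= mu m.+1) ->
  (forall k p, `|c k p.+1| <= bet p.+1) -> 0 < a ->
  (forall q, \sum_(p < q) p.+1%:R * bet p.+1 / a ^+ p.+1 <= 1) ->
  forall j m, wsum m (fun w => `|d j w|) <= M (m + j)%N * a ^+ j / j`!%:R.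
Proof.
move=> d0 dS hPhi M0 MS muj cb a0 hbet.
have bet0 p : 0 <= bet p.+1 by apply: le_trans (cb ord0 p).
have Mle q l j : (l <= j)%N -> M (q + l)%N / l`!%:R <= M (q + j)%N / j`!%:R.
  move=> /subnKC <-; elim: (j - l)%N => [|i IH]; first by rewrite addn0.
  apply: (le_trans IH); rewrite !addnS MS factS natrM.
  have f0 : 0 < (l + i)`!%:R :> R by rewrite ltr0n fact_gt0.
  rewrite invfM mulrA; rewrite ler_wpM2r ?invr_ge0 ?(ltW f0)//.
  rewrite ler_pdivlMr ?ltr0n// ler_wpM2l//; apply: le_trans (muj _).
  by rewrite ler_nat ltnS leq_addl.
move=> j; have [m] := ubnP j; elim: m => // m IH in j *; rewrite ltnS => jm q.
case: j jm => [|j] jm.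
  rewrite addn0 expr0 fact0 divr1 mulr1; apply: le_trans (hPhi q).
  by apply: wsum_le => w _; rewrite d0.
have j0 : 0 < j.+1%:R :> R by rewrite ltr0n.
pose G (p : 'I_j.+1) w := `|d (j - p)%N w|.
apply: (@le_trans _ _ (j.+1%:R^-1 * \sum_(p < j.+1) p.+1%:R * bet p.+1 * wsum q.+1 (G p))).
  have -> : \sum_(p < j.+1) p.+1%:R * bet p.+1 * wsum q.+1 (G p) =
      wsum q (fun w => \sum_k \sum_(p < j.+1) p.+1%:R * bet p.+1 * G p (k :: w)).
    rewrite wsum_sum; under [RHS]eq_bigr do rewrite wsum_sum.
    rewrite exchange_big /=; apply: eq_bigr => p _; rewrite mulr_sumr; apply: eq_bigr => k _.
    by rewrite wsumZ.
  rewrite -wsumZ; apply: wsum_le => w _; rewrite dS normrM gtr0_norm ?invr_gt0//.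
  rewrite ler_wpM2l ?invr_ge0 ?(ltW j0)//; apply: (le_trans (ler_norm_sum _ _ _)).
  apply: ler_sum => k _; apply: (le_trans (ler_norm_sum _ _ _)); apply: ler_sum => p _.
  rewrite /G !normrM ger0_norm ?ler0n//; apply: ler_wpM2r => //; apply: ler_wpM2l => //.
rewrite ler_pdivrMl//.
apply: (@le_trans _ _ (\sum_(p < j.+1) M (q.+1 + j)%N / j`!%:R * a ^+ j.+1 * (p.+1%:R * bet p.+1 / a ^+ p.+1))).
  apply: ler_sum => p _; have pj : (p <= j)%N by rewrite -ltnS.
  apply: (@le_trans _ _ (p.+1%:R * bet p.+1 * (M (q.+1 + (j - p))%N / (j - p)`!%:R * a ^+ (j - p)))).
    rewrite ler_wpM2l ?mulr_ge0 ?ler0n//; rewrite mulrAC; apply: IH.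
    exact: leq_ltn_trans (leq_subr _ _) jm.
  have -> : M (q.+1 + j)%N / j`!%:R * a ^+ j.+1 * (p.+1%:R * bet p.+1 / a ^+ p.+1) =
      p.+1%:R * bet p.+1 * (M (q.+1 + j)%N / j`!%:R * a ^+ (j - p)).
    have -> : a ^+ j.+1 = a ^+ (j - p) * a ^+ p.+1 by rewrite -exprD addnS subnK.
    have : a ^+ p.+1 != 0 by rewrite expf_neq0// gt_eqF.
    set u := a ^+ p.+1; set v := a ^+ (j - p); set z := M _ / _; set b := bet _; set N := _%:R => u0.
    by clearbody u v z b N; field.
  rewrite ler_wpM2l ?mulr_ge0 ?ler0n// ler_wpM2r ?exprn_ge0 ?(ltW a0)//.
  by apply: Mle; exact: leq_subr.
rewrite -mulr_sumr addSnnS factS natrM invfM.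
have -> : j.+1%:R * (M (q + j.+1)%N * a ^+ j.+1 * (j.+1%:R^-1 / j`!%:R)) = M (q + j.+1)%N / j`!%:R * a ^+ j.+1.
  move: (M _) (a ^+ _) ((j`!%:R)^-1) => x y z; move: j0; set N := j.+1%:R => N0.
  by clearbody N; field; rewrite gt_eqF.
rewrite ler_piMr ?hbet// mulr_ge0 ?exprn_ge0 ?(ltW a0)// divr_ge0//.
Qed.

Lemma composition_derivatives (mu bet : nat -> R) (M0 a : R) (L : set 'rV[R]_n.+1)
    (f : 'rV[R]_n.+1 -> R) (C : 'I_n.+1 -> {poly R}) :
  mu_smooth mu M0 L f -> 0 < M0 -> (forall j, (1 <= j)%N -> j%:R <= mu j) -> 0 < a ->
  (forall s, 0 <= s <= 1 -> L (\row_k (C k).[s])) ->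
  (forall k p s, 0 <= s <= 1 -> `|((C k)^`N(p.+1)).[s]| <= bet p.+1) ->
  (forall q, \sum_(p < q) p.+1%:R * bet p.+1 / a ^+ p.+1 <= 1) ->
  exists G : nat -> R -> R, [/\ derivative_chain G,
    forall s, G 0%N s = f (\row_k (C k).[s]) &
    forall j s, 0 <= s <= 1 -> `|G j s| <= Mseq (fun i => a * mu i) M0 j].
Proof.
move=> smooth M00 muj a0 CL Cb hbet.
have [[U [oU LU Cf]] _] := smooth.
pose gam s : 'rV[R]_n.+1 := \row_k (C k).[s].
pose Phi w s := partials w f (gam s).
pose c k p s := ((C k)^`N(p)).[s].
have [d [d0 dS]] := ex_normalized_derivatives (index_enum 'I_n.+1) Phi c.
have dd := @is_derive_normalized R _ (index_enum 'I_n.+1) Phi c d d0 dS `[0, 1]%classic.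
exists (fun j s => j`!%:R * d j [::] s); split.
- move=> j s s01; rewrite /= factS natrM.
  have H : is_derive s 1 (d j [::]) (j.+1%:R * d j.+1 [::] s).
    apply: dd; last by rewrite /= in_itv.
      move=> w t; rewrite /= in_itv /= => t01; have Ut := LU _ (CL t t01).
      have [r /= r0 hr] : nbhs_ball (gam t) U by apply/nbhs_ballP; exact: open_nbhs_nbhs.
      have hU y : `|y - gam t| < r -> U y by move=> yr; apply: hr; rewrite -ball_normE /= distrC.
      have := @is_derive_comp_curve R n (partials w f) C t r r0
        (fun i y yr => (Cf w y (hU y yr)).2 i) (fun i => (Cf (i :: w) _ Ut).1).
      move=> H; apply: is_derive_eq H _; apply: eq_bigr => k _.
      by rewrite /c poly.nderivn1 mulrC.
    move=> k p t; have := @is_derive_poly R ((C k)^`N(p)) t.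
    move=> H; apply: is_derive_eq H _.
    by rewrite /c deriv_nderivn hornerMn mulr_natl.
  apply: is_derive_eq (is_deriveZ j`!%:R H) _.
  by rewrite [LHS]mulrCA mulrA.
- by move=> s; rewrite d0 fact0 mul1r.
move=> j s s01.
have MseqS m : Mseq mu M0 m.+1 = Mseq mu M0 m * mu m.+1.
  by rewrite /Mseq big_nat_recr//= mulrA.
have Mseq0 m : 0 <= Mseq mu M0 m.
  elim: m => [|m IH]; first by rewrite /Mseq big_geq// mulr1 ltW.
  by rewrite MseqS mulr_ge0// (le_trans _ (muj m.+1 isT)).
have hw := @normalized_derivative_bound (fun w => Phi w s) (fun k p => c k p s)
  (fun j w => d j w s) (Mseq mu M0) mu bet a (fun w => d0 w s) (fun j w => dS j w s)
  (fun m => mu_smooth_wsum m oU LU Cf smooth (CL s s01)) Mseq0 MseqS (fun m => muj m.+1 isT)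
  (fun k p => Cb k p s s01) a0 hbet j 0%N.
rewrite normrM ger0_norm ?ler0n//.
have -> : Mseq (fun i => a * mu i) M0 j = j`!%:R * (Mseq mu M0 j * a ^+ j / j`!%:R).
  rewrite mulrC divfK ?pnatr_eq0 -?lt0n ?fact_gt0// /Mseq big_split /= prodr_const_nat subSS subn0.
  by rewrite mulrCA mulrC.
by rewrite ler_wpM2l.
Qed.

End composition.

(** * Products and sums attached to the nodes j^2 *)

Section square_nodes.
Context {R : realType}.

Let fact_pred m : (0 < m)%N -> m`! = (m * (m.-1)`!)%N.
Proof. by case: m => // m _; rewrite factS. Qed.

Lemma prod_sqr_dist_lt (i d : nat) : (d < i)%N ->
  (i * (i - d.+1)`! * \prod_(1 <= j < d.+1) (i ^ 2 - j ^ 2) = (i + d)`!)%N.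
Proof.
elim: d => [|d IH] di.
  by rewrite big_geq// muln1 addn0 subn1; case: i di => // i _; rewrite factS.
rewrite big_nat_recr//= subn_sqr.
have E : (i - d.+1)`! = ((i - d.+1) * (i - d.+2)`!)%N.
  by rewrite fact_pred ?subn_gt0// -subnS.
rewrite addnS factS -IH ?E; last exact: ltnW.
by rewrite -addnS; ring.
Qed.

Lemma prod_sqr_dist_ge (i m : nat) : (0 < i)%N ->
  (2 * i ^ 2 * \prod_(1 <= j < (i + m).+1 | j != i) (i ^ 2 - j ^ 2 + (j ^ 2 - i ^ 2)) =
   m`! * (2 * i + m)`!)%N.
Proof.
move=> i0; elim: m => [|m IH].
  rewrite addn0 fact0 mul1n addn0 big_mkcond big_nat_recr//= eqxx /= muln1.
  have -> : (\prod_(1 <= j < i) (if j != i then i ^ 2 - j ^ 2 + (j ^ 2 - i ^ 2) else 1) =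
      \prod_(1 <= j < i.-1.+1) (i ^ 2 - j ^ 2))%N.
    rewrite prednK//; apply: eq_big_nat => j /andP[_ ji].
    by rewrite ltn_eqF//= [X in (_ + X)%N](_ : _ = 0%N) ?addn0//; apply/eqP; rewrite subn_eq0 leq_exp2r// ltnW.
  have i1 : (i.-1 < i)%N by rewrite prednK.
  have := prod_sqr_dist_lt i1; rewrite prednK// subnn fact0 muln1 => E.
  have -> : (2 * i)`! = (2 * i * (i + i.-1)`!)%N.
    rewrite fact_pred ?muln_gt0//; congr (_ * _`!)%N.
    by rewrite mul2n -addnn; case: (i) i0 => // k _; rewrite addSn addnS.
  rewrite -E expnS expn1; ring.
rewrite addnS big_mkcond big_nat_recr//= -big_mkcond /= ifT; last by rewrite gtn_eqF// ltnS leq_addr.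
rewrite mulnA IH.
have -> : (i ^ 2 - (i + m).+1 ^ 2 = 0)%N by apply/eqP; rewrite subn_eq0 leq_exp2r// -addnS leq_addr.
rewrite add0n subn_sqr -[(i + m).+1]addnS addKn [(2 * i + m.+1)%N]addnS !factS.
have -> : (i + m.+1 + i = (2 * i + m).+1)%N by rewrite addnAC addnn mul2n addnS.
ring.
Qed.

Lemma fact_sqr_le (d i : nat) : (i <= d)%N -> (d`! ^ 2 <= (d - i)`! * (d + i)`!)%N.
Proof.
elim: i => [|i IH] id; first by rewrite subn0 addn0.
apply: (leq_trans (IH (ltnW id))); rewrite addnS factS.
have E : (d - i)`! = ((d - i) * (d - i.+1)`!)%N.
  by rewrite fact_pred ?subn_gt0// -subnS.
rewrite E -mulnA mulnCA leq_mul2l; apply/orP; right.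
by rewrite leq_mul2r (leq_trans (leq_subr _ _))// ?orbT// leqW ?leq_addr.
Qed.

(** The product equals 2 (d!)^2 / ((d-i)! (d+i)!). *)
Lemma prod_square_ratio_le2 (d i : nat) : (0 < i)%N -> (i <= d)%N ->
  \prod_(1 <= j < d.+1 | j != i) (j%:R ^+ 2 / `|i%:R ^+ 2 - j%:R ^+ 2|) <= 2 :> R.
Proof.
move=> i0 id.
have distE j : `|i%:R ^+ 2 - j%:R ^+ 2| = (i ^ 2 - j ^ 2 + (j ^ 2 - i ^ 2))%:R :> R.
  rewrite -!natrX; have [le|/ltnW le] := leqP (j ^ 2) (i ^ 2).
    by rewrite (eqP (_ : (j ^ 2 - i ^ 2 == 0)%N)) ?subn_eq0// addn0 natrB// ger0_norm// subr_ge0 ler_nat.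
  by rewrite (eqP (_ : (i ^ 2 - j ^ 2 == 0)%N)) ?subn_eq0// add0n natrB// distrC ger0_norm// subr_ge0 ler_nat.
under eq_bigr do rewrite distE -natrX.
rewrite prodf_div -!natr_prod.
set A := (\prod_(1 <= j < d.+1 | j != i) j ^ 2)%N; set T := (\prod_(1 <= j < d.+1 | j != i) _)%N.
have iA : (i ^ 2 * A = d`! ^ 2)%N.
  rewrite fact_prod -[RHS]mulnn -big_split [RHS](bigD1_seq i) ?iota_uniq//= ?mem_index_iota ?i0 ?ltnS ?id//.
have iT : (2 * i ^ 2 * T = (d - i)`! * (d + i)`!)%N.
  have := prod_sqr_dist_ge (d - i) i0; rewrite subnKC// => ->; congr (_ * _`!)%N.
  by rewrite mul2n -addnn -addnA subnKC// addnC.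
have T0 : (0 < T)%N.
  have : (0 < 2 * i ^ 2 * T)%N by rewrite iT muln_gt0 !fact_gt0.
  by rewrite muln_gt0 => /andP[].
rewrite ler_pdivrMr ?ltr0n// -natrM ler_nat.
have i20 : (0 < i ^ 2)%N by rewrite expn_gt0 i0.
by rewrite -(leq_pmul2l i20) iA mulnA [(i ^ 2 * 2)%N]mulnC iT fact_sqr_le.
Qed.

Lemma sum_inv_sqr_le (d : nat) : \sum_(1 <= i < d.+1) (i%:R ^+ 2)^-1 <= 2 :> R.
Proof.
case: d => [|d]; first by rewrite big_geq.
suff : \sum_(1 <= i < d.+2) (i%:R ^+ 2)^-1 <= 2 - d.+1%:R^-1 :> R.
  by move/le_trans; apply; rewrite gerBl invr_ge0.
elim: d => [|d IH]; first by rewrite big_nat1 expr1n invr1; lra.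
rewrite big_nat_recr//=; apply: (le_trans (lerD IH (lexx _))).
have x0 : 0 < d.+1%:R :> R by rewrite ltr0n.
rewrite -[d.+2%:R]natr1; move: x0; set x := d.+1%:R => x0.
rewrite -lerBrDl -subr_ge0.
have -> : 2 - (x + 1)^-1 - (2 - x^-1) - ((x + 1) ^+ 2)^-1 = (x * (x + 1) ^+ 2)^-1.
  by clearbody x; field; rewrite !gt_eqF//; lra.
by rewrite invr_ge0 mulr_ge0 ?sqr_ge0// ltW.
Qed.

Lemma prod_one_plus_le2 (d : nat) (rho : R) : 0 <= rho -> rho <= 1 / 4 ->
  \prod_(1 <= j < d.+1) (1 + rho / j%:R ^+ 2) <= 2.
Proof.
move=> r0 r1; apply: (@le_trans _ _ (expR (2^-1))).
  apply: (@le_trans _ _ (\prod_(1 <= j < d.+1) expR (rho / j%:R ^+ 2))).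
    rewrite !big_nat; apply: ler_prod => j _; rewrite expR_ge1Dx andbT.
    by rewrite addr_ge0// divr_ge0// sqr_ge0.
  rewrite -expR_sum ler_expR -mulr_sumr.
  apply: (@le_trans _ _ (1 / 4 * 2)); last by lra.
  by apply: ler_pM => //; [apply: sumr_ge0 => j _; rewrite invr_ge0 sqr_ge0|exact: sum_inv_sqr_le].
have h : expR (2^-1) ^+ 2 <= 2 ^+ 2 :> R.
  by rewrite -expRM_natl mulfV// expr2 -natrM; exact: expR1_le4.
by rewrite -(ler_pXn2r (_ : 0 < 2)%N) ?nnegrE ?expR_ge0.
Qed.

(** Links the constant in a_K with the d^2 of Markov's inequality. With k = d - 1 the ratio is
    (d+1)^2 (1 + 2/k)^k, and for k >= 2 the binomial expansion up to order two gives (1 + 2/k)^k >=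
    5 - 2/k >= 4. *)
Lemma pow_ratio_ge (d : nat) : (2 <= d)%N ->
  4 * d%:R ^+ 2 <= d.+1%:R ^+ d.+1 / d.-1%:R ^+ d.-1 :> R.
Proof.
case: d => // -[|[|m]] // _; first by rewrite expr1 divr1; lra.
set d := m.+3; set k := m.+2.
have binom (x : R) l : 0 <= x -> 1 + l%:R * x + l%:R * (l%:R - 1) / 2 * x ^+ 2 <= (1 + x) ^+ l.
  move=> x0; elim: l => [|l IH]; first by rewrite expr0; lra.
  have x10 : 0 <= 1 + x by lra.
  rewrite [leRHS]exprS; apply: le_trans (ler_wpM2l x10 IH).
  rewrite -natr1; have : 0 <= l%:R * (l%:R - 1) * x ^+ 3 :> R.
    case: l {IH} => [|l]; first by rewrite mul0r mul0r.
    by rewrite -{2}natr1 addrK !mulr_ge0 ?exprn_ge0.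
  by move: (l%:R : R) => z h; nra.
have k0 : 0 < k%:R :> R by rewrite ltr0n.
have k2 : 2 <= k%:R :> R by rewrite ler_nat.
have -> : d.+1%:R ^+ d.+1 / d.-1%:R ^+ d.-1 = d.+1%:R ^+ 2 * (1 + 2 / k%:R) ^+ k :> R.
  have -> : 1 + 2 / k%:R = d.+1%:R / k%:R :> R.
    have -> : d.+1%:R = k%:R + 2 :> R by rewrite -natrD addn2.
    by rewrite [RHS]mulrDl divff// gt_eqF.
  by rewrite expr_div_n mulrA -exprD.
have := binom (2 / k%:R) k; rewrite divr_ge0 ?(ltW k0)// => /(_ isT).
have -> : 1 + k%:R * (2 / k%:R) + k%:R * (k%:R - 1) / 2 * (2 / k%:R) ^+ 2 = 5 - 2 / k%:R :> R.
  by move: k0; set x := k%:R => x0; clearbody x; field; rewrite gt_eqF.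
have : 2 / k%:R <= 1 :> R by rewrite ler_pdivrMr ?mul1r.
set y := 2 / _; set z := (1 + y) ^+ k => h1 h2.
rewrite mulrC; apply: ler_pM => //; last by lra.
by rewrite !lerXn2r ?nnegrE ?ler_nat.
Qed.

End square_nodes.

(** * A Markov-type inequality for all Taylor coefficients *)

Section markov.
Context {R : realType}.

Lemma abs_coef_prod (I : Type) (r : seq I) (P : pred I) (x h : I -> R) :
  (forall j, `|x j| <= h j) -> forall p,
  `|(\prod_(j <- r | P j) ('X - (x j)%:P))`_p| <= (\prod_(j <- r | P j) ('X + (h j)%:P))`_p.
Proof.
move=> xh; apply: (big_ind2 (fun (A B : {poly R}) => forall p, `|A`_p| <= B`_p)).
- by move=> p; rewrite !coef1 normr_nat.
- move=> A B A' B' AB AB' p; rewrite !coefM; apply: (le_trans (ler_norm_sum _ _ _)).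
  by apply: ler_sum => i _; rewrite normrM ler_pM.
- move=> j _ p; rewrite coefB coefD coefX !coefC; case: p => [|[|p]] /=.
  + by rewrite sub0r add0r normrN.
  + by rewrite subr0 addr0 normr1.
  + by rewrite subr0 addr0 normr0.
Qed.

(** The factor j = 0 of the i-th product is rho / i^2. The others split into prod (1 + rho/j^2) and
    prod j^2/|i^2 - j^2|, each at most 2, and sum_i 1/i^2 <= 2. *)
Let nodes_bound (d : nat) (rho : R) : (0 < d)%N -> 0 <= rho -> rho <= 1 / 4 ->
  \sum_(i < d.+1 | i != ord0) \prod_(j < d.+1 | j != i)
    ((rho + j%:R ^+ 2) / `|i%:R ^+ 2 - j%:R ^+ 2|) <= 8 * rho.
Proof.
move=> d0 r0 r1.
apply: (@le_trans _ _ (\sum_(i < d.+1 | i != ord0) 4 * rho * (i%:R ^+ 2)^-1)); last first.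
  rewrite -mulr_sumr (_ : 8 * rho = 4 * rho * 2); last by ring.
  rewrite ler_wpM2l ?mulr_ge0//; apply: le_trans (sum_inv_sqr_le d).
  rewrite big_mkcond big_ord_recl /= add0r big_add1 /= big_mkord.
  by apply: ler_sum => i _.
apply: ler_sum => i i0; have {}i0 : (0 < i)%N by rewrite lt0n.
pose F (j : nat) := (rho + j%:R ^+ 2) / `|i%:R ^+ 2 - j%:R ^+ 2|.
have -> : \prod_(j < d.+1 | j != i) ((rho + j%:R ^+ 2) / `|i%:R ^+ 2 - j%:R ^+ 2|) =
    F 0%N * \prod_(1 <= j < d.+1 | j != i) F j.
  rewrite -(big_mkord (fun j => j != i) F) big_mkcond big_ltn//= ltn_eqF//.
  by rewrite -big_mkcond.
have F0 : F 0%N = rho * (i%:R ^+ 2)^-1.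
  by rewrite /F expr0n addr0 subr0 ger0_norm// sqr_ge0.
rewrite F0 [leRHS](_ : _ = rho * (i%:R ^+ 2)^-1 * (2 * 2)); last by ring.
rewrite ler_wpM2l ?mulr_ge0 ?invr_ge0 ?sqr_ge0//.
have FE j : (1 <= j)%N -> F j = (1 + rho / j%:R ^+ 2) * (j%:R ^+ 2 / `|i%:R ^+ 2 - j%:R ^+ 2|).
  move=> j1; have j0 : j%:R ^+ 2 != 0 :> R by rewrite expf_neq0// pnatr_eq0 -lt0n.
  by rewrite /F mulrA; congr (_ / _); rewrite mulrDl mul1r divfK// addrC.
rewrite big_nat_cond (eq_bigr (fun j => (1 + rho / j%:R ^+ 2) * (j%:R ^+ 2 / `|i%:R ^+ 2 - j%:R ^+ 2|))); last first.
  by move=> j /andP[/andP[j1 _] _]; exact: FE.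
rewrite -big_nat_cond big_split /=; apply: ler_pM.
- by apply: prodr_ge0 => j _; rewrite addr_ge0// divr_ge0// sqr_ge0.
- by apply: prodr_ge0 => j _; rewrite divr_ge0// sqr_ge0.
- apply: le_trans (prod_one_plus_le2 d r0 r1); rewrite [leRHS](bigID (fun j : nat => j != i)) /=.
  apply: ler_peMr; first by apply: prodr_ge0 => j _; rewrite addr_ge0// divr_ge0// sqr_ge0.
  apply: (big_ind (fun y : R => 1 <= y)) => // [y z|j _]; first exact: mulr_ege1.
  by rewrite lerDl divr_ge0// sqr_ge0.
- by apply: prod_square_ratio_le2 => //; rewrite -ltnS.
Qed.

(* Interpolation at the nodes s +- i^2/(2 d^2), which cluster at s, gives the
   order d^2 of Markov's inequality. *)
Lemma taylor_coefficients_bound (d : nat) : (2 <= d)%N ->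
  exists B : {poly R}, [/\ forall p, 0 <= B`_p,
    forall rho, 0 <= rho -> 2 * d%:R ^+ 2 * rho <= 1 / 4 -> B.[rho] <= 16 * d%:R ^+ 2 * rho &
    forall (C : {poly R}) (Delta s : R) (p : nat), (size C <= d.+1)%N -> 0 <= s <= 1 ->
      (forall t, 0 <= t <= 1 -> `|C.[t] - C.[s]| <= Delta) ->
      `|(C^`N(p.+1)).[s]| <= Delta * B`_p.+1].
Proof.
move=> d2; have d0 : 0 < d%:R :> R by rewrite ltr0n (leq_trans _ d2).
pose th : R := (2 * d%:R ^+ 2)^-1.
have th0 : 0 < th by rewrite invr_gt0 mulr_gt0// exprn_gt0.
pose Bi (i : 'I_d.+1) : {poly R} := \prod_(j < d.+1 | j != i) ('X + (th * j%:R ^+ 2)%:P).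
pose ka (i : 'I_d.+1) : R := (\prod_(j < d.+1 | j != i) (th * `|i%:R ^+ 2 - j%:R ^+ 2|))^-1.
have ka0 i : 0 <= ka i by rewrite invr_ge0; apply: prodr_ge0 => j _; rewrite mulr_ge0// ltW.
have Bi0 i p : 0 <= (Bi i)`_p.
  apply: le_trans (normr_ge0 _) (@abs_coef_prod _ _ _ (fun j : 'I_d.+1 => th * j%:R ^+ 2) _ _ p).
  by move=> j; rewrite ger0_norm// mulr_ge0 ?(ltW th0)// sqr_ge0.
exists (\sum_(i < d.+1 | i != ord0) ka i *: Bi i); split.
- by move=> p; rewrite coef_sum; apply: sumr_ge0 => i _; rewrite coefZ mulr_ge0.
- move=> rho r0 r1; rewrite horner_sum.
  have -> : 16 * d%:R ^+ 2 * rho = 8 * (2 * d%:R ^+ 2 * rho) by ring.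
  apply: le_trans (nodes_bound (leq_trans _ d2) (_ : 0 <= 2 * d%:R ^+ 2 * rho) r1) => //; last first.
    by rewrite !mulr_ge0// sqr_ge0.
  apply: ler_sum => i _; rewrite hornerZ /Bi horner_prod /ka -prodfV -big_split /=.
  rewrite le_eqVlt; apply/orP; left; apply/eqP; apply: eq_bigr => j _.
  have -> : 2 * d%:R ^+ 2 = th^-1 by rewrite invrK.
  by rewrite hornerD hornerX hornerC invfM mulrAC mulrDr mulKf ?gt_eqF.
move=> C Delta s p szC s01 hC.
(* The nodes go from s towards the farther end of [0, 1]; as th d^2 = 1/2, they stay inside. *)
have [sg sgE seg] : exists2 sg : R, `|sg| = th & forall i, (i <= d)%N -> 0 <= s + sg * i%:R ^+ 2 <= 1.
  have thi i : (i <= d)%N -> 0 <= th * i%:R ^+ 2 <= 2^-1.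
    move=> id; rewrite mulr_ge0 ?(ltW th0) ?sqr_ge0//= /th invfM -mulrA ler_piMr//.
    rewrite mulrC ler_pdivrMr ?exprn_gt0// mul1r lerXn2r ?nnegrE//.
    by rewrite ler_nat.
  have [s2|s2] := leP s (2^-1).
    exists th; first by rewrite gtr0_norm.
    by move=> i /thi /andP[? ?]; apply/andP; split; lra.
  exists (- th); first by rewrite normrN gtr0_norm.
  by move=> i /thi /andP[? ?]; rewrite mulNr; apply/andP; split; lra.
have sg0 : sg != 0 by rewrite -normr_gt0 sgE.
pose W : {poly R} := \poly_(i < d.+1) (C^`N(i)).[s] - (C.[s])%:P.
have WE t : W.[t] = C.[s + t] - C.[s].
  rewrite /W !hornerE horner_poly; congr (_ - _).
  by rewrite (nderiv_taylor_wide (mulrC s t) szC).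
have Wp : (C^`N(p.+1)).[s] = W`_p.+1.
  rewrite /W coefB coefC subr0 coef_poly; case: ltnP => // dp.
  have -> : C^`N(p.+1) = 0; last by rewrite horner0.
  apply/polyP => k; rewrite coef_nderivn coef0 nth_default ?mul0rn//.
  by rewrite (leq_trans szC)// (leq_trans dp)// leq_addr.
pose x (i : nat) : R := sg * i%:R ^+ 2.
have xinj : injective x.
  move=> i j /(mulfI sg0) /eqP; rewrite -!natrX eqr_nat eqn_exp2r// => /eqP; exact.
have szW : (size W <= d.+1)%N.
  apply: (leq_trans (size_polyD _ _)); rewrite geq_max size_poly size_polyN.
  exact: (leq_trans (size_polyC_leq1 _)).
rewrite Wp (lagrange_gen (ltn0Sn d) xinj szW) coef_sum coef_sum mulr_sumr.
(* The node i = 0 is s itself, where W(t) = C(s + t) - C(s) vanishes; this is why the majorant omits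
   it. *)
rewrite (bigD1 ord0)//= {1}WE /x expr0n mulr0 addr0 subrr mul0r coef0 add0r.
apply: (le_trans (ler_norm_sum _ _ _)); apply: ler_sum => i i0.
rewrite lagrangeE ?xinj// coefCM coefCM coefZ !normrM mulrA [leRHS]mulrA.
apply: ler_pM => //; last first.
  by apply: abs_coef_prod => j; rewrite /x normrM sgE ger0_norm// sqr_ge0.
apply: ler_pM => //.
  by rewrite WE; apply: hC; apply: seg; rewrite -ltnS.
rewrite horner_prod normfV normr_prod /ka le_eqVlt; apply/orP; left; apply/eqP; congr (_^-1).
by apply: eq_bigr => j _; rewrite hornerXsubC -mulrBr normrM sgE.
Qed.

End markov.

Section polynomial_curve.
Context {R : realType} {n : nat}.

(** For d >= 2, the bound p + 1 <= 2^p turns the sum into (Delta/2) B(2/a) <= 16 d^2 Delta / a <= 1;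
    the maximum with 1 in a keeps 2/a in the range where B is controlled. For d = 1 the only
    coefficient is C(1) - C(0), so a = Delta suffices. *)
Lemma ex_taylor_majorant (d : nat) (Delta a : R) : (1 <= d)%N -> 0 < Delta ->
  a = (if (d <= 1)%N then Delta
       else 4 * (d.+1%:R ^+ d.+1 / d.-1%:R ^+ d.-1) * Num.max Delta 1) ->
  exists bet : nat -> R, (forall q, \sum_(p < q) p.+1%:R * bet p.+1 / a ^+ p.+1 <= 1) /\
    forall (C : {poly R}) (s : R) (p : nat), (size C <= d.+1)%N -> 0 <= s <= 1 ->
      (forall t u, 0 <= t <= 1 -> 0 <= u <= 1 -> `|C.[t] - C.[u]| <= Delta) ->
      `|(C^`N(p.+1)).[s]| <= bet p.+1.
Proof.
move=> d1 Delta0; case: leqP => [d_le1|d2] aE.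
  have -> : d = 1%N by apply/eqP; rewrite eqn_leq d_le1.
  exists (fun p => if p == 1%N then Delta else 0); split => [[|q]|C s p szC s01 hC].
  - by rewrite big_ord0.
  - rewrite big_ord_recl big1 => [|p _]; last by rewrite /= mulr0 mul0r.
    by rewrite /= mul1r expr1 addr0 aE divff// gt_eqF.
  case: p => [|p] /=; last by rewrite nderivn_poly0 ?horner0 ?normr0// (leq_trans szC).
  have CE t : C.[t] = C`_0 + C`_1 * t.
    by rewrite (horner_coef_wide _ szC) !big_ord_recl big_ord0 expr0 mulr1 expr1 addr0.
  rewrite poly.nderivn1; have -> : C^`().[s] = C.[1] - C.[0].
    rewrite !CE mulr0 mulr1 addr0 addrC addKr.
    have szd : (size C^`() <= 1)%N.
      by apply: (leq_trans (size_poly _ _)); case: (size C) szC.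
    by rewrite (horner_coef_wide _ szd) big_ord1 expr0 mulr1 coef_deriv.
  by apply: hC; rewrite ?lexx ?ler01.
have [B [B0 Brho hB]] := @taylor_coefficients_bound R d d2.
have d0 : 0 < d%:R ^+ 2 :> R by rewrite exprn_gt0// ltr0n.
set m := Num.max Delta 1 in aE.
have m1 : 1 <= m by rewrite le_max lexx orbT.
have mD : Delta <= m by rewrite le_max lexx.
have ale : 16 * d%:R ^+ 2 * m <= a.
  by rewrite aE; have := @pow_ratio_ge R d d2; set z := _ / _ => h; apply: ler_wpM2r; lra.
have a0 : 0 < a.
  by apply: lt_le_trans ale; apply: mulr_gt0; [exact: mulr_gt0|lra].
have rho0 : 0 <= 2 / a by rewrite divr_ge0// ltW.
have rho1 : 2 * d%:R ^+ 2 * (2 / a) * (4 * m) <= 1.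
  rewrite [leLHS](_ : _ = 16 * d%:R ^+ 2 * m / a); last by ring.
  by rewrite ler_pdivrMr// mul1r.
exists (fun p => Delta * B`_p); split => [q|C s p szC s01 hC]; last first.
  by apply: hB => // t t01; exact: hC.
have p2 (p : nat) : p.+1%:R <= 2 ^+ p :> R by rewrite -natrX ler_nat ltn_expl.
apply: (@le_trans _ _ (Delta / 2 * \sum_(p < q) B`_p.+1 * (2 / a) ^+ p.+1)).
  rewrite mulr_sumr; apply: ler_sum => p _.
  rewrite expr_div_n [2 ^+ p.+1]exprS [leRHS](_ : _ = 2 ^+ p * (Delta * B`_p.+1) / a ^+ p.+1).
    apply: ler_wpM2r; first by rewrite invr_ge0 exprn_ge0// ltW.
    by apply: ler_wpM2r => //; apply: mulr_ge0 => //; exact: ltW.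
  by move: (2 ^+ p) ((a ^+ p.+1)^-1) => x y; field.
have sumB : \sum_(p < q) B`_p.+1 * (2 / a) ^+ p.+1 <= B.[2 / a].
  rewrite (@horner_coef_wide _ (maxn q (size B)).+1); last by rewrite leqW// leq_maxr.
  rewrite big_ord_recl; apply: ler_wpDl; first by rewrite mulr_ge0// exprn_ge0.
  rewrite /= -(big_mkord xpredT (fun p => B`_p.+1 * (2 / a) ^+ p.+1)).
  rewrite -(big_mkord xpredT (fun p => B`_p.+1 * (2 / a) ^+ p.+1)).
  rewrite [leRHS](@big_cat_nat _ _ _ q)//= ?leq_maxl//.
  by rewrite lerDl; apply: sumr_ge0 => p _; rewrite mulr_ge0// exprn_ge0.
have x0 : 0 <= 2 * d%:R ^+ 2 * (2 / a).
  by apply: mulr_ge0 => //; apply: mulr_ge0 => //; exact: ltW.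
have h4 : 2 * d%:R ^+ 2 * (2 / a) <= 1 / 4.
  have : 2 * d%:R ^+ 2 * (2 / a) * 4 <= 2 * d%:R ^+ 2 * (2 / a) * (4 * m).
    by apply: ler_wpM2l => //; lra.
  by move: rho1; set x := 2 * _ * (2 / a); lra.
have hBr := le_trans sumB (Brho _ rho0 h4).
have D20 : 0 <= Delta / 2 by rewrite divr_ge0// ltW.
apply: (le_trans (ler_wpM2l D20 hBr)).
apply: le_trans rho1; rewrite [leLHS](_ : _ = 2 * d%:R ^+ 2 * (2 / a) * (4 * Delta)); last by move: (2 / a) => x; field.
by apply: ler_wpM2l => //; apply: ler_wpM2l.
Qed.

Lemma polynomial_curve_derivatives (mu : nat -> R) (M0 Delta a : R) (d : nat)
    (L : set 'rV[R]_n.+1) (f : 'rV[R]_n.+1 -> R) (C : 'I_n.+1 -> {poly R}) :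
  mu_smooth mu M0 L f -> 0 < M0 -> (forall j, (1 <= j)%N -> j%:R <= mu j) ->
  (1 <= d)%N -> 0 < Delta ->
  a = (if (d <= 1)%N then Delta
       else 4 * (d.+1%:R ^+ d.+1 / d.-1%:R ^+ d.-1) * Num.max Delta 1) ->
  (forall k, (size (C k) <= d.+1)%N) ->
  (forall s, 0 <= s <= 1 -> L (\row_k (C k).[s])) ->
  (forall k t u, 0 <= t <= 1 -> 0 <= u <= 1 -> `|(C k).[t] - (C k).[u]| <= Delta) ->
  exists G : nat -> R -> R, [/\ derivative_chain G,
    forall s, G 0%N s = f (\row_k (C k).[s]) &
    forall j s, 0 <= s <= 1 -> `|G j s| <= Mseq (fun i => a * mu i) M0 j].
Proof.
move=> smooth M00 muj d1 Delta0 aE szC CL osc.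
have [bet [hbet Cb]] := ex_taylor_majorant d1 Delta0 aE.
apply: (composition_derivatives smooth M00 muj (bet := bet)) => //.
- rewrite aE; case: leqP => // d2; apply: mulr_gt0; last by rewrite lt_max ltr01 orbT.
  apply: mulr_gt0 => //; apply: divr_gt0; rewrite exprn_gt0// ltr0n//.
  by rewrite -subn1 subn_gt0.
- by move=> k p s s01; apply: Cb => //; exact: osc.
Qed.

End polynomial_curve.

(** * The Remez inequality on admissible sets *)

Section curves.
Context {R : realType} {n : nat}.
Implicit Types (K E L : set 'rV[R]_n.+1) (w x y : 'rV[R]_n.+1).

Lemma coord_le_enorm x i : `|x 0 i| <= enorm x.
Proof.
rewrite /enorm -sqrtr_sqr ler_sqrt; last by apply: sumr_ge0 => j _; exact: sqr_ge0.
by rewrite (bigD1 i)//= lerDl sumr_ge0// => j _; exact: sqr_ge0.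
Qed.

Lemma coord_le_diam K x y i : compact K -> K x -> K y -> `|x 0 i - y 0 i| <= diam K.
Proof.
move=> cK Kx Ky; apply: (@le_trans _ _ (enorm (x - y))).
  by have := coord_le_enorm (x - y) i; rewrite !mxE.
have [M [_ hM]] := compact_bounded cK.
have hr z : K z -> `|z| <= `|M| + 1 by apply: hM; rewrite (le_lt_trans (ler_norm M))// ltrDl.
apply: ub_le_sup; last by exists x, y.
exists (Num.sqrt (\sum_(i < n.+1) (`|M| + 1 + (`|M| + 1)) ^+ 2)) => _ [u [v [Ku Kv ->]]].
rewrite /enorm ler_sqrt; last by apply: sumr_ge0 => j _; exact: sqr_ge0.
apply: ler_sum => j _; rewrite -ler_sqrt ?sqr_ge0// !sqrtr_sqr.
rewrite [leRHS]ger0_norm ?addr_ge0// !mxE; apply: (le_trans (ler_normB _ _)).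
by apply: lerD; apply: le_trans (coord_le_norm _ _) (hr _ _).
Qed.

Lemma diam_gt0 K w : compact K -> K w -> (0 < lebesgue_rV K)%E -> 0 < diam K.
Proof.
move=> cK Kw; apply: contraTT; rewrite -leNgt -leNgt => d0.
have KB : K `<=` box w w.
  move=> x Kx i; have := le_trans (coord_le_diam i cK Kx Kw) d0.
  by rewrite normr_le0 subr_eq0 => /eqP ->; rewrite lexx.
apply: (le_trans (lebesgue_rV_box KB)); rewrite lee_fin /box_volume (bigD1 ord0)//=.
by rewrite subrr maxxx mul0r.
Qed.

(** The curve may leave K as long as it stays in L and its coordinates oscillate by at most the
    diameter of K; this admits segments between points of K. *)
Lemma remez_along_curve (d : nat) K L E w f (mu : nat -> R) (mut : R -> R)
    (M0 b0 m eps : R) (C : 'I_n.+1 -> {poly R}) (N : nat) :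
  N = (2 * bang_degree (fun j => (aK d K * mu j)%R) (b0 / M0)%R)%N ->
  (1 <= d)%N -> compact K -> K w -> (0 < lebesgue_rV K)%E ->
  0 < mu 1%N -> (forall i j, (1 <= i)%N -> (i <= j)%N -> mu i <= mu j) ->
  (forall j, (1 <= j)%N -> j%:R <= mu j) ->
  (\sum_(1 <= j <oo) ((mu j)^-1)%:E = +oo)%E -> interpolant mu mut ->
  0 < b0 -> b0 < M0 -> mu_smooth mu M0 L f -> b0 <= `|f w| ->
  \row_k (C k).[0] = w -> (forall k, (size (C k) <= d.+1)%N) ->
  (forall s, 0 <= s <= 1 -> L (\row_k (C k).[s])) ->
  (forall k t u, 0 <= t <= 1 -> 0 <= u <= 1 -> `|(C k).[t] - (C k).[u]| <= diam K) ->
  let F := `[0, 1]%classic `&` [set s | E (\row_k (C k).[s])] in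
  measurable F -> 0 < m -> (m%:E <= lebesgue_measure F)%E ->
  (forall x, E x -> `|f x| <= eps) ->
  `|f w| * m ^+ N <= C_ mut N * eps.
Proof.
move=> NE d1 cK Kw K0 mu1 mu_homo muj div mutP b00 b0M smooth bf C0 szC CL osc F mF m0 mF' Eeps.
have D0 := diam_gt0 cK Kw K0.
have M00 : 0 < M0 by lra.
have [G [Gd G0 GM]] := polynomial_curve_derivatives smooth M00 muj d1 D0 (erefl _) szC CL osc.
have a0 : 0 < aK d K.
  rewrite /aK; case: leqP => // d2; apply: mulr_gt0; last by rewrite lt_max ltr01 orbT.
  apply: mulr_gt0 => //; apply: divr_gt0; rewrite exprn_gt0// ltr0n//.
  by rewrite -subn1 subn_gt0.
have Gw : G 0%N 0 = f w by rewrite G0 C0.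
rewrite -Gw; apply: (@remez_quasianalytic R mu mut M0 (aK d K) b0 m eps G F N) => //.
- by rewrite Gw.
- by move=> s [].
- by move=> s [_ Es]; rewrite G0; exact: Eeps.
Qed.

Lemma bernoulli (t : R) (N : nat) : 0 <= t <= 1 -> 1 - N%:R * t <= (1 - t) ^+ N.
Proof.
move=> /andP[t0 t1]; elim: N => [|N IH]; first by rewrite mul0r subr0 expr0.
have u0 : 0 <= 1 - t by lra.
rewrite exprS; apply: le_trans (ler_wpM2l u0 IH); rewrite -natr1.
have h : 0 <= N%:R * (t * t) :> R by apply: mulr_ge0 => //; exact: mulr_ge0.
lra.
Qed.

(** Apply e^u >= 1 + u at u = nu ln lam, then - ln lam <= 1/lam - 1. *)
Lemma one_sub_powR_le (lam nu : R) : 0 < lam -> 0 <= nu -> 1 - lam `^ nu <= nu * (lam^-1 - 1).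
Proof.
move=> lam0 nu0; rewrite /powR gt_eqF//.
have h1 := expR_ge1Dx (nu * ln lam).
have h2 : - ln lam <= lam^-1 - 1.
  rewrite -lnV ?posrE//; have := @le_ln1Dx R (lam^-1 - 1); rewrite [1 + _]addrC subrK; apply.
  have := lam0; rewrite -invr_gt0; lra.
have := ler_wpM2l nu0 h2; rewrite mulrN; lra.
Qed.

Lemma convex_set_segment L x y (s : R) :
  convex_set L -> L x -> L y -> 0 <= s <= 1 -> L (x + s *: (y - x)).
Proof.
move=> convL Lx Ly /andP[s0 s1].
have := convL y x (Itv01 s0 s1); rewrite !inE => /(_ Ly Lx).
suff -> : x + s *: (y - x) = conv (Itv01 s0 s1) (y : convex_lmodType 'rV[R]_n.+1) x by [].
change (x + s *: (y - x) = s *: y + (1 - s) *: x).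
by rewrite scalerBr scalerBl scale1r addrCA.
Qed.

End curves.

Theorem theorem1p1 (R : realType) (n d : nat) (K : set 'rV[R]_n) :
  (0 < n)%N -> admissible d K ->
  exists nu : R, 0 < nu <= 1 /\
  forall (mu : nat -> R) (mut : R -> R) (M0 : R) (L : set 'rV[R]_n),
    0 < mu 1%N ->
    (forall i j : nat, (1 <= i)%N -> (i <= j)%N -> mu i <= mu j) ->
    (forall j : nat, (1 <= j)%N -> j%:R <= mu j) ->
    (\sum_(1 <= j <oo) ((mu j)^-1)%:E = +oo)%E ->
    interpolant mu mut ->
    0 < M0 ->
    convex_body L -> K `<=` L ->
  forall b0 : R, 0 < b0 -> b0 < M0 ->
  forall f : 'rV[R]_n -> R, mu_smooth mu M0 L f -> b0 <= supnorm K f ->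
  forall E : set 'rV[R]_n,
    lebesgue_measurable E -> E `<=` K -> (0 < lebesgue_rV E)%E ->
    let N := (2 * bang_degree (fun j => (aK d K * mu j)%R) (b0 / M0)%R)%N in
    supnorm K f <=
      C_ mut N *
      (vol K `^ nu / (vol K `^ nu - (vol K - vol E) `^ nu)) ^+ N *
      supnorm E f.
Proof.
case: n K => // n K _ adm.
have [d1 K0 cK _] := adm.
have [c c0 [p hcurve]] := admissible_curves adm.
have [M [_ hM]] := compact_bounded cK.
pose r := `|M| + 1.
have r0 : 0 < r by rewrite /r ltr_wpDl.
have hr x : K x -> `|x| <= r by apply: hM; rewrite (le_lt_trans (ler_norm M))// ltrDl.
pose rho := r + r.
have rho0 : 0 < rho by rewrite addr_gt0.
have hrho w x : K w -> K x -> `|x - w| <= rho.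
  by move=> Kw Kx; apply: (le_trans (ler_normB _ _)); apply: lerD; exact: hr.
have KB : K `<=` box (const_mx (- r)) (const_mx r).
  by move=> x Kx i; rewrite !mxE -ler_norml; apply: le_trans (coord_le_norm _ _) (hr x Kx).
have finK A : A `<=` K -> (lebesgue_rV A \is a fin_num)%E.
  move=> AK; rewrite ge0_fin_numE ?lebesgue_rV_ge0//.
  exact: le_lt_trans (lebesgue_rV_box (subset_trans AK KB)) (ltry _).
have volE A : A `<=` K -> lebesgue_rV A = (vol A)%:E by move=> AK; rewrite /vol fineK// finK.
have vol0 (A : set 'rV[R]_n.+1) : 0 <= vol A by rewrite /vol; apply: fine_ge0; exact: lebesgue_rV_ge0.
have [VK0|VKpos] := leP (vol K) 0.
  exists 1; rewrite ltr01 lexx; split => // mu mut M0 L _ _ _ _ _ _ _ _ b0 _ _ f _ _ E _ EK.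
  by rewrite ltNge (le_trans (le_lebesgue_rV EK))// volE.
set V := vol K in VKpos *.
(* A segment spends at least c' (1 - lam) of its time in E. The threshold lam0 is where V lam <= c
   sqrt(lam) ceases to hold, that is, where the curves of [admissible_curves] are no longer
   available. *)
pose c' := V / (4 * (16 * rho) ^+ n.+1).
have c'0 : 0 < c'.
  by apply: divr_gt0 => //; apply: mulr_gt0 => //; apply: exprn_gt0; exact: mulr_gt0.
pose lam0 := (c / V) ^+ 2.
have lam00 : 0 < lam0 by rewrite exprn_gt0// divr_gt0.
(* nu <= 1/(2 p) gives lam^(nu p) >= sqrt lam, and nu <= c' lam0 gives
   1 - lam^nu <= c' (1 - lam) for lam >= lam0. *)
pose nu := Num.min 1 (Num.min (1 / (2 * p.+1%:R)) (c' * lam0)).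
have nu0 : 0 < nu.
  rewrite !lt_min ltr01 (mulr_gt0 c'0 lam00) andbT /=; exact: divr_gt0.
exists nu; rewrite nu0 ge_min lexx; split => //.
have nu1 : nu * p%:R <= 1 / 2.
  have h : nu <= 1 / (2 * p.+1%:R) by rewrite !ge_min lexx !orbT.
  apply: (@le_trans _ _ (nu * p.+1%:R)); first by rewrite ler_wpM2l ?(ltW nu0)// ler_nat.
  by move: h; rewrite ler_pdivlMr ?mulr_gt0 ?ltr0n// mulrCA; lra.
have nu2 : nu <= c' * lam0 by rewrite !ge_min lexx !orbT.
move=> mu mut M0 L mu1 mu_homo muj div mutP M00 [_ convL _] KL b0 b00 b0M f smooth bK E mE EK E0 /=.
set N := (2 * _)%N.
have K0' : (0 < lebesgue_rV K)%E by rewrite volE// lte_fin.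
have cf : {within K, continuous (fun y => `|f y|)}.
  have [[U [oU LU Cf]] _] := smooth.
  apply: continuous_in_subspaceT => x; rewrite inE => Kx.
  have [h _] := Cf [::] x (LU x (KL x Kx)).
  by apply: continuous_comp => //; exact: norm_continuous.
have [w Kw fw] := @EVT_max_rV R n.+1 (fun x => `|f x|) K K0 cK cf.
rewrite inE in Kw; have {}fw x : K x -> `|f x| <= `|f w| by move=> Kx; apply: fw; rewrite inE.
have supK : supnorm K f = `|f w|.
  apply/eqP; rewrite eq_le; apply/andP; split.
    by apply: ge_sup => [|_ [x Kx <-]]; [exists `|f w|, w|exact: fw].
  by apply: ub_le_sup; [exists `|f w| => _ [x Kx <-]; exact: fw|exists w].
rewrite supK in bK *.
set eps := supnorm E f.
have fE x : E x -> `|f x| <= eps.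
  move=> Ex; apply: ub_le_sup; last by exists x.
  by exists `|f w| => _ [y Ey <-]; apply/fw/EK.
(* E is only Caratheodory measurable, and its trace on a curve need not be measurable; a Borel
   subset of the same measure replaces it. *)
have [E' [bE' E'E volE']] := lebesgue_rV_inner_borel mE (subset_trans EK KB).
have E'K : E' `<=` K by exact: subset_trans E'E EK.
have bK' : borel_rV K by apply: borel_rV_closed; exact: compact_closed.
pose lam := (V - vol E) / V.
have VE0 : 0 < vol E by move: E0; rewrite volE// lte_fin.
have VE' : vol E' = vol E by rewrite /vol volE'.
have VD : lebesgue_rV (K `\` E') = (V - vol E)%:E.
  have := lebesgue_rV_borelD bE' E'K; rewrite !volE// -EFinD => -[h].
  by congr (_%:E); rewrite /V h VE' addrAC subrr add0r.
have VE1 : 0 <= V - vol E by rewrite -lee_fin -VD lebesgue_rV_ge0.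
have lamge0 : 0 <= lam by rewrite divr_ge0// ltW.
have lam1 : lam < 1 by rewrite ltr_pdivrMr// mul1r ltrBlDr ltrDl.
have VlamE : V - vol E = V * lam by rewrite /lam mulrC divfK// gt_eqF.
pose x := lam `^ nu.
have x0 : 0 <= x by exact: powR_ge0.
have x1 : x < 1 by have /= <- := congr1 (@^~ nu) (powR1 R); apply: gt0_ltr_powR; rewrite ?nnegrE.
(* As |K| - |E| = V lam, the base of the N-th power in the claim is 1 / (1 - lam^nu). *)
suff main : `|f w| * (1 - x) ^+ N <= C_ mut N * eps.
  rewrite VlamE powRM ?(ltW VKpos)// -/x.
  have Vnu : 0 < V `^ nu by exact: powR_gt0.
  have -> : V `^ nu / (V `^ nu - V `^ nu * x) = (1 - x)^-1.
    by rewrite -{2}[V `^ nu]mulr1 -mulrBr invfM mulrA divff ?mul1r// gt_eqF.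
  rewrite exprVn mulrAC ler_pdivlMr// exprn_gt0// subr_gt0.
  by [].
have remez := @remez_along_curve R n d K L E' w f mu mut M0 b0 _ eps _ N (erefl _) d1 cK Kw K0'
  mu1 mu_homo muj div mutP b00 b0M smooth bK.
have E'eps y : E' y -> `|f y| <= eps by move=> /E'E; exact: fE.
have [lamle|lamgt] := leP lam lam0.
  have curve tau : 0 < tau -> tau < 1 -> V * lam <= c * tau ^+ p ->
      `|f w| * (1 - tau) ^+ N <= C_ mut N * eps.
    move=> t0 t1 hlam.
    have [|g [g0 gK gC hH]] := hcurve w (K `\` E') tau Kw (borel_rVD bK' bE') t0 (ltW t1).
      by rewrite VD VlamE lee_fin.
    have /choice[C hC] := gC.
    have gE s : 0 <= s <= 1 -> \row_k (C k).[s] = g s.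
      by move=> s01; apply/rowP => k; rewrite mxE; have [_ ->] := hC k.
    have s0 : (0 : R) <= 0 <= (1 : R) by rewrite lexx ler01.
    pose F := `[0, 1]%classic `&` [set s | E' (\row_k (C k).[s])].
    have mF : measurable F.
      apply: measurableI => //.
      apply: (bE' _ (measurableTypeR R) (fun s => \row_k (C k).[s])) => k.
      under eq_fun do rewrite mxE.
      by apply: continuous_measurable_fun; exact: continuous_horner.
    apply: (remez (1 - tau) C) (mF) _ _ _ => //.
    - by rewrite gE.
    - by move=> k; have [] := hC k.
    - by move=> s s01; rewrite gE//; exact/KL/gK.
    - move=> k t u t01 u01; have [_ hk] := hC k; rewrite -!hk//.
      by apply: coord_le_diam => //; exact: gK.
    - by rewrite subr_gt0.
    (* The curve lies in K, so the time not spent in K \ E' is spent in E'. *)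
    pose H := `[0%R, 1%R]%classic `&` [set s | (K `\` E') (g s)].
    have HE : `[0%R, 1%R]%classic `\` F = H.
      apply/seteqP; split => s [s01 h]; split => //.
        have s01' : 0 <= s <= 1 by move: s01; rewrite /= in_itv.
        by split; [exact: gK|move=> Es; apply: h; split => //; rewrite /= gE].
      have s01' : 0 <= s <= 1 by move: s01; rewrite /= in_itv.
      by move=> [_ /=]; rewrite gE//; apply: h.2.
    have mH : measurable H by rewrite -HE; exact: measurableD.
    have u01 : lebesgue_measure (`[0%R, 1%R]%classic : set R) = 1%:E.
      by rewrite lebesgue_measure_itv /= lte_fin ltr01 oppr0 adde0.
    have : (1%:E <= lebesgue_measure F + tau%:E)%E.
      rewrite -u01; apply: le_trans (leeD (lexx _) hH).
      have hU : (lebesgue_measure (F `|` H) <= lebesgue_measure F + lebesgue_measure H)%E.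
        exact: measureU2.
      apply: le_trans hU; apply: le_measure; rewrite ?inE //; first exact: measurableU.
      by move=> s s01; have [Fs|nFs] := pselect (F s); [left|right; rewrite -HE].
    by rewrite EFinB leeBlDr.
  (* For lam = 0 every tau > 0 is allowed, and 1 - tau tends to 1. *)
  have [lamz|lampos] := eqVneq lam 0.
    have xz : x = 0 by rewrite /x lamz powR0// gt_eqF.
    rewrite xz subr0 expr1n mulr1.
    have a0 : 0 < `|f w| by exact: lt_le_trans b00 bK.
    have Na0 : 0 <= N%:R * `|f w| by apply: mulr_ge0.
    apply/ler_addgt0Pr => e e0.
    pose tau := Num.min (1 / 2) (e / (N%:R * `|f w| + 1)).
    have Na1 : 0 < N%:R * `|f w| + 1 by rewrite ltr_wpDl.
    have tau0 : 0 < tau by rewrite lt_min !divr_gt0.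
    have tau1 : tau <= 1 / 2 by rewrite ge_min lexx.
    have tau2 : tau * (N%:R * `|f w| + 1) <= e by rewrite -ler_pdivlMr// ge_min lexx orbT.
    have tau3 : tau < 1 by lra.
    have hV : V * lam <= c * tau ^+ p.
      by rewrite lamz mulr0; apply: mulr_ge0; [exact: ltW|exact/exprn_ge0/ltW].
    have h1 := curve tau tau0 tau3 hV.
    have t01 : 0 <= tau <= 1 by rewrite !ltW.
    have h2 := ler_wpM2l (ltW a0) (bernoulli N t01).
    apply: (@le_trans _ _ (`|f w| * (1 - N%:R * tau) + tau * (N%:R * `|f w| + 1))).
      by clear -tau0; lra.
    by apply: lerD => //; exact: le_trans h2 h1.
  have lampos' : 0 < lam by rewrite lt_def lampos.
  (* Here tau = x = lam^nu: V lam <= c sqrt(lam) because lam <= lam0, and sqrt(lam) <= x^p because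
     nu p <= 1/2. *)
  apply: curve => //; first exact: powR_gt0.
  have sq : Num.sqrt lam <= c / V.
    rewrite -[c / V]ger0_norm ?divr_ge0 ?(ltW c0) ?(ltW VKpos)// -sqrtr_sqr.
    by rewrite ler_wsqrtr.
  have hp : Num.sqrt lam <= x ^+ p.
    rewrite -powR12_sqrt// -powR_mulrn// /x -powRrM; apply: ger_powR.
      by rewrite lampos' ltW.
    by rewrite -div1r.
  apply: (@le_trans _ _ (c * Num.sqrt lam)); last by rewrite ler_wpM2l ?(ltW c0).
  rewrite -[in leLHS](sqr_sqrtr lamge0) expr2 mulrA ler_wpM2r ?sqrtr_ge0//.
  by rewrite mulrC -ler_pdivlMr.
have hE : ((vol E)%:E <= lebesgue_rV E')%E by rewrite -VE' volE.
have [v Kv [mF hF]] := segment_through_set cK (fun y => @hrho w y Kw) rho0 bE' E'K VE0 hE.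
pose C (k : 'I_n.+1) : {poly R} := (w 0 k)%:P + (v 0 k - w 0 k) *: 'X.
have CE s : \row_k (C k).[s] = w + s *: (v - w).
  by apply/rowP => k; rewrite !mxE /C hornerD hornerC hornerZ hornerX mulrC.
have SE : [set s | E' (\row_k (C k).[s])] = [set s | E' (w + s *: (v - w))].
  by apply/funext => s; rewrite /= CE.
have CkE k s : (C k).[s] = w 0 k + (v 0 k - w 0 k) * s.
  by rewrite /C hornerD hornerC hornerZ hornerX.
set m := vol E / _ in hF.
have m0 : 0 < m.
  by apply: divr_gt0 => //; apply: mulr_gt0 => //; apply: exprn_gt0; exact: mulr_gt0.
have mE' : m = c' * (1 - lam).
  by rewrite /m /c' mulrAC mulrBr mulr1 -VlamE subKr.
have xm : 1 - x <= m.
  have lampos : 0 < lam by exact: lt_trans lamgt.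
  apply: (le_trans (one_sub_powR_le lampos (ltW nu0))); rewrite mE'.
  have -> : lam^-1 - 1 = (1 - lam) / lam by rewrite mulrBl mul1r divff// gt_eqF.
  rewrite mulrCA mulrC ler_wpM2r ?subr_ge0 ?(ltW lam1)// ler_pdivrMr//.
  by apply: (le_trans nu2); rewrite ler_wpM2l ?(ltW c'0)// ltW.
apply: (@le_trans _ _ (`|f w| * m ^+ N)).
  by rewrite ler_wpM2l// lerXn2r// nnegrE ?subr_ge0 ltW.
apply: (remez m C) => //.
- by rewrite CE scale0r addr0.
- move=> k; apply: (leq_trans (size_polyD _ _)); rewrite geq_max.
  rewrite (leq_trans (size_polyC_leq1 _))//=.
  by apply: (leq_trans (size_scale_leq _ _)); rewrite size_polyX.
- by move=> s s01; rewrite CE; apply: convex_set_segment => //; exact: KL.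
- move=> k t u t01 u01; rewrite !CkE opprD addrACA subrr add0r -mulrBr normrM.
  have h1 : `|v 0 k - w 0 k| <= diam K by exact: coord_le_diam.
  have h2 : `|t - u| <= 1 by rewrite ler_norml; lra.
  by rewrite -[diam K]mulr1; apply: ler_pM.
- by rewrite SE.
- by rewrite SE.
Qed.
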